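(* Let $s\ge1$. There are constants $C_4,c_4>0$ such that for all integers $0=n_0<n_1<\dots<n_s$ and all unit cubes $\mathcal Q_1,\dots,\mathcal Q_s\subset\mathbb R^d$ centered at $z_1,\dots,z_s$, with $z_0=0\in\mathbb R^d$, $$\mu\left(\tau_{n_j}\in\mathcal Q_j\text{ for }j=1,\dots,s\right)\le\prod_{j=1}^s\left[\frac{C_4}{(n_j-n_{j-1})^{d/2}}\,e^{-c_4\frac{|z_j-z_{j-1}|^2}{n_j-n_{j-1}}}\right].$$
   Context: $(\Sigma,\sigma)$ is a subshift of finite type, $\mu$ is a Gibbs measure (for a Hölder potential), and $\tau:\Sigma\to\mathbb R^d$ is a Hölder function of zero mean, $\mu(\tau)=0$. It is assumed that for each $\mathbf a\in\mathbb R^d\setminus\{0\}$ the function $\langle\mathbf a,\tau\rangle$ is not a coboundary (not of the form $u\circ\sigma-u$ with $u$ continuous). $\tau_N=\sum_{n=0}^{N-1}\tau\circ\sigma^n$.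
   Formalization: The subshift of finite type is assumed topologically transitive (irreducible transition matrix); without this the bound fails, e.g. for two disjoint full shifts on which τ has opposite nonzero means. *)

(* Defs.v *)
From HB Require Import structures.
From mathcomp Require Import all_boot all_order all_algebra.
From mathcomp Require Import all_classical all_reals all_analysis.

Set Implicit Arguments.
Unset Strict Implicit.
Unset Printing Implicit Defensive.

Import Order.TTheory GRing.Theory Num.Theory.
Import numFieldNormedType.Exports.

Local Open Scope classical_set_scope.
Local Open Scope ring_scope.

(* A nonempty finite alphabet with an irreducible 0-1 transition matrix [adj].
   Irreducibility is topological transitivity of the shift; it includes the
   aperiodic (topologically mixing) case. *)
Record transition : Type := Transition {
  alphabet : finType;
  adj : rel alphabet;
  letter0 : alphabet;
  adj_irreducible : forall a b : alphabet,
    exists p : seq alphabet, [/\ p != [::], path adj a p & last a p = b]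
}.

Section Sft.
Variable M : transition.

Definition admissible :
    set (prod_topology (fun _ : int => discrete_topology (alphabet M))) :=
  [set x | forall i : int, adj (x i) (x (i + 1))].

(* The two-sided subshift. Its topology is the library's subtype topology,
   induced by the product of discrete topologies. *)
Definition sft : Type := set_type admissible.

HB.instance Definition _ := Topological.copy sft (set_type admissible).

Definition letter (x : sft) (i : int) : alphabet M := set_val x i.

Lemma letterP (x : sft) (i : int) : adj (letter x i) (letter x (i + 1)).
Proof. by case: x => x /= xA; rewrite /letter /=; exact: (set_mem xA i). Qed.

Definition mk_sft (x : int -> alphabet M)
    (xP : forall i : int, adj (x i) (x (i + 1))) : sft :=
  SigSub (mem_set (xP : admissible x)).

(* Irreducibility yields a loop through [letter0], hence a periodic point. *)
Lemma sft_inhabited : exists _ : sft, True.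
Proof.
have [p [p0 pp lp]] := adj_irreducible (letter0 M) (letter0 M).
have sp : (0 < size p)%N by rewrite lt0n size_eq0.
have stepP (j : nat) : (j < size p)%N ->
    adj (nth (letter0 M) p j) (nth (letter0 M) p (j.+1 %% size p)%N).
  move=> jp; move/(pathP (letter0 M)) : pp => pp.
  have [jp1|jp1] := ltnP j.+1 (size p).
    by rewrite modn_small//; exact: (pp j.+1 jp1).
  have js : j.+1 = size p by apply/eqP; rewrite eqn_leq jp jp1.
  rewrite js modnn; have <- : last (letter0 M) p = nth (letter0 M) p j.
    by rewrite -nth_last -js.
  by rewrite lp; exact: (pp 0%N sp).
have xP (i : int) : adj (nth (letter0 M) p (absz (i %% (size p)%:Z)%Z))
    (nth (letter0 M) p (absz ((i + 1) %% (size p)%:Z)%Z)).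
  have p0z : (size p)%:Z != 0 by rewrite -lt0n.
  have i0 := modz_ge0 i p0z.
  have ip : (i %% (size p)%:Z < (size p)%:Z)%Z.
    by have := ltz_mod i p0z; rewrite ger0_norm.
  have -> : absz ((i + 1) %% (size p)%:Z)%Z =
      ((absz (i %% (size p)%:Z)%Z).+1 %% size p)%N.
    rewrite -modzDml -(gez0_abs i0) -PoszD addn1 modz_nat absz_nat.
    by rewrite absz_nat.
  by apply: stepP; rewrite -ltz_nat gez0_abs.
by exists (mk_sft xP).
Qed.

HB.instance Definition _ := isPointed.Build sft (sval (cid sft_inhabited)).

(* The Borel sigma-algebra. *)
HB.instance Definition _ :=
  Measurable.copy sft (g_sigma_algebraType (@open sft)).

Definition sft_shift (x : sft) : sft :=
  mk_sft (fun i : int => letterP x (i + 1)).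

(* [cylinder x n] = { y | y_0 ... y_{n-1} = x_0 ... x_{n-1} } *)
Definition cylinder (x : sft) (n : nat) : set sft :=
  [set y | forall k : nat, (k < n)%N -> letter y k%:Z = letter x k%:Z].

Definition birkhoff (V : nmodType) (f : sft -> V) (n : nat) (x : sft) : V :=
  \sum_(k < n) f (iter k sft_shift x).

Variable R : realType.

(* Hoelder continuity for the shift metrics theta ^ (min {|i| : x_i <> y_i});
   the Hoelder exponent is absorbed in theta. *)
Definition holder (V : normedModType R) (f : sft -> V) : Prop :=
  exists C theta : R, [/\ 0 < theta, theta < 1 &
    forall (k : nat) (x y : sft),
      (forall i : int, (absz i < k)%N -> letter x i = letter y i) ->
      `|f x - f y| <= C * theta ^+ k].

Definition coboundary (g : sft -> R) : Prop :=
  exists2 u : sft -> R, continuous u & forall x, g x = u (sft_shift x) - u x.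

Definition shift_invariant (mu : probability sft R) : Prop :=
  forall A : set sft, measurable A -> mu (sft_shift @^-1` A) = mu A.

(* Bowen's definition; [P] is necessarily the pressure of [phi]. *)
Definition gibbs (phi : sft -> R) (mu : probability sft R) : Prop :=
  shift_invariant mu /\
  exists P c1 c2 : R, [/\ 0 < c1, 0 < c2 &
    forall (x : sft) (n : nat),
      ((c1 * expR (birkhoff phi n x - P * n%:R))%:E <= mu (cylinder x n) /\
       mu (cylinder x n) <= (c2 * expR (birkhoff phi n x - P * n%:R))%:E)%E].

End Sft.

Section Euclidean.
Variables (R : realType) (d : nat).

Definition dotv (a v : 'rV[R]_d) : R := \sum_(i < d) a 0 i * v 0 i.

(* The library's norm on matrices is the sup norm. *)
Definition enorm (v : 'rV[R]_d) : R := Num.sqrt (dotv v v).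

Definition unit_cube (z : 'rV[R]_d) : set 'rV[R]_d :=
  [set v | forall i : 'I_d, `|v 0 i - z 0 i| <= 2^-1].

End Euclidean.

(* Main.v *)
Require Import Defs.
From mathcomp Require Import all_boot all_order all_algebra.
From mathcomp Require Import all_classical all_reals all_analysis.
From mathcomp Require Import measurable_realfun.
From mathcomp Require Import ring lra zify.

Set Implicit Arguments.
Unset Strict Implicit.
Unset Printing Implicit Defensive.

Import Order.TTheory GRing.Theory Num.Theory.
Import numFieldNormedType.Exports.

Local Open Scope classical_set_scope.
Local Open Scope ring_scope.

(** Local limit upper bounds are usually obtained from the spectral theory of
    twisted transfer operators.  The proof below replaces it by elementary
    estimates for transfer operators acting on functions of finite words.

    Words.  A Gibbs measure gives the cylinder of a word [u] of length [n] a mass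
    comparable to [expR (E u - P * n)], where the energy [E u] is the Birkhoff
    sum of the potential at a canonical point of the cylinder; the Birkhoff sums
    of the coordinates of [tau] are, up to bounded errors, energies of words as
    well.  All these energies are [fading]: the increment due to a new letter is
    bounded and depends exponentially little on the distant past
    ([energy_fading]).  Probabilities of events that are read off the words are
    thereby bounded by weighted sums over words ([transfer], [part_le]), and the
    normalised weights are the transition probabilities of a chain that forgets
    its past exponentially fast ([trans_chain]).  Periodic graphs are allowed,
    so that two pasts can be compared only if their most recent letters lie in
    the same cyclic class ([compat]).

    One block.  The claim for one block, uniform in the past, is
    [energy_local_bound]: the conditional probability that the energies of
    [tau] increase by [z], up to a constant, during [m] letters is at most
    [C m ^ (- d / 2) exp (- c |z| ^ 2 / m)].  It is derived as follows.
    - Averaging over the next letters contracts a norm that combines oscillation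
      and regularity ([avg_contraction]).  The conditional means therefore
      have bounded martingale differences, which gives Gaussian exponential
      moments ([partfn_tilt_le]).
    - The conditional characteristic functions are iterated averages twisted by
      small rotations.  If from every past two continuations have very different
      energies, they interfere destructively, and the characteristic function at
      a small frequency [t] decays like [exp (- c m t ^ 2)] ([wave_decay]).
    - A Fejer kernel turns this decay into the bound [C m ^ (- d / 2)] for the
      probability of a box, for every fading energy ([concentration]).  Applying
      it after an exponential change of measure, which is again given by a fading
      energy, adds the Gaussian factor ([local_bound]).

    Hypotheses on [tau].  A regular function whose Birkhoff sums are bounded above
    satisfies [f x <= h (sigma x) - h x] for some continuous [h]
    ([subaction_exists]); if moreover it has zero mean, equality holds because a
    Gibbs measure has full support, and the function is a coboundary
    ([combination_coboundary]).  Hence, in every direction, the energies of [tau]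
    are unbounded above, but do not drift, since the mean is zero.  Repeating
    loops with different mean energies yields continuations with very different
    energies, uniformly in the direction by compactness ([loops_spread]).  The
    zero mean also implies that the conditional means over [m] letters are
    [O (sqrt m)] ([mean_small]), so that the exponential moments are those of a
    centred variable.

    Several blocks.  Since the bound for one block holds for every past, the
    blocks are treated one after the other, starting with the last one
    ([visits_bound]). *)

(** * Elementary inequalities *)

Section RealBounds.
Variable R : realType.
Implicit Types x y t : R.

Lemma expR_le_quad x : x <= 2^-1 -> expR x <= 1 + x + 2 * x ^+ 2.
Proof.
move=> x2; have e0 := expR_gt0 x.
have e1 : expR x * (1 - x) <= 1.
  have e2 : expR x * expR (- x) = 1 by rewrite expRN mulfV ?gt_eqF.
  by rewrite -[leRHS]e2 (ler_wpM2l (ltW e0))//; exact: expR_ge1Dx.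
have h : 1 <= (1 + x + 2 * x ^+ 2) * (1 - x).
  have x3 : 0 <= 1 - 2 * x by lra.
  have := mulr_ge0 (sqr_ge0 x) x3; lra.
have x1 : 0 < 1 - x by lra.
by rewrite -(ler_pM2r x1); lra.
Qed.

Lemma expR_sub1_le x : expR x - 1 <= x * expR x.
Proof.
have e0 := expR_gt0 x; have := expR_ge1Dx (- x).
rewrite expRN -(ler_pM2r e0) mulVf ?gt_eqF//; lra.
Qed.

Lemma one_le_expR x : 0 <= x -> 1 <= expR x.
Proof. by move=> x0; rewrite -[leLHS]expR0 ler_expR. Qed.

Lemma norm_sin_le x : `|sin x| <= `|x|.
Proof.
wlog x0 : x / 0 < x.
  move=> H; case: (ltgtP x 0) => [xn|xp|->]; last by rewrite sin0.
    by have := H (- x); rewrite oppr_gt0 sinN !normrN; exact.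
  exact: H.
have [] := @MVT R sin cos 0 x x0 (fun z _ => is_derive_sin z).
  by apply: continuous_subspaceT; exact: continuous_sin.
move=> c _; rewrite sin0 !subr0 => ->.
by rewrite normrM ler_piMl// cos_max.
Qed.

Lemma one_sub_cosE x : 1 - cos x = 2 * sin (x / 2) ^+ 2.
Proof.
have -> : cos x = cos ((x / 2) *+ 2) by congr (cos _); rewrite -mulr_natr; lra.
rewrite cos_mulr2n sin2cos2 mulr2n; lra.
Qed.

Lemma cos_ge_half x : `|x| <= 1 -> 2^-1 <= cos x.
Proof.
move=> x1; have := one_sub_cosE x.
have : sin (x / 2) ^+ 2 <= (1 / 2) ^+ 2.
  rewrite -[leLHS]real_normK ?num_real// ler_sqr ?nnegrE//.
  apply: (le_trans (norm_sin_le _)); rewrite normrM (ger0_norm (x := 2^-1))//.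
  lra.
lra.
Qed.

Lemma sin_ge_half x : 0 <= x <= 1 -> x / 2 <= sin x.
Proof.
move=> /andP[x0 x1]; move: x0; rewrite le_eqVlt => /predU1P[<-|x0].
  by rewrite sin0 mul0r.
have [] := @MVT R sin cos 0 x x0 (fun z _ => is_derive_sin z).
  by apply: continuous_subspaceT; exact: continuous_sin.
move=> c; rewrite in_itv/= => /andP[c0 cx]; rewrite sin0 !subr0 => ->.
rewrite [leLHS]mulrC (ler_wpM2r (ltW x0))// cos_ge_half// ger0_norm; lra.
Qed.

Lemma one_sub_cos_ge x : `|x| <= 1 -> x ^+ 2 / 8 <= 1 - cos x.
Proof.
wlog x0 : x / 0 <= x.
  move=> H; case: (leP 0 x) => [/H//|xn].
  by have := H (- x); rewrite oppr_ge0 ltW// cosN sqrrN normrN; exact.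
rewrite ger0_norm// => x1; rewrite one_sub_cosE.
have : (x / 4) ^+ 2 <= sin (x / 2) ^+ 2.
  rewrite ler_sqr ?nnegrE; [|lra|].
    have := @sin_ge_half (x / 2); lra.
  have := @sin_ge_half (x / 2); lra.
nra.
Qed.

Lemma one_sub_cos_le x : 1 - cos x <= x ^+ 2 / 2.
Proof.
rewrite one_sub_cosE; have : sin (x / 2) ^+ 2 <= (x / 2) ^+ 2.
  rewrite -[leLHS]real_normK ?num_real// -[leRHS]real_normK ?num_real//.
  by rewrite ler_sqr ?nnegrE// norm_sin_le.
nra.
Qed.

Lemma geometric_sum_le (r : R) n : 0 <= r < 1 ->
  \sum_(i < n) r ^+ i <= (1 - r)^-1.
Proof.
move=> /andP[r0 r1]; have := subrX1 r n => H.
have r1' : 0 < 1 - r by lra.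
have -> : \sum_(i < n) r ^+ i = (1 - r ^+ n) / (1 - r).
  apply: (mulIf (lt0r_neq0 r1')); rewrite mulfVK ?gt_eqF//.
  by rewrite -[LHS]opprK -mulrN opprB mulrC -H opprB.
rewrite ler_pdivrMr// mulVf ?gt_eqF//.
by rewrite gerBl exprn_ge0.
Qed.

Lemma exprn_small (r e : R) : 0 <= r < 1 -> 0 < e -> exists n, r ^+ n <= e.
Proof.
move=> r01 e0; have /andP[r0 r1] := r01.
have r1' : 0 < 1 - r by rewrite subr_gt0.
set y := (e * (1 - r))^-1; have y0 : 0 <= y by rewrite invr_ge0 mulr_ge0 ?ltW.
exists (Num.bound y); set n := Num.bound y.
have yn : y < n%:R := archi_boundP y0.
have n0 : 0 < n%:R :> R by apply: le_lt_trans yn.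
have : n%:R * r ^+ n <= (1 - r)^-1.
  apply: le_trans (geometric_sum_le n r01).
  have -> : n%:R * r ^+ n = \sum_(i < n) r ^+ n by rewrite sumr_const card_ord mulr_natl.
  by apply: ler_sum => i _; rewrite ler_wiXn2l ?(ltnW (ltn_ord i))// ltW.
rewrite -ler_pdivlMl// => /le_trans; apply.
rewrite -invfM -[leRHS]invrK lef_pV2 ?posrE ?mulr_gt0 ?invr_gt0//.
move: yn; rewrite /y invfM -ltr_pdivlMr ?invr_gt0// invrK => /ltW.
by [].
Qed.

(** A discrete Gaussian of any centre is dominated by a two-sided geometric
    sequence, as [p <= p ^ 2] for every natural number [p]. *)
Lemma gauss_sum_le (b : R) (n j : nat) : 0 < b ->
  \sum_(k < n) expR (- (b * (j%:R - k%:R) ^+ 2)) <= 2 / (1 - expR (- b)).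
Proof.
move=> b0; set r := expR (- b).
have r01 : 0 <= r < 1 by rewrite expR_ge0/= -expR0 ltr_expR oppr_lt0.
have /andP[r0 /ltW r1] := r01.
have dist_sum i m : \sum_(k < m) r ^+ (i - k + (k - i)) <=
    \sum_(k < m) r ^+ k + \sum_(k < i) r ^+ k.
  have pos l : 0 <= \sum_(k < l) r ^+ k by apply: sumr_ge0 => k _; exact: exprn_ge0.
  elim: i m => [|i IH] [|m]; rewrite ?big_ord0 ?addr0 ?add0r//.
    by apply: ler_sum => k _; rewrite sub0n subn0.
  rewrite big_ord_recl subn0 sub0n addn0 exprS.
  under eq_bigr do rewrite subSS subSS.
  rewrite ![in leRHS]big_ord_recr /=.
  have : r * r ^+ i <= r ^+ i by rewrite ler_piMl// exprn_ge0.
  have := exprn_ge0 m r0; have := IH m; lra.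
apply: (@le_trans _ _ (\sum_(k < n) r ^+ (j - k + (k - j)))).
  apply: ler_sum => k _; set p := (j - k + _)%N.
  have -> : (j%:R - k%:R : R) ^+ 2 = p%:R ^+ 2.
    rewrite /p; case: (leqP j k) => jk.
      by rewrite natrD (natrB _ jk) (eqP jk); ring.
    by rewrite natrD (natrB _ (ltnW jk)) (eqP (ltnW jk)); ring.
  rewrite -expRM_natl ler_expR mulrN lerN2 [leLHS]mulrC (ler_wpM2l (ltW b0))//.
  by rewrite -natrX ler_nat; case: p => // p; rewrite expnS leq_pmulr// expn_gt0.
apply: le_trans (dist_sum j n) _.
by have := geometric_sum_le n r01; have := geometric_sum_le j r01; lra.
Qed.

Lemma nat_sqrt m : (0 < m)%N -> exists J, [/\ (0 < J)%N, (m <= J ^ 2)%N & (J ^ 2 <= 4 * m)%N].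
Proof.
case: m => // m _; elim: m => [|m [J [J0 h1 h2]]]; first by exists 1%N.
have [h|h] := leqP m.+2 (J ^ 2); first by exists J; split => //; lia.
by exists J.+1; split => //; nia.
Qed.

End RealBounds.

Section Plane.
Variable R : realType.

(** The complex plane as a real module: [rot t] is the multiplication by
    [exp (i t)]. *)
Definition plane : lmodType R := (R^o * R^o)%type.

Implicit Types z w : plane.

Definition pnorm z : R := Num.sqrt (z.1 ^+ 2 + z.2 ^+ 2).

Definition rot (t : R) z : plane :=
  (z.1 * cos t - z.2 * sin t, z.1 * sin t + z.2 * cos t).

Lemma pnorm_ge0 z : 0 <= pnorm z. Proof. exact: sqrtr_ge0. Qed.

Lemma pnormE z : pnorm z ^+ 2 = z.1 ^+ 2 + z.2 ^+ 2.
Proof. by rewrite sqr_sqrtr// addr_ge0// sqr_ge0. Qed.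

Lemma pnorm_le z (b : R) : 0 <= b -> (pnorm z <= b) = (z.1 ^+ 2 + z.2 ^+ 2 <= b ^+ 2).
Proof. by move=> b0; rewrite -pnormE ler_sqr ?nnegrE ?pnorm_ge0. Qed.

Lemma pnormD z w : pnorm (z + w) <= pnorm z + pnorm w.
Proof.
rewrite pnorm_le ?addr_ge0 ?pnorm_ge0//=.
rewrite [leRHS]sqrrD !pnormE -mulr_natr.
suff : z.1 * w.1 + z.2 * w.2 <= pnorm z * pnorm w by nra.
apply: le_trans (ler_norm _) _.
rewrite -ler_sqr ?nnegrE ?mulr_ge0 ?pnorm_ge0// real_normK ?num_real//.
rewrite exprMn !pnormE.
have := sqr_ge0 (z.1 * w.2 - z.2 * w.1); nra.
Qed.

Lemma pnormZ (a : R) z : pnorm (a *: z) = `|a| * pnorm z.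
Proof.
apply/eqP; rewrite -(@eqrXn2 _ 2) ?mulr_ge0 ?pnorm_ge0//.
rewrite exprMn !pnormE real_normK ?num_real//=; apply/eqP.
by rewrite /GRing.scale/=; ring.
Qed.

Lemma pnorm_rot (t : R) z : pnorm (rot t z) = pnorm z.
Proof.
apply/eqP; rewrite -(@eqrXn2 _ 2) ?pnorm_ge0// !pnormE/=; apply/eqP.
have := cos2Dsin2 t => h.
transitivity ((z.1 ^+ 2 + z.2 ^+ 2) * (cos t ^+ 2 + sin t ^+ 2)); first by ring.
by rewrite h mulr1.
Qed.

Lemma pnormN z : pnorm (- z) = pnorm z.
Proof. by rewrite -scaleN1r pnormZ normrN1 mul1r. Qed.

Lemma rotB (t : R) z w : rot t (z - w) = rot t z - rot t w.
Proof. by rewrite /rot; congr pair => /=; ring. Qed.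

Lemma rotD (t : R) z w : rot t (z + w) = rot t z + rot t w.
Proof. by rewrite /rot; congr pair => /=; ring. Qed.

Lemma rotZ (t a : R) z : rot t (a *: z) = a *: rot t z.
Proof. by rewrite /rot /GRing.scale/= /scale_pair/=; congr pair; rewrite /GRing.scale/=; ring. Qed.

Lemma rot_rot (s t : R) z : rot s (rot t z) = rot (s + t) z.
Proof. by rewrite /rot/= cosD sinD; congr pair; ring. Qed.

Lemma rot0 z : rot 0 z = z.
Proof. by case: z => a b; rewrite /rot cos0 sin0/=; congr pair; ring. Qed.

Lemma pnorm_rot_sub (t : R) z : pnorm (rot t z - z) ^+ 2 = 2 * (1 - cos t) * pnorm z ^+ 2.
Proof.
rewrite !pnormE/=; have := cos2Dsin2 t => h.
transitivity ((z.1 ^+ 2 + z.2 ^+ 2) * (cos t ^+ 2 + sin t ^+ 2 + 1 - 2 * cos t)).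
  by ring.
by rewrite h; ring.
Qed.

Lemma pnorm_rot_sub_le (t : R) z : pnorm (rot t z - z) <= `|t| * pnorm z.
Proof.
rewrite -ler_sqr ?nnegrE ?mulr_ge0 ?pnorm_ge0// pnorm_rot_sub exprMn.
rewrite real_normK ?num_real// ler_wpM2r ?sqr_ge0//.
have := one_sub_cos_le t; lra.
Qed.

Lemma pnorm_rot_sub_ge (t : R) z : `|t| <= 1 -> `|t| / 2 * pnorm z <= pnorm (rot t z - z).
Proof.
move=> t1; rewrite -ler_sqr ?nnegrE ?mulr_ge0 ?pnorm_ge0// pnorm_rot_sub exprMn.
rewrite ler_wpM2r ?sqr_ge0// exprMn real_normK ?num_real//.
have := one_sub_cos_ge t1; lra.
Qed.

(** The parallelogram law: two vectors of the disc of radius [s] at a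
    distance [d * s] have a sum shorter than [2 * s] by a proportion quadratic
    in [d]. *)
Lemma pnorm_add_lt (s d : R) z w : 0 < s -> 0 <= d -> pnorm z <= s -> pnorm w <= s ->
  d * s <= pnorm (z - w) -> pnorm (z + w) <= 2 * s * (1 - d ^+ 2 / 8).
Proof.
move=> s0 d0 zs ws zw.
have h1 : pnorm (z + w) ^+ 2 = 2 * pnorm z ^+ 2 + 2 * pnorm w ^+ 2 - pnorm (z - w) ^+ 2.
  by rewrite !pnormE/=; ring.
have z2 : pnorm z ^+ 2 <= s ^+ 2 by rewrite ler_sqr ?nnegrE ?pnorm_ge0// ltW.
have w2 : pnorm w ^+ 2 <= s ^+ 2 by rewrite ler_sqr ?nnegrE ?pnorm_ge0// ltW.
have zw2 : (d * s) ^+ 2 <= pnorm (z - w) ^+ 2.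
  by rewrite ler_sqr ?nnegrE ?pnorm_ge0// mulr_ge0// ltW.
have d2 : d ^+ 2 <= 4.
  have : (d * s) ^+ 2 <= 4 * s ^+ 2 by have := sqr_ge0 (pnorm (z + w)); lra.
  by rewrite exprMn ler_pM2r// exprn_gt0.
rewrite -ler_sqr ?nnegrE ?pnorm_ge0//; last first.
  by rewrite mulr_ge0 ?mulr_ge0 ?(ltW s0)//; lra.
rewrite h1; move: zw2; rewrite !exprMn => zw2.
have s2 : 0 < s ^+ 2 by rewrite exprn_gt0.
have := sqr_ge0 (d ^+ 2 / 8); set e := d ^+ 2 in d2 zw2 *.
nra.
Qed.

End Plane.

(** * Words of a transitive graph *)

Section Graph.
Variable M : transition.
Local Notation A := (alphabet M).
Implicit Types (a b c : A) (u v w t : seq A) (n m j k : nat).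

Fixpoint reach n a b : Prop :=
  if n is k.+1 then exists2 c, adj a c & reach k c b else a = b.

Lemma reach_add n m a b c : reach n a b -> reach m b c -> reach (n + m) a c.
Proof.
elim: n a => [|n IH] a /=; first by move=> ->.
by case=> d ad dn bm; exists d => //; exact: IH.
Qed.

Lemma reach_pos a b : exists n, reach n.+1 a b.
Proof.
have [p [p0 pp <-]] := adj_irreducible a b.
case: p p0 pp => // d p _ /= /andP[ad dp]; exists (size p); exists d => //.
elim: p d {ad} dp => //= e p IH d /andP[de ep]; exists e => //; exact: IH.
Qed.

Lemma succ_exists a : exists b, adj a b.
Proof. by have [n /= [b]] := reach_pos a a; exists b. Qed.

Lemma reach_last n a b : reach n.+1 a b -> exists2 c, reach n a c & adj c b.
Proof.
elim: n a => [|n IH] a /=; first by case=> c ac <-; exists a.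
case=> c ac [d cd db].
have /IH[e ce eb] : reach n.+1 c b by exists d.
by exists e => //; exists c.
Qed.

Lemma pred_exists a : exists b, adj b a.
Proof. by have [n /reach_last[b _ ba]] := reach_pos a a; exists b. Qed.

Lemma reach_loops n k a : reach n a a -> reach (k * n) a a.
Proof. by move=> r; elim: k => //= k IH; rewrite mulSn; exact: reach_add IH. Qed.

Definition meet n a b := exists2 c, reach n a c & reach n b c.

(** Two letters are compatible when they lie in the same cyclic class of the
    graph; words can be coupled only if their most recent letters are. *)
Definition compat a b := exists n, meet n a b.

Lemma meet_le n m a b : (n <= m)%N -> meet n a b -> meet m a b.
Proof.
move=> /subnK <-; elim: (m - n)%N => //= k IH /IH[c ac bc].
have [d cd] := succ_exists c.
exists d; rewrite addSn -addn1; apply: (@reach_add _ 1 _ c) => //; exists d => //.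
Qed.

Lemma compat_refl a : compat a a.
Proof. by exists 0%N; exists a. Qed.

(** Going once around a loop through [a] (resp. [b]) brings the successor back
    to [a] (resp. [b]); running the two loops enough times equalises the
    travelled lengths. *)
Lemma compat_step a b a' b' :
  compat a b -> adj a a' -> adj b b' -> compat a' b'.
Proof.
case=> n [c ac bc] aa bb.
have [q ra] := reach_pos a' a; have [q' rb] := reach_pos b' b.
have la : reach q.+2 a a by exists a'.
have lb : reach q'.+2 b b by exists b'.
exists ((q.+1 + q'.+1 * q.+2) + n)%N; exists c.
  apply: (@reach_add _ _ _ a) => //; apply: (@reach_add _ _ _ a) => //.
  exact: reach_loops.
have -> : (q.+1 + q'.+1 * q.+2 = q'.+1 + q.+1 * q'.+2)%N by lia.
apply: (@reach_add _ _ _ b) => //; apply: (@reach_add _ _ _ b) => //.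
exact: reach_loops.
Qed.

Lemma meet_uniform : exists N, forall a b, compat a b -> meet N a b.
Proof.
have H (p : A * A) : exists n, compat p.1 p.2 -> meet n p.1 p.2.
  have [[n nH]|h] := pselect (compat p.1 p.2); first by exists n.
  by exists 0%N => /h.
have [f fP] := choice H.
exists (\max_p f p)%N => a b ab.
by apply: meet_le (fP (a, b) ab); exact: (leq_bigmax (a, b)).
Qed.

Lemma reach_uniform : exists N, forall a b,
  exists n, (n < N)%N /\ reach n.+1 a b.
Proof.
have H (p : A * A) : exists n, reach n.+1 p.1 p.2 by exact: reach_pos.
have [f fP] := choice H.
exists (\max_p f p).+1 => a b; exists (f (a, b)); split; last exact: (fP (a, b)).
by rewrite ltnS; exact: (leq_bigmax (a, b)).
Qed.

(** A word is stored most recent letter first, so that reading one more letter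
    is [cons] and a common recent past is a common prefix. *)
Definition adm u := sorted (fun x y => adj y x) u.
Arguments adm : simpl never.

Lemma adm_cons2 a b u : adm [:: a, b & u] = adj b a && adm (b :: u).
Proof. by []. Qed.

Lemma adm_behead a u : adm (a :: u) -> adm u.
Proof. by rewrite /adm; apply: path_sorted. Qed.

Lemma adm_catr u v : adm (u ++ v) -> adm v.
Proof. by elim: u => //= a u IH /adm_behead/IH. Qed.

Lemma adm_catl u v : adm (u ++ v) -> adm u.
Proof.
elim: u => //= a [|b u] IH //; rewrite cat_cons in IH *.
by rewrite !adm_cons2 => /andP[->] /IH.
Qed.

Lemma adm_glue u b v : adm (u ++ [:: b]) -> adm (b :: v) -> adm (u ++ b :: v).
Proof.
elim: u => //= a [|d u] IH; first by rewrite /= !adm_cons2 => /andP[->].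
by move=> /= ; rewrite !adm_cons2 => /andP[-> h1] h2; exact: IH.
Qed.

Lemma adm_ext b u : adm (b :: u) -> exists a, adm [:: a, b & u].
Proof. by move=> bu; have [a ba] := succ_exists b; exists a; rewrite adm_cons2 ba. Qed.

Lemma reach_word n a b : reach n.+1 a b ->
  exists2 q, size q = n & adm (b :: q ++ [:: a]).
Proof.
elim: n b => [|n IH] b; first by case=> c ac <-; exists [::] => //=; rewrite /adm/= ac.
move=> /reach_last[c /IH[q qn qa] cb]; exists (c :: q); first by rewrite /= qn.
by rewrite cat_cons adm_cons2 cb.
Qed.

Lemma pad_exists k c : exists2 q, size q = k & adm (q ++ [:: c]).
Proof.
elim: k => [|k [q qk qa]]; first by exists [::].
case: q qk qa => [|b q] qk qa.
  by have [a ca] := succ_exists c; exists [:: a]; rewrite -?qk// /adm/= ca.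
have [a ba] := adm_ext qa; exists (a :: b :: q) => //=; first by rewrite -qk.
Qed.

Definition share j u v := [&& j <= size u, j <= size v & take j u == take j v]%N.

Lemma share_cons j a u v : share j.+1 (a :: u) (a :: v) = share j u v.
Proof. by rewrite /share /= !ltnS eqseq_cons eqxx. Qed.

Lemma share_sym j u v : share j u v = share j v u.
Proof. by rewrite /share eq_sym; case: (j <= size u)%N; case: (j <= size v)%N. Qed.

Lemma share_inv j u v : (0 < j)%N -> share j u v ->
  exists a u' v', [/\ u = a :: u', v = a :: v' & share j.-1 u' v'].
Proof.
case: j => // j _; case: u => [|a u]; case: v => [|b v]; rewrite /share ?andbF//.
move=> /and3P[h1 h2 /eqP[<- h3]].
by exists a, u, v; split => //; apply/and3P; split => //; apply/eqP.
Qed.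

Lemma share_le i j u v : (i <= j)%N -> share j u v -> share i u v.
Proof.
move=> ij /and3P[h1 h2 /eqP h3]; apply/and3P; split; try exact: leq_trans ij _.
by rewrite -(take_takel _ ij) h3 take_takel.
Qed.

Lemma share_adm a u v j : (0 < j)%N -> share j u v -> adm u -> adm v ->
  adm (a :: u) = adm (a :: v).
Proof.
move=> j0 /(share_inv j0)[b [u' [v' [-> -> _]]]] hu hv.
by rewrite !adm_cons2 hu hv.
Qed.

(** Coupling of two pasts: after [n] well chosen letters, functions that depend
    essentially on the last [J] letters no longer distinguish them. *)
Fixpoint coupled J n u v : Prop :=
  if n is k.+1 then
    exists a b, [/\ adm (a :: u), adm (b :: v) & coupled J k (a :: u) (b :: v)]
  else share J u v.

Lemma coupled_share J i u v : (0 < i)%N -> (i <= J)%N -> adm u -> adm v ->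
  share i u v -> coupled J (J - i) u v.
Proof.
move=> i0 iJ; move: {-2}(J - i)%N (erefl (J - i)%N) => n.
elim: n i u v i0 iJ => [|n IH] i u v i0 iJ ni hu hv s /=.
  by apply: share_le s; lia.
have [b [u' [v' [eu ev _]]]] := share_inv i0 s.
have [a au] : exists a, adm (a :: u) by rewrite eu; apply: adm_ext; rewrite -eu.
have av : adm (a :: v) by rewrite -(share_adm a i0 s hu hv).
exists a, a; split => //; apply: (IH i.+1) => //; try lia.
by rewrite share_cons.
Qed.

Lemma coupled_meet J n a b u v : (0 < J)%N -> adm (a :: u) -> adm (b :: v) ->
  meet n a b -> coupled J (n + J.-1) (a :: u) (b :: v).
Proof.
move=> J0; elim: n a b u v => [|n IH] a b u v hu hv [c ac bc].
  move: ac bc hu hv => /= -> -> hu hv; rewrite add0n -subn1.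
  by apply: coupled_share => //; rewrite share_cons /share/= !take0.
case: ac => a' aa ac; case: bc => b' bb bc.
have ha : adm (a' :: a :: u) by rewrite adm_cons2 aa.
have hb : adm (b' :: b :: v) by rewrite adm_cons2 bb.
by exists a', b'; split => //; apply: IH => //; exists c.
Qed.

(** Compatible letters lead to a common letter in a time bounded over the finite
    alphabet, and from then on both words can be continued in the same way. *)
Lemma coupled_uniform J : (0 < J)%N -> exists2 n, (J <= n.+1)%N &
  forall a b u v, adm (a :: u) -> adm (b :: v) -> compat a b ->
  coupled J n (a :: u) (b :: v).
Proof.
move=> J0; have [N NP] := meet_uniform; exists (N + J.-1)%N; first lia.
move=> a b u v hu hv ab.
by apply: coupled_meet => //; exact: NP.
Qed.

End Graph.

(** * Contraction of averages *)

Arguments adm {M} u : simpl never.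

(** The averages act on real functions for conditional means and on plane-valued
    ones for characteristic functions, hence the abstract seminorm [nrm]. *)
Section Averages.
Variables (R : realType) (M : transition) (rho : R).
Hypothesis rho01 : 0 < rho < 1.
Local Notation A := (alphabet M).
Variables (V : lmodType R) (nrm : V -> R).
Hypothesis nrmD : forall x y, nrm (x + y) <= nrm x + nrm y.
Hypothesis nrmZ : forall (a : R) x, nrm (a *: x) = `|a| * nrm x.
Implicit Types (a b : A) (u v : seq A) (g h : seq A -> V).

Let rho_gt0 : 0 < rho. Proof. by case/andP: rho01. Qed.
Let rho_lt1 : rho < 1. Proof. by case/andP: rho01. Qed.
Let rho_ge0 : 0 <= rho. Proof. exact: ltW. Qed.
Let rho_le1 : rho <= 1. Proof. exact: ltW. Qed.

Lemma nrm0 : nrm 0 = 0.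
Proof. by rewrite -(scale0r (0 : V)) nrmZ normr0 mul0r. Qed.

Lemma nrmN x : nrm (- x) = nrm x.
Proof. by rewrite -scaleN1r nrmZ normrN1 mul1r. Qed.

Lemma nrm_ge0 x : 0 <= nrm x.
Proof. by have := nrmD x (- x); rewrite subrr nrm0 nrmN; lra. Qed.

Lemma nrm_sum (I : finType) (x : I -> V) : nrm (\sum_i x i) <= \sum_i nrm (x i).
Proof.
elim/big_ind2 : _ => //; first by rewrite nrm0.
by move=> x1 x2 y1 y2 h1 h2; apply: le_trans (nrmD _ _) _; exact: lerD.
Qed.

Lemma nrm_mean (I : finType) (p : I -> R) (x : I -> V) (t : R) :
  (forall i, 0 <= p i) -> (forall i, p i != 0 -> nrm (x i) <= t) ->
  nrm (\sum_i p i *: x i) <= (\sum_i p i) * t.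
Proof.
move=> p0 xt; apply: le_trans (nrm_sum _) _; rewrite mulr_suml.
apply: ler_sum => i _; rewrite nrmZ ger0_norm//.
have [->|pi0] := eqVneq (p i) 0; first by rewrite !mul0r.
by rewrite ler_wpM2l// xt.
Qed.

(** Two means with the same total mass are compared by integrating against the
    product of the two mass distributions. *)
Lemma nrm_mean_sub (I : finType) (p q : I -> R) (x y : I -> V) (s t : R) :
  (forall i, 0 <= p i) -> (forall i, 0 <= q i) ->
  \sum_i p i = s -> \sum_i q i = s ->
  (forall i j, p i != 0 -> q j != 0 -> nrm (x i - y j) <= t) ->
  nrm (\sum_i p i *: x i - \sum_i q i *: y i) <= s * t.
Proof.
move=> p0 q0 ps qs xy.
have s0 : 0 <= s by rewrite -ps sumr_ge0.
have [sz|sz] := eqVneq s 0.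
  have pz i : p i = 0.
    by apply: (psumr_eq0P (fun i _ => p0 i) (etrans ps sz)).
  have qz i : q i = 0.
    by apply: (psumr_eq0P (fun i _ => q0 i) (etrans qs sz)).
  rewrite sz mul0r !big1 ?subrr ?nrm0// => i _; rewrite ?pz ?qz scale0r//.
have sp : 0 < s by rewrite lt_neqAle eq_sym sz.
rewrite -(ler_pM2l sp) -{1}(ger0_norm s0) -nrmZ.
have -> : s *: (\sum_i p i *: x i - \sum_i q i *: y i) =
    \sum_i p i *: \sum_j q j *: (x i - y j).
  transitivity (\sum_i p i *: (s *: x i - \sum_j q j *: y j)).
    rewrite scalerBr scaler_sumr -{2}ps scaler_suml -sumrB.
    by apply: eq_bigr => i _; rewrite scalerBr !scalerA mulrC.
  apply: eq_bigr => i _; congr (_ *: _).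
  rewrite -qs scaler_suml -sumrB; apply: eq_bigr => j _; by rewrite scalerBr.
rewrite -{1}ps; apply: nrm_mean => // i pi0.
by rewrite -qs; apply: nrm_mean => // j qj0; exact: xy.
Qed.

Section Chain.
Variables kap Cp : R.
Hypothesis kap01 : 0 < kap <= 1.
Hypothesis Cp0 : 0 <= Cp.

(** The transition probabilities of a chain that remembers its whole past, but
    forgets old letters exponentially fast. *)
Definition chain (p : seq A -> A -> R) :=
  [/\ forall u a, 0 <= p u a,
      forall b u, adm (b :: u) -> \sum_a p (b :: u) a = 1,
      forall u a, ~~ adm (a :: u) -> p u a = 0,
      forall b u a, adm [:: a, b & u] -> kap <= p (b :: u) a &
      forall j u v, (0 < j)%N -> share j u v -> adm u -> adm v ->
        \sum_a `|p u a - p v a| <= Cp * rho ^+ j].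

Definition avg (p : seq A -> A -> R) g u := \sum_a p u a *: g (a :: u).

(** Only compatible words are compared: in a periodic graph, the averages of a
    function may keep different values on different cyclic classes forever. *)
Definition osc t g := forall a b u v, adm (a :: u) -> adm (b :: v) ->
  compat a b -> nrm (g (a :: u) - g (b :: v)) <= t.

Definition hol t g := forall j u v, (0 < j)%N -> share j u v -> adm u -> adm v ->
  nrm (g u - g v) <= t * rho ^+ j.

(** The index counts down: [p k] is the law of the letter that is followed by [k]
    more letters. *)
Fixpoint iavg n (p : nat -> seq A -> A -> R) g :=
  if n is k.+1 then avg (p k) (iavg k p g) else g.

Lemma chain_adm p u a : chain p -> p u a != 0 -> adm (a :: u).
Proof. by case=> _ _ p3 _ _; apply: contraR => /p3 ->. Qed.

Lemma avgB p g h u : avg p (fun w => g w - h w) u = avg p g u - avg p h u.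
Proof. by rewrite -sumrB; apply: eq_bigr => a _; rewrite scalerBr. Qed.

Lemma avgD p g h u : avg p (fun w => g w + h w) u = avg p g u + avg p h u.
Proof. by rewrite -big_split; apply: eq_bigr => a _; rewrite scalerDr. Qed.

Lemma osc_ge0 t g : osc t g -> 0 <= t.
Proof.
pose a := letter0 M; have ha : adm [:: a] by [].
move=> /(_ a a [::] [::] ha ha (compat_refl _)); exact/le_trans/nrm_ge0.
Qed.

Lemma osc_avg p t g : chain p -> osc t g -> osc t (avg p g).
Proof.
move=> kp og a b u v hu hv ab; have [p1 p2 p3 _ _] := kp.
rewrite -[t]mul1r; apply: nrm_mean_sub => //; try exact: p2.
move=> i j /(chain_adm kp) hi /(chain_adm kp) hj; apply: og => //.
by apply: compat_step ab _ _; [case/andP: hi | case/andP: hj].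
Qed.

(** The common part of the past makes the new letters almost coupled; the
    defect is paid by the oscillation. *)
Lemma hol_avg p s t g : chain p -> osc s g -> hol t g ->
  hol (t * rho + Cp * s) (avg p g).
Proof.
move=> kp og hg j u v j0 suv hu hv; have [p1 p2 p3 p4 p5] := kp.
have s0 := osc_ge0 og.
have [b [u' [v' [eu ev _]]]] := share_inv j0 suv.
have -> : avg p g u - avg p g v =
   \sum_a p u a *: (g (a :: u) - g (a :: v)) + \sum_a (p u a - p v a) *: g (a :: v).
  rewrite /avg -sumrB -big_split; apply: eq_bigr => a _ /=.
  by rewrite scalerBr scalerBl subrKA.
apply: le_trans (nrmD _ _) _; rewrite mulrDl; apply: lerD.
  rewrite -mulrA -exprS -[leRHS]mul1r -(p2 b u') -?eu//.
  apply: nrm_mean => // a /(chain_adm kp) ha.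
  by apply: hg => //; rewrite ?share_cons// -(share_adm a j0 suv).
have [c cv] : exists c, adm (c :: v) by rewrite ev; apply: adm_ext; rewrite -ev.
have -> : \sum_a (p u a - p v a) *: g (a :: v) =
    \sum_a (p u a - p v a) *: (g (a :: v) - g (c :: v)).
  rewrite [RHS](eq_bigr _ (fun a _ => scalerBr _ _ _)) sumrB -scaler_suml sumrB.
  by rewrite eu ev !p2 -?eu -?ev// subrr scale0r subr0.
apply: le_trans (nrm_sum _) _.
apply: (@le_trans _ _ (\sum_a `|p u a - p v a| * s)); last first.
  by rewrite -mulr_suml mulrAC ler_wpM2r//; exact: p5.
apply: ler_sum => a _; rewrite nrmZ.
have [av|nav] := boolP (adm (a :: v)); last first.
  by rewrite !p3 ?subrr ?normr0 ?mul0r// (share_adm a j0 suv).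
rewrite ler_wpM2l//; apply: og => //.
move: av cv; rewrite ev => /andP[ba _] /andP[bc _].
exact: compat_step (compat_refl b) ba bc.
Qed.

(** Both laws give mass at least [kap] to the letters that continue the coupling. *)
Lemma avg_coupled p s t g a b u v : chain p -> osc s g ->
  u != [::] -> v != [::] ->
  (forall a' b', adm (a' :: u) -> adm (b' :: v) -> nrm (g (a' :: u) - g (b' :: v)) <= s) ->
  adm (a :: u) -> adm (b :: v) ->
  nrm (g (a :: u) - g (b :: v)) <= t ->
  nrm (avg p g u - avg p g v) <= kap * t + (1 - kap) * s.
Proof.
move=> kp _ u0 v0 og ha hb gab; have [p1 p2 p3 p4 p5] := kp.
case/andP: kap01 => k0 k1.
have aux w c : w != [::] -> adm (c :: w) -> avg p g w =
    kap *: g (c :: w) + \sum_d (p w d - kap *+ (d == c)) *: g (d :: w).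
  move=> w0 hc; rewrite [in RHS](eq_bigr _ (fun d _ => scalerBl _ _ _)) sumrB.
  suff -> : \sum_d (kap *+ (d == c)) *: g (d :: w) = kap *: g (c :: w).
    by rewrite addrC subrK.
  rewrite (bigD1 c)//= eqxx mulr1n big1 ?addr0// => d /negbTE ->.
  by rewrite mulr0n scale0r.
have pos w c d : w != [::] -> adm (c :: w) -> 0 <= p w d - kap *+ (d == c).
  case: w => // e w _ hc; case: eqVneq => [->|_]; rewrite ?mulr1n ?mulr0n ?subr0//.
  by rewrite subr_ge0; exact: p4.
have mass w c : w != [::] -> adm (c :: w) -> \sum_d (p w d - kap *+ (d == c)) = 1 - kap.
  case: w => // e w _ hc; rewrite sumrB p2 ?(adm_behead hc)//.
  rewrite (bigD1 c)//= eqxx mulr1n big1 ?addr0// => d /negbTE ->.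
  by rewrite mulr0n.
have supp w c d : adm (c :: w) -> p w d - kap *+ (d == c) != 0 -> adm (d :: w).
  by move=> hc; case: (eqVneq d c) => [->//|_]; rewrite mulr0n subr0 => /(chain_adm kp).
rewrite (aux u a)// (aux v b)// opprD addrACA -scalerBr.
apply: le_trans (nrmD _ _) _; apply: lerD.
  by rewrite nrmZ gtr0_norm// ler_pM2l.
apply: (@nrm_mean_sub _ (fun d => p u d - kap *+ (d == a))
  (fun d => p v d - kap *+ (d == b)) (fun d => g (d :: u)) (fun d => g (d :: v)));
  [by move=> d; exact: pos|by move=> d; exact: pos|exact: mass|exact: mass|].
by move=> d e /(supp _ _ _ ha) hd /(supp _ _ _ hb) he; exact: og.
Qed.

Lemma osc_iavg n p t g : (forall i, chain (p i)) -> osc t g -> osc t (iavg n p g).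
Proof. by move=> kp og; elim: n => //= n IH; exact: osc_avg. Qed.

Lemma hol_iavg n p s t g : (forall i, chain (p i)) -> osc s g -> hol t g ->
  hol (t * rho ^+ n + Cp / (1 - rho) * s) (iavg n p g).
Proof.
move=> kp og hg; have s0 := osc_ge0 og; have r1 : 0 < 1 - rho by rewrite subr_gt0.
elim: n => [|n IH] /=.
  move=> j u v j0 suv hu hv; apply: le_trans (hg j u v j0 suv hu hv) _.
  rewrite ler_wpM2r ?exprn_ge0// expr0 mulr1 lerDl mulr_ge0// divr_ge0// ltW//.
have := hol_avg (kp n) (osc_iavg n kp og) IH.
suff -> : (t * rho ^+ n + Cp / (1 - rho) * s) * rho + Cp * s =
    t * rho ^+ n.+1 + Cp / (1 - rho) * s by [].
by rewrite exprSr; field; rewrite gt_eqF.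
Qed.

Lemma iavg_coupled n J p s t g u v : (forall i, chain (p i)) ->
  u != [::] -> v != [::] -> adm u -> adm v ->
  compat (head (letter0 M) u) (head (letter0 M) v) ->
  coupled J n u v -> osc s g ->
  (forall u v, share J u v -> adm u -> adm v -> nrm (g u - g v) <= t) ->
  nrm (iavg n p g u - iavg n p g v) <= kap ^+ n * t + (1 - kap ^+ n) * s.
Proof.
move=> kp u0 v0 hu hv cuv; elim: n u v u0 v0 hu hv cuv => [|n IH] u v u0 v0 hu hv cuv.
  by move=> suv og gt /=; rewrite expr0 mul1r subrr mul0r addr0; exact: gt.
move=> /= [a [b [ha hb cab]]] og gt.
have comp a' b' : adm (a' :: u) -> adm (b' :: v) -> compat a' b'.
  case: u v u0 v0 cuv {hu hv ha hb cab} => [|c u] [|d v]//= _ _ cd /andP[ca _] /andP[db _].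
  exact: compat_step cd ca db.
have oI : osc s (iavg n p g) by exact: osc_iavg.
have -> : kap ^+ n.+1 * t + (1 - kap ^+ n.+1) * s =
    kap * (kap ^+ n * t + (1 - kap ^+ n) * s) + (1 - kap) * s by rewrite exprS; ring.
apply: (@avg_coupled _ _ _ _ a b) => //.
  by move=> a' b' h1 h2; apply: oI => //; exact: comp.
by apply: IH => //; exact: comp.
Qed.

(** The weight [B] is chosen such that both parts contract together. *)
Definition reg B t g := osc t g /\ hol (B * t) g.

Lemma reg_le B s t g : 0 <= B -> s <= t -> reg B s g -> reg B t g.
Proof.
move=> B0 st [og hg]; split=> [a b u v hu hv ab|j u v j0 suv hu hv].
  exact: le_trans (og a b u v hu hv ab) st.
apply: le_trans (hg j u v j0 suv hu hv) _.
by rewrite ler_wpM2r ?exprn_ge0// ler_wpM2l.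
Qed.

Lemma regD B s t g h : reg B s g -> reg B t h -> reg B (s + t) (fun u => g u + h u).
Proof.
move=> [og hg] [oh hh]; split=> [a b u v hu hv ab|j u v j0 suv hu hv];
  rewrite opprD addrACA; apply: le_trans (nrmD _ _) _.
  exact: lerD (og _ _ _ _ hu hv ab) (oh _ _ _ _ hu hv ab).
rewrite mulrDr mulrDl.
exact: lerD (hg j u v j0 suv hu hv) (hh j u v j0 suv hu hv).
Qed.

Lemma reg_const B t (x : V) : 0 <= B -> 0 <= t -> reg B t (fun=> x).
Proof.
move=> B0 t0; split=> [a b u v _ _ _|j u v _ _ _ _]; rewrite subrr nrm0//.
by rewrite mulr_ge0 ?exprn_ge0 ?mulr_ge0.
Qed.

(** Oscillation and regularity control each other: a fixed number of steps
    turns regularity into a gain on the oscillation, by coupling two pasts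
    until they share many letters, and the oscillation is what is left of the
    regularity once old letters are forgotten.  A suitable weight [B] between
    the two makes the averaging operators contract uniformly. *)
Theorem avg_contraction : exists N r B, [/\ (0 < N)%N, 0 < r < 1, 1 <= B,
  forall p t g, chain p -> reg B t g -> reg B (2 * t) (avg p g) &
  forall p t g, (forall i, chain (p i)) -> reg B t g -> reg B (r * t) (iavg N p g)].
Proof.
have r1 : 0 < 1 - rho by rewrite subr_gt0.
case/andP: kap01 => k0 k1.
pose D := Cp / (1 - rho); have D0 : 0 <= D by rewrite divr_ge0// ltW.
pose B := 2 * D + 1; have B0 : 0 < B by rewrite /B; lra.
have DB : 2 * D <= B by rewrite /B lerDl.
have B1 : 1 <= B by rewrite /B lerDr mulr_ge0.
have CD : Cp <= D by rewrite /D ler_pdivlMr// ler_piMr// lerBlDr lerDl.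
clearbody B.
have [J1 J1P] : exists n, rho ^+ n <= 4^-1 by apply: exprn_small; rewrite ?rho_ge0.
have [J2 J2P] : exists n, rho ^+ n <= (2 * B)^-1.
  by apply: exprn_small; rewrite ?rho_ge0// invr_gt0 mulr_gt0.
have [J JE] : exists J, J = (J1 + J2).+2 by eexists.
have J0 : (0 < J)%N by rewrite JE.
have [N JN NP] := @coupled_uniform M J J0.
have rN : rho ^+ N <= 4^-1.
  by apply: le_trans J1P; rewrite ler_wiXn2l//; clear -JN JE; lia.
have BJ : B * rho ^+ J <= 2^-1.
  apply: (@le_trans _ _ (B * (2 * B)^-1)); last by rewrite invfM mulrCA mulfV ?gt_eqF// mulr1.
  by rewrite ler_pM2l//; apply: le_trans J2P; rewrite ler_wiXn2l//; clear -JE; lia.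
have kN0 : 0 < kap ^+ N by rewrite exprn_gt0.
have kN1 : kap ^+ N <= 1 by rewrite exprn_ile1// ltW.
exists N, (Num.max (3 / 4) (1 - kap ^+ N / 2)), B; split.
- by clear -JN JE; lia.
- by rewrite lt_max gt_max; apply/andP; split; [apply/orP; left|apply/andP; split]; lra.
- exact: B1.
- move=> p t g kp [og hg]; have t0 := osc_ge0 og; split.
    move=> a b u v hu hv ab; apply: le_trans (osc_avg kp og hu hv ab) _.
    by rewrite mulr_natl mulr2n lerDl.
  move=> j u v j0 suv hu hv; apply: le_trans (hol_avg kp og hg j0 suv hu hv) _.
  rewrite ler_wpM2r ?exprn_ge0//.
  have : Cp * t <= D * t by rewrite ler_wpM2r.
  have : 2 * D * t <= B * t by rewrite ler_wpM2r.
  have : 0 <= D * t by rewrite mulr_ge0.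
  have : B * t * rho <= B * t by rewrite ler_piMr// mulr_ge0// ltW.
  lra.
- move=> p t g kp [og hg]; have t0 := osc_ge0 og.
  have maxl : 3 / 4 <= Num.max (3 / 4) (1 - kap ^+ N / 2) by rewrite le_max lexx.
  have maxr : 1 - kap ^+ N / 2 <= Num.max (3 / 4) (1 - kap ^+ N / 2).
    by rewrite le_max lexx orbT.
  split=> [a b u v hu hv ab|j u v j0 suv hu hv].
    have gt u1 v1 : share J u1 v1 -> adm u1 -> adm v1 ->
        nrm (g u1 - g v1) <= t / 2.
      move=> s1 h1 h2; apply: le_trans (hg J u1 v1 J0 s1 h1 h2) _.
      by rewrite mulrAC [t / 2]mulrC ler_wpM2r.
    apply: (@le_trans _ _ ((1 - kap ^+ N / 2) * t)); last by rewrite ler_wpM2r.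
    have H := @iavg_coupled N J p t (t / 2) g (a :: u) (b :: v) kp isT isT hu hv ab
      (NP a b u v hu hv ab) og gt.
    apply: le_trans H _.
    by lra.
  apply: le_trans (hol_iavg N kp og hg j0 suv hu hv) _.
  rewrite ler_wpM2r ?exprn_ge0//.
  apply: (@le_trans _ _ (B * (3 / 4 * t))); last by rewrite ler_wpM2l ?(ltW B0)// ler_wpM2r.
  have : B * t * rho ^+ N <= B * t * 4^-1 by rewrite ler_wpM2l// mulr_ge0// ltW.
  have : 2 * D * t <= B * t by rewrite ler_wpM2r.
  rewrite -/D; lra.
Qed.

(** A recursion whose steps are averages up to regular errors inherits the
    contraction. *)
Lemma affine_contraction N r B : 0 <= B ->
  (forall p t g, chain p -> reg B t g -> reg B (2 * t) (avg p g)) ->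
  (forall p t g, (forall i, chain (p i)) -> reg B t g -> reg B (r * t) (iavg N p g)) ->
  forall p (x e : nat -> seq A -> V) t d, (forall i, chain (p i)) ->
  (forall n u, x n.+1 u = avg (p n) (x n) u + e n u) ->
  0 <= d -> reg B t (x 0%N) -> (forall n, (n < N)%N -> reg B d (e n)) ->
  reg B (r * t + 3 ^+ N * d) (x N).
Proof.
move=> B0 step contr p x e t d kp xS d0 x0 eP.
have y_reg n : (n <= N)%N -> reg B (3 ^+ n * d) (fun u => x n u - iavg n p (x 0%N) u).
  elim: n => [|n IH] nN.
    have -> : (fun u => x 0%N u - iavg 0 p (x 0%N) u) = fun=> 0.
      by apply/funext => u; rewrite /= subrr.
    by apply: reg_const => //; rewrite mulr_ge0.
  have -> : (fun u => x n.+1 u - iavg n.+1 p (x 0%N) u) =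
      fun u => avg (p n) (fun w => x n w - iavg n p (x 0%N) w) u + e n u.
    by apply/funext => u; rewrite avgB xS addrAC.
  apply: (@reg_le _ (2 * (3 ^+ n * d) + d)) => //.
    have : 1 * d <= 3 ^+ n * d by rewrite ler_wpM2r// exprn_ege1// ler1n.
    by rewrite exprS; lra.
  by apply: regD (eP n nN); apply: step (IH (ltnW nN)).
have -> : x N = fun u => iavg N p (x 0%N) u + (x N u - iavg N p (x 0%N) u).
  by apply/funext => u; rewrite addrC subrK.
by apply: regD (contr _ _ _ kp x0) (y_reg N _).
Qed.

End Chain.
End Averages.

(** * Transfer operators of fading energies *)

Section Transfer.
Variables (R : realType) (M : transition) (rho : R).
Hypothesis rho01 : 0 < rho < 1.
Local Notation A := (alphabet M).
Implicit Types (a b : A) (u v w : seq A) (E F G H : seq A -> R) (K L : R).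

Let rho_gt0 : 0 < rho. Proof. by case/andP: rho01. Qed.
Let rho_lt1 : rho < 1. Proof. by case/andP: rho01. Qed.
Let rho_ge0 : 0 <= rho. Proof. exact: ltW. Qed.
Let rho_le1 : rho <= 1. Proof. exact: ltW. Qed.
Let rho1_gt0 : 0 < 1 - rho. Proof. by rewrite subr_gt0. Qed.

Definition inc F a u := F (a :: u) - F u.

(** Energies of words: reading one letter changes [F] by a bounded amount that
    depends exponentially little on the distant past. *)
Definition fading K F :=
  [/\ F [::] = 0,
      forall a u, adm (a :: u) -> `|inc F a u| <= K &
      forall j a u v, (0 < j)%N -> share j u v -> adm (a :: u) -> adm (a :: v) ->
        `|inc F a u - inc F a v| <= K * rho ^+ j].

Lemma fading_ge0 K F : fading K F -> 0 <= K.
Proof.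
by case=> _ h _; apply: le_trans (h (letter0 M) [::] isT) => //.
Qed.

Lemma fadingD K L E F : fading K E -> fading L F -> fading (K + L) (fun u => E u + F u).
Proof.
move=> [e0 e1 e2] [f0 f1 f2]; split; first by rewrite e0 f0 addr0.
  move=> a u au; have -> : inc (fun u => E u + F u) a u = inc E a u + inc F a u.
    by rewrite /inc; ring.
  by apply: le_trans (ler_normD _ _) _; apply: lerD; [exact: e1|exact: f1].
move=> j a u v j0 s au av.
have -> : inc (fun u => E u + F u) a u - inc (fun u => E u + F u) a v =
   (inc E a u - inc E a v) + (inc F a u - inc F a v) by rewrite /inc; ring.
by rewrite mulrDl; apply: le_trans (ler_normD _ _) _; apply: lerD; [exact: e2|exact: f2].
Qed.

Lemma fadingZ (c : R) K F : fading K F -> fading (`|c| * K) (fun u => c * F u).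
Proof.
move=> [f0 f1 f2]; split; first by rewrite f0 mulr0.
  move=> a u au; rewrite /inc -mulrBr normrM ler_wpM2l//; exact: f1.
move=> j a u v j0 s au av; rewrite /inc -!mulrBr normrM -mulrA ler_wpM2l//.
exact: f2.
Qed.

Lemma fading_le K L F : K <= L -> fading K F -> fading L F.
Proof.
move=> KL [f0 f1 f2]; split=> // [a u au|j a u v j0 s au av].
  exact: le_trans (f1 a u au) KL.
apply: le_trans (f2 j a u v j0 s au av) _; rewrite ler_wpM2r// exprn_ge0//.
Qed.

Lemma fading_sum (I : finType) (k : I -> R) (f : I -> seq A -> R) :
  (forall i, fading (k i) (f i)) ->
  fading (\sum_i k i) (fun u => \sum_i f i u).
Proof.
move=> h; split.
- by rewrite big1// => i _; have [] := h i.
- move=> a u au; rewrite /inc -sumrB; apply: le_trans (ler_norm_sum _ _ _) _.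
  by apply: ler_sum => i _; have [_ h1 _] := h i; exact: h1.
- move=> j a u v j0 s au av; rewrite /inc -!sumrB; apply: le_trans (ler_norm_sum _ _ _) _.
  by rewrite mulr_suml; apply: ler_sum => i _; have [_ _ h2] := h i; exact: h2.
Qed.

Definition defect : R := 2 + (1 - rho)^-1.

Lemma defect_ge0 : 0 <= defect.
Proof. by rewrite /defect addr_ge0// invr_ge0 ltW. Qed.

(** A letter of [v] feels the presence of [u] exponentially little in the number
    of letters between them, and the corrections form a geometric series. *)
Lemma quasi_additive K F u v : fading K F -> adm (v ++ u) ->
  `|F (v ++ u) - F v - F u| <= K * defect.
Proof.
move=> FK; have K0 := fading_ge0 FK; have [f0 f1 f2] := FK => hvu.
suff H : `|F (v ++ u) - F v - F u| <= K * 2 + K * \sum_(i < size v) rho ^+ i.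
  apply: le_trans H _; rewrite /defect [leRHS]mulrDr lerD2l ler_wpM2l//.
  by apply: geometric_sum_le; rewrite rho_ge0.
elim: v hvu => [|a v IH] hvu.
  by rewrite /= f0 subr0 subrr normr0 big_ord0 mulr0 addr0 mulr_ge0.
have hv := adm_catl hvu.
have -> : F ((a :: v) ++ u) - F (a :: v) - F u =
    (inc F a (v ++ u) - inc F a v) + (F (v ++ u) - F v - F u).
  by rewrite /inc cat_cons; ring.
apply: le_trans (ler_normD _ _) _.
have [v0|v0] := eqVneq v [::].
  rewrite v0 /= f0 !subr0 subrr normr0 addr0 big_ord1 expr0.
  apply: le_trans (ler_normB _ _) _.
  have := f1 a u; have := f1 a [::]; rewrite /= => h1 h2.
  have := h1 isT; have : adm (a :: u) -> `|inc F a u| <= K by exact: h2.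
  move=> h3 h4; have h5 : adm (a :: u).
    by move: hvu; rewrite v0.
  by have := h3 h5; lra.
rewrite big_ord_recr/=; set S := \sum_(i < _) _.
have -> : K * 2 + K * (S + rho ^+ size v) = K * rho ^+ size v + (K * 2 + K * S) by ring.
apply: lerD; last exact: IH (adm_behead hvu).
apply: f2 => //; first by rewrite lt0n size_eq0.
apply/and3P; split=> //; first by rewrite size_cat leq_addr.
by rewrite take_size_cat// take_size.
Qed.

(** The iterated Ruelle transfer operator of the energy [E], on functions of
    words. *)
Fixpoint transfer E m G u : R :=
  if m is k.+1 then \sum_(a | adm (a :: u)) expR (inc E a u) * transfer E k G (a :: u)
  else G u.

Definition partfn E m u := transfer E m (fun=> 1) u.

Lemma transfer_le E m G H u :
  (forall w, size w = m -> adm (w ++ u) -> G (w ++ u) <= H (w ++ u)) ->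
  adm u -> transfer E m G u <= transfer E m H u.
Proof.
elim: m u => [|m IH] u GH hu /=; first exact: (GH [::]).
apply: ler_sum => a au; rewrite ler_wpM2l ?expR_ge0// IH// => w sw hw.
by rewrite -cat_rcons GH ?size_rcons ?sw ?cat_rcons.
Qed.

Lemma eq_transfer E m G H u :
  (forall w, size w = m -> adm (w ++ u) -> G (w ++ u) = H (w ++ u)) ->
  adm u -> transfer E m G u = transfer E m H u.
Proof.
by move=> GH hu; apply/eqP; rewrite eq_le; apply/andP; split;
  apply: transfer_le => // w sw hw; rewrite GH.
Qed.

Lemma transferZ E m (c : R) G u : transfer E m (fun v => c * G v) u = c * transfer E m G u.
Proof.
elim: m u => //= m IH u; rewrite mulr_sumr; apply: eq_bigr => a _.
by rewrite IH mulrCA.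
Qed.

Lemma transfer_sum (I : finType) E m (G : I -> seq A -> R) u :
  transfer E m (fun v => \sum_i G i v) u = \sum_i transfer E m (G i) u.
Proof.
elim: m u => //= m IH u; rewrite exchange_big/=; apply: eq_bigr => a _.
by rewrite IH mulr_sumr.
Qed.

Lemma transfer_add E k l G u :
  transfer E (k + l) G u = transfer E k (transfer E l G) u.
Proof.
by elim: k u => //= k IH u; apply: eq_bigr => a _; rewrite IH.
Qed.

Lemma transfer_ge0 E m G u : (forall v, 0 <= G v) -> 0 <= transfer E m G u.
Proof.
move=> G0; elim: m u => //= m IH u.
by apply: sumr_ge0 => a _; rewrite mulr_ge0 ?expR_ge0.
Qed.

Lemma adm_succ u : adm u -> exists a, adm (a :: u).
Proof. by case: u => [_|b u /adm_ext//]; exists (letter0 M). Qed.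

Lemma partfn_gt0 E m u : adm u -> 0 < partfn E m u.
Proof.
rewrite /partfn; elim: m u => //= m IH u hu; have [a au] := adm_succ hu.
rewrite (bigD1 a)//= ltr_wpDr//.
  by apply: sumr_ge0 => b _; rewrite mulr_ge0 ?expR_ge0 ?transfer_ge0.
by rewrite mulr_gt0 ?expR_gt0// IH.
Qed.

Lemma partfn_share K E m j u v : fading K E -> (0 < j)%N -> share j u v ->
  adm u -> adm v ->
  partfn E m u <= expR (K / (1 - rho) * rho ^+ j) * partfn E m v.
Proof.
move=> EK; have K0 := fading_ge0 EK; have [_ e1 e2] := EK.
have q0 : 0 <= K / (1 - rho) by rewrite divr_ge0// ltW.
rewrite /partfn; elim: m j u v => [|m IH] j u v j0 s hu hv /=.
  by rewrite mulr1 one_le_expR// mulr_ge0// exprn_ge0.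
rewrite mulr_sumr (eq_bigl _ _ (fun a => share_adm a j0 s hu hv)).
apply: ler_sum => a av; have au : adm (a :: u) by rewrite (share_adm a j0 s).
have -> : K / (1 - rho) * rho ^+ j = K * rho ^+ j + K / (1 - rho) * rho ^+ j.+1.
  by rewrite exprSr; field; rewrite gt_eqF.
have h1 : expR (inc E a u) <= expR (K * rho ^+ j) * expR (inc E a v).
  by rewrite -expRD ler_expR -lerBlDr; apply: le_trans (ler_norm _) _; exact: e2.
have h2 := IH j.+1 (a :: u) (a :: v) isT (etrans (share_cons _ _ _ _) s) au av.
have Zu := transfer_ge0 E m (a :: u) (fun=> ler01).
apply: le_trans (ler_pM (expR_ge0 _) Zu h1 h2) _.
by rewrite (expRD (K * rho ^+ j)) le_eqVlt; apply/predU1P; left; ring.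
Qed.

Lemma partfn_succ K E m u : fading K E -> adm u ->
  expR (- K) * partfn E m u <= partfn E m.+1 u <= #|A|%:R * expR K * partfn E m u.
Proof.
move=> EK hu; have [_ e1 _] := EK.
rewrite /partfn -addn1 transfer_add -!transferZ; apply/andP; split;
  apply: transfer_le => // w _; rewrite mulr1 /=; set v := w ++ u => hv.
  have [a av] := adm_succ hv; rewrite (bigD1 a)//= mulr1 ler_wpDr//.
    by apply: sumr_ge0 => b _; rewrite mulr1 expR_ge0.
  by rewrite ler_expR; have := e1 a v av; rewrite ler_norml => /andP[].
apply: (@le_trans _ _ (\sum_(a : A) expR K)).
  rewrite big_mkcond; apply: ler_sum => a _; case: ifP => [av|_]; last exact: expR_ge0.
  by rewrite mulr1 ler_expR; have := e1 a v av; rewrite ler_norml => /andP[].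
by rewrite sumr_const mulr_natl.
Qed.

Lemma partfn_add K E m r u : fading K E -> adm u ->
  partfn E (m + r) u <= (#|A|%:R * expR K) ^+ r * partfn E m u.
Proof.
move=> EK hu; set c := #|A|%:R * expR K.
have c0 : 0 <= c by rewrite mulr_ge0 ?expR_ge0// ltW.
elim: r => [|r IH]; first by rewrite addn0 expr0 mul1r.
have /andP[_] := partfn_succ (m + r) EK hu.
rewrite addnS exprS -/c => /le_trans; apply.
by rewrite -[leRHS]mulrA ler_wpM2l.
Qed.

Lemma partfn_reach K E m r b b' u : fading K E -> adm (b :: u) -> reach r b b' ->
  exists w, adm (b' :: w) /\
    partfn E m (b' :: w) <= expR K ^+ r * partfn E (m + r) (b :: u).
Proof.
move=> EK; have [_ e1 _] := EK; elim: r b u => [|r IH] b u hu /=.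
  by move=> <-; exists u; rewrite addn0 expr0 mul1r.
case=> c bc cb'; have hc : adm (c :: b :: u) by rewrite adm_cons2 bc.
have [w [hw le_w]] := IH _ _ hc cb'; exists w; split => //.
apply: le_trans le_w _; rewrite exprSr -mulrA ler_wpM2l ?exprn_ge0 ?expR_ge0//.
rewrite addnS /partfn /= (bigD1 c)//= -/(partfn E (m + r) (c :: b :: u)).
rewrite mulrDr ler_wpDr//.
  by rewrite mulr_ge0 ?expR_ge0// sumr_ge0// => d _; rewrite mulr_ge0 ?expR_ge0 ?transfer_ge0.
rewrite mulrA -expRD -[leLHS]mul1r ler_wpM2r ?(ltW (partfn_gt0 _ _ _))//.
rewrite one_le_expR// addrC -lerBlDr sub0r.
by have := e1 c _ hc; rewrite ler_norml => /andP[].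
Qed.

(** By irreducibility, a letter is joined to any other in boundedly many steps,
    each of which changes the partition function by a bounded factor. *)
Lemma partfn_compare K : 0 <= K -> exists2 Ga, 1 <= Ga &
  forall E m a b u v, fading K E -> adm (a :: u) -> adm (b :: v) ->
  partfn E m (a :: u) <= Ga * partfn E m (b :: v).
Proof.
move=> K0; have [N NP] := @reach_uniform M.
have eK := one_le_expR K0.
have A1 : 1 <= #|A|%:R :> R by rewrite ler1n; apply/card_gt0P; exists (letter0 M).
have AK : 1 <= #|A|%:R * expR K by rewrite mulr_ege1.
have q0 : 0 <= K / (1 - rho) by rewrite divr_ge0// ltW.
have eq1 := one_le_expR q0.
exists (expR (K / (1 - rho)) * (expR K ^+ N * (#|A|%:R * expR K) ^+ N)).
  by rewrite !mulr_ege1 ?exprn_ege1.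
move=> E m a b u v EK hu hv; have [n [nN rn]] := NP b a.
have [w [hw le_w]] := partfn_reach m EK hv rn.
have s1 : share 1 (a :: u) (a :: w) by rewrite share_cons /share/= !take0.
have Zs := @partfn_share K E m 1 _ _ EK isT s1 hu hw.
apply: le_trans Zs _.
have Zv := ltW (partfn_gt0 E m hv).
rewrite -[leRHS]mulrA.
apply: (ler_pM (expR_ge0 _) (ltW (partfn_gt0 E m hw))).
  by rewrite ler_expR -[leRHS]mulr1 ler_wpM2l// expr1.
apply: le_trans le_w _; rewrite -[leRHS]mulrA.
apply: ler_pM; [by rewrite exprn_ge0 ?expR_ge0|exact: (ltW (partfn_gt0 E _ hv))| |].
  by rewrite ler_weXn2l.
apply: le_trans (partfn_add m n.+1 EK hv) _.
by rewrite ler_wpM2r// ler_weXn2l.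
Qed.

(** The law of the next letter when [m] more letters follow, all words being
    weighted by the exponential of their energy. *)
Definition trans E m u a : R :=
  if adm (a :: u) then expR (inc E a u) * partfn E m (a :: u) / partfn E m.+1 u else 0.

Lemma trans_ge0 E m u a : 0 <= trans E m u a.
Proof.
rewrite /trans; case: ifP => // au; have hu := adm_behead au.
by rewrite divr_ge0 ?mulr_ge0 ?expR_ge0 ?(ltW (partfn_gt0 _ _ _)).
Qed.

Lemma trans_sum E m u : adm u -> \sum_a trans E m u a = 1.
Proof.
move=> hu; rewrite /trans -big_mkcond/= -mulr_suml.
by rewrite -[X in X / _]/(partfn E m.+1 u) mulfV// gt_eqF// partfn_gt0.
Qed.

Lemma transferS E m G u : adm u -> transfer E m.+1 G u =
  partfn E m.+1 u *
  \sum_a trans E m u a * (transfer E m G (a :: u) / partfn E m (a :: u)).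
Proof.
move=> hu; rewrite /= big_mkcond mulr_sumr; apply: eq_bigr => a _; rewrite /trans.
case: ifP => au; last by rewrite mul0r mulr0.
have := lt0r_neq0 (partfn_gt0 E m au); have := lt0r_neq0 (partfn_gt0 E m.+1 hu).
set z := partfn _ _ _; set y := partfn _ _ _ => z0 y0; field.
by rewrite z0 y0.
Qed.

Lemma trans_share K E m j u v a : fading K E -> (0 < j)%N -> share j u v ->
  adm u -> adm v ->
  trans E m u a <= expR (2 * K / (1 - rho) * rho ^+ j) * trans E m v a.
Proof.
move=> EK j0 s hu hv; rewrite /trans -(share_adm a j0 s hu hv).
have K0 := fading_ge0 EK; have [_ e1 e2] := EK.
case: ifP => au; last by rewrite mulr0.
have av : adm (a :: v) by rewrite -(share_adm a j0 s hu hv).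
rewrite ler_pdivrMr ?partfn_gt0//.
have h1 : expR (inc E a u) <= expR (K * rho ^+ j) * expR (inc E a v).
  by rewrite -expRD ler_expR -lerBlDr; apply: le_trans (ler_norm _) _; exact: e2.
have h2 := @partfn_share K E m j.+1 (a :: u) (a :: v) EK isT _ au av.
have {}h2 := h2 (etrans (share_cons _ _ _ _) s).
have h3 := @partfn_share K E m.+1 j v u EK j0 (etrans (share_sym _ _ _) s) hv hu.
have Zu := partfn_gt0 E m.+1 hu; have Zv := partfn_gt0 E m.+1 hv.
have Zav := partfn_gt0 E m av; have Zau := partfn_gt0 E m au.
have -> : 2 * K / (1 - rho) * rho ^+ j =
    (K * rho ^+ j + K / (1 - rho) * rho ^+ j.+1) + K / (1 - rho) * rho ^+ j.
  by rewrite exprSr; field; rewrite gt_eqF.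
rewrite (expRD (K * rho ^+ j + _)) -mulrA.
apply: (@le_trans _ _ ((expR (K * rho ^+ j) * expR (inc E a v)) *
   (expR (K / (1 - rho) * rho ^+ j.+1) * partfn E m (a :: v)))).
  exact: ler_pM (expR_ge0 _) (ltW Zau) h1 h2.
rewrite (expRD (K * rho ^+ j)); set x1 := expR _; set x2 := expR _; set x3 := expR _; set x4 := expR _.
have -> : x1 * x2 * (x3 * partfn E m (a :: v)) =
   (x1 * x3 * x2 * partfn E m (a :: v) / partfn E m.+1 v) * partfn E m.+1 v.
  by field; rewrite gt_eqF.
have -> : x1 * x3 * (x4 * (x2 * partfn E m (a :: v) / partfn E m.+1 v)) * partfn E m.+1 u =
   (x1 * x3 * x2 * partfn E m (a :: v) / partfn E m.+1 v) * (x4 * partfn E m.+1 u).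
  by ring.
by rewrite ler_wpM2l// divr_ge0 ?mulr_ge0 ?expR_ge0// ltW.
Qed.

(** Ratios of partition functions inherit the forgetting of the energy, and the
    comparison of partition functions bounds the transition probabilities from
    below. *)
Theorem trans_chain K : 0 <= K -> exists kap Cp, [/\ 0 < kap <= 1, 0 <= Cp &
  forall E m, fading K E -> chain rho kap Cp (trans E m)].
Proof.
move=> K0; have [Ga Ga1 GaP] := partfn_compare K0.
have q0 : 0 <= 2 * K / (1 - rho) by rewrite divr_ge0 ?mulr_ge0// ltW.
have eK := one_le_expR K0.
have A1 : 1 <= #|A|%:R :> R by rewrite ler1n; apply/card_gt0P; exists (letter0 M).
pose ki := expR K * (#|A|%:R * expR K * Ga).
have ki1 : 1 <= ki by rewrite /ki !mulr_ege1.
exists ki^-1, (2 * (2 * K / (1 - rho) * expR (2 * K / (1 - rho)))); split.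
- rewrite invr_gt0 (lt_le_trans ltr01 ki1)/= invf_le1//; exact: lt_le_trans ki1.
- by rewrite !mulr_ge0 ?expR_ge0 ?(ltW rho1_gt0)// invr_ge0 ltW.
move=> E m EK; have [_ e1 e2] := EK; split.
- exact: trans_ge0.
- by move=> b u hu; exact: trans_sum.
- by move=> u a /negbTE au; rewrite /trans au.
- move=> b u a hau; have hu := adm_behead hau; rewrite /trans hau.
  have Zu := partfn_gt0 E m.+1 hu; have Za := partfn_gt0 E m hau.
  rewrite ler_pdivlMr// /ki invfM; set y := #|A|%:R * expR K * Ga.
  have y0 : 0 < y by rewrite !mulr_gt0 ?expR_gt0// (lt_le_trans ltr01).
  apply: (@le_trans _ _ (expR (- K) * partfn E m (a :: b :: u))); last first.
    rewrite ler_wpM2r ?(ltW Za)// ler_expR.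
    by have := e1 a _ hau; rewrite ler_norml => /andP[].
  rewrite expRN -[leLHS]mulrA ler_wpM2l ?invr_ge0 ?expR_ge0//.
  rewrite ler_pdivrMl//.
  have /andP[_ h] := partfn_succ m EK hu; apply: le_trans h _.
  rewrite /y -[leRHS]mulrA ler_wpM2l ?mulr_ge0 ?expR_ge0//.
  exact: GaP.
move=> j u v j0 s hu hv.
set x := 2 * K / (1 - rho) * rho ^+ j.
have x0 : 0 <= x by rewrite mulr_ge0// exprn_ge0.
have ex1 : 0 <= expR x - 1 by rewrite subr_ge0 one_le_expR.
have xle : expR x - 1 <= 2 * K / (1 - rho) * expR (2 * K / (1 - rho)) * rho ^+ j.
  apply: le_trans (expR_sub1_le _) _; rewrite /x mulrAC ler_wpM2r ?exprn_ge0//.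
  by rewrite ler_wpM2l// ler_expR ler_piMr// exprn_ile1.
apply: (@le_trans _ _ (\sum_a (expR x - 1) * (trans E m u a + trans E m v a))).
  apply: ler_sum => a _.
  have h1 := trans_share m a EK j0 s hu hv.
  have h2 := trans_share m a EK j0 (etrans (share_sym _ _ _) s) hv hu.
  have p1 := mulr_ge0 ex1 (trans_ge0 E m u a); have p2 := mulr_ge0 ex1 (trans_ge0 E m v a).
  by rewrite ler_norml; apply/andP; split; rewrite -/x in h1 h2; lra.
rewrite -mulr_sumr big_split/= !trans_sum//.
by lra.
Qed.

End Transfer.

(** * Conditional means and exponential moments *)

Section Moments.
Variables (R : realType) (M : transition) (rho : R).
Hypothesis rho01 : 0 < rho < 1.
Local Notation A := (alphabet M).
Implicit Types (a b : A) (u v w : seq A) (E F : seq A -> R) (K L : R).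

Let rho_gt0 : 0 < rho. Proof. by case/andP: rho01. Qed.
Let rho_lt1 : rho < 1. Proof. by case/andP: rho01. Qed.
Let rho_ge0 : 0 <= rho. Proof. exact: ltW. Qed.
Let rho_le1 : rho <= 1. Proof. exact: ltW. Qed.

Let nrm (x : R^o) : R := `|x|.
Let nrmD (x y : R^o) : nrm (x + y) <= nrm x + nrm y. Proof. exact: ler_normD. Qed.
Let nrmZ (a : R) (x : R^o) : nrm (a *: x) = `|a| * nrm x. Proof. exact: normrM. Qed.

Definition last_inc F (v : seq A) : R^o := F v - F (behead v).

(** Conditional expectation of the next [m] increments of [F], for the transition
    probabilities [trans E]. *)
Fixpoint mean E F m : seq A -> R^o :=
  if m is k.+1 then avg (trans E k) (fun v => last_inc F v + mean E F k v) else fun=> 0.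

Lemma last_inc_reg K F B : 1 <= B -> fading rho K F ->
  reg rho nrm B (2 * K / rho) (last_inc F).
Proof.
move=> B1 FK; have K0 := fading_ge0 FK; have [_ f1 f2] := FK.
have B0 : 0 <= B by lra.
have bound a b u v : adm (a :: u) -> adm (b :: v) ->
    `|inc F a u - inc F b v| <= 2 * K.
  by move=> hu hv; apply: le_trans (ler_normB _ _) _; have := f1 a u hu; have := f1 b v hv; lra.
split=> [a b u v hu hv _|j u v j0 s hu hv].
  apply: le_trans (bound _ _ _ _ hu hv) _.
  by rewrite ler_pdivlMr// ler_piMr// mulr_ge0.
have [a [u' [v' [eu ev s']]]] := share_inv j0 s.
rewrite eu ev /nrm /last_inc /= in hu hv *; rewrite -/(inc F a u') -/(inc F a v').
case: j j0 s s' => // j _ _ s'.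
have -> : B * (2 * K / rho) * rho ^+ j.+1 = B * (2 * (K * rho ^+ j)).
  by rewrite exprS; field; rewrite gt_eqF.
apply: (@le_trans _ _ (2 * (K * rho ^+ j))); last first.
  by rewrite ler_peMl// !mulr_ge0 ?exprn_ge0.
case: j s' => [_|j s']; first by rewrite expr0 mulr1; exact: bound.
apply: le_trans (f2 j.+1 a u' v' isT s' hu hv) _.
by rewrite ler_peMl ?mulr_ge0 ?exprn_ge0// ler1n.
Qed.

Lemma meanZ E F (c : R) m u : mean E (fun v => c * F v) m u = c * mean E F m u.
Proof.
elim: m u => [|m IH] u /=; first by rewrite mulr0.
rewrite /avg mulr_sumr; apply: eq_bigr => a _; rewrite IH /last_inc.
by rewrite /GRing.scale /=; ring.
Qed.

(** The differences of the martingale of conditional means are bounded: the means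
    satisfy an affine recursion whose error is the last increment, so that the
    contraction of averages keeps their oscillation of order [L] forever. *)
Lemma mean_dev K : 0 <= K -> exists2 Th, 0 < Th &
  forall E F L m a b u, fading rho K E -> fading rho L F -> adm [:: a, b & u] ->
  `|last_inc F (a :: b :: u) + mean E F m (a :: b :: u) - mean E F m.+1 (b :: u)|
  <= Th * L.
Proof.
move=> K0; have [kap [Cp [kap01 Cp0 kerP]]] := trans_chain M rho01 K0.
have [N [r [B [N0 /andP[r0 r1] B1 step contr]]]] :=
  avg_contraction M rho01 nrmD nrmZ kap01 Cp0.
have B0 : 0 <= B by lra.
have r1' : 0 < 1 - r by lra.
pose c := 4 / rho; have c0 : 0 < c by rewrite divr_gt0.
pose q := 3 ^+ N * c / (1 - r).
have q0 : 0 < q.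
  by apply: divr_gt0 => //; apply: mulr_gt0 => //; exact: exprn_gt0.
exists (2 / rho + q); first exact: (addr_gt0 (divr_gt0 (ltr0n _ 2) rho_gt0) q0).
move=> E F L m a b u EK FL hau.
have L0 := fading_ge0 FL; have ker i := kerP E i EK.
have incR := last_inc_reg B1 FL.
have d0 : 0 <= c * L by rewrite mulr_ge0// ltW.
have errR i : reg rho nrm B (c * L) (avg (trans E i) (last_inc F)).
  have -> : c * L = 2 * (2 * L / rho) by rewrite /c; lra.
  exact: step (ker i) incR.
have meanS i : mean E F i.+1 = fun v => avg (trans E i) (mean E F i) v +
    avg (trans E i) (last_inc F) v.
  by apply/funext => v; rewrite addrC -avgD.
have base i : reg rho nrm B (3 ^+ i * (c * L)) (mean E F i).
  elim: i => [|i IH].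
    by apply: (reg_const _ rho01 nrmZ) => //; rewrite mulr_ge0.
  rewrite meanS; apply: (@reg_le _ _ _ rho01 _ _ _ (2 * (3 ^+ i * (c * L)) + c * L)) => //.
    have : 1 * (c * L) <= 3 ^+ i * (c * L) by rewrite ler_wpM2r// exprn_ege1// ler1n.
    by rewrite exprS; lra.
  by apply: (regD nrmD) => //; exact: step.
have Lq : 3 ^+ N * (c * L) <= q * L.
  rewrite mulrA ler_wpM2r// /q ler_pdivlMr//.
  have : 0 <= 3 ^+ N * c by rewrite mulr_ge0 ?exprn_ge0// ltW.
  by nra.
have all_reg i : reg rho nrm B (q * L) (mean E F i).
  elim/ltn_ind: i => i IH; have [iN|Ni] := ltnP i N.
    apply: (@reg_le _ _ _ rho01 _ _ _ (3 ^+ i * (c * L))) => //.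
    apply: le_trans Lq; rewrite ler_wpM2r// ler_weXn2l ?ler1n//; exact: ltnW.
  have eqt : r * (q * L) + 3 ^+ N * (c * L) = q * L.
    by rewrite /q; field; rewrite gt_eqF.
  rewrite -eqt -{1}(subnK Ni).
  apply: (@affine_contraction _ _ _ rho01 _ _ nrmD nrmZ kap Cp N r B B0 step contr
     (fun n => trans E (i - N + n)) (fun n => mean E F (i - N + n))
     (fun n => avg (trans E (i - N + n)) (last_inc F))) => //.
  - by move=> n v; rewrite addnS meanS.
  - by rewrite addn0; apply: IH; rewrite ltn_subrL N0 (leq_trans N0).
have hu := adm_behead hau.
have [ol _] := regD nrmD incR (all_reg m).
set y := fun v => last_inc F v + mean E F m v.
have -> : last_inc F [:: a, b & u] + mean E F m [:: a, b & u] - mean E F m.+1 (b :: u) =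
   \sum_c trans E m (b :: u) c *: (y (a :: b :: u) - y (c :: b :: u)).
  rewrite [RHS](eq_bigr _ (fun c _ => scalerBr _ _ _)) sumrB -scaler_suml.
  by rewrite trans_sum// scale1r.
have -> : (2 / rho + q) * L = (\sum_c trans E m (b :: u) c) * (2 * L / rho + q * L).
  by rewrite trans_sum// mul1r; lra.
apply: (nrm_mean nrmD nrmZ) => [e|e]; first exact: trans_ge0.
move=> /(chain_adm (ker m)) hc; apply: ol => //.
move: hau hc; rewrite !adm_cons2 => /andP[ba _] /andP[bc _].
exact: compat_step (compat_refl b) ba bc.
Qed.

Lemma partfn_addS E F m u : adm u -> partfn (fun v => E v + F v) m.+1 u =
  partfn E m.+1 u * \sum_a trans E m u a *
    (expR (inc F a u) * (partfn (fun v => E v + F v) m (a :: u) / partfn E m (a :: u))).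
Proof.
move=> hu; rewrite {1}/partfn /= big_mkcond mulr_sumr; apply: eq_bigr => a _; rewrite /trans.
case: ifP => au; last by rewrite mul0r mulr0.
have := lt0r_neq0 (partfn_gt0 E m au); have := lt0r_neq0 (partfn_gt0 E m.+1 hu).
rewrite -/(partfn (fun v => E v + F v) m (a :: u)).
have -> : inc (fun v => E v + F v) a u = inc E a u + inc F a u by rewrite /inc; ring.
rewrite (expRD (inc E a u)).
set z := partfn E m.+1 u; set y := partfn E m (a :: u) => z0 y0; field.
by rewrite z0 y0.
Qed.

(** Azuma's martingale argument: the centred exponential moments of a sum over
    [m] letters are Gaussian of variance [O(m)]. *)
Lemma partfn_tilt_le K : 0 <= K -> exists C de, [/\ 0 < C, 0 < de &
  forall E F L m b u, fading rho K E -> fading rho L F -> L <= de -> adm (b :: u) ->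
  partfn (fun v => E v + F v) m (b :: u) <=
  partfn E m (b :: u) * expR (mean E F m (b :: u) + C * L ^+ 2 * m%:R)].
Proof.
move=> K0; have [Th Th0 ThP] := mean_dev K0.
exists (2 * Th ^+ 2), (2 * Th)^-1; split; rewrite ?invr_gt0 ?mulr_gt0 ?exprn_gt0//.
move=> E F L m b u EK FL Lde; have L0 := fading_ge0 FL.
have ThL : Th * L <= 2^-1.
  apply: (@le_trans _ _ (Th * (2 * Th)^-1)); first by rewrite ler_pM2l.
  by rewrite invfM mulrCA mulfV ?gt_eqF// mulr1.
set v2 := 2 * Th ^+ 2 * L ^+ 2.
elim: m b u => [|m IH] b u hu; first by rewrite /partfn /= mulr0 addr0 expR0 mulr1.
have Zu := partfn_gt0 E m.+1 hu.
rewrite partfn_addS// ler_pM2l//.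
set g := mean E F m.+1 (b :: u).
apply: (@le_trans _ _ (\sum_a trans E m (b :: u) a *
   (expR (g + v2 * m%:R) * (1 + (last_inc F (a :: b :: u) + mean E F m (a :: b :: u) - g) + v2)))).
  apply: ler_sum => a _; have [au|/negbTE au] := boolP (adm [:: a, b & u]); last first.
    by rewrite /trans au !mul0r.
  rewrite ler_wpM2l ?trans_ge0//.
  have Za := partfn_gt0 E m au.
  have := IH a (b :: u) au; rewrite -ler_pdivrMl// [X in X <= _]mulrC => IHa.
  apply: (@le_trans _ _ (expR (inc F a (b :: u)) * expR (mean E F m [:: a, b & u] + v2 * m%:R))).
    by rewrite ler_wpM2l ?expR_ge0.
  set D := last_inc F _ + _ - _.
  have -> : expR (inc F a (b :: u)) * expR (mean E F m [:: a, b & u] + v2 * m%:R) =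
     expR (g + v2 * m%:R) * expR D.
    by rewrite -!expRD; congr expR; rewrite /D /last_inc /inc /=; ring.
  rewrite ler_wpM2l ?expR_ge0//.
  have Dle : `|D| <= Th * L by exact: ThP.
  have D2 : D ^+ 2 <= (Th * L) ^+ 2.
    by rewrite -(real_normK (num_real D)) ler_sqr ?nnegrE// mulr_ge0// ltW.
  have Dh : D <= 2^-1 by apply: le_trans (ler_norm _) _; exact: le_trans Dle ThL.
  apply: le_trans (expR_le_quad Dh) _.
  by move: D2; rewrite exprMn /v2; lra.
rewrite -[X in _ <= X]/(expR (g + v2 * m.+1%:R)).
have -> : \sum_a trans E m (b :: u) a * (expR (g + v2 * m%:R) *
    (1 + (last_inc F [:: a, b & u] + mean E F m [:: a, b & u] - g) + v2)) =
    expR (g + v2 * m%:R) * (1 + v2).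
  transitivity (expR (g + v2 * m%:R) * (\sum_a trans E m (b :: u) a * (1 - g + v2) +
     \sum_a trans E m (b :: u) a * (last_inc F [:: a, b & u] + mean E F m [:: a, b & u]))).
    by rewrite -big_split/= mulr_sumr; apply: eq_bigr => a _; ring.
  have -> : \sum_a trans E m (b :: u) a *
      (last_inc F [:: a, b & u] + mean E F m [:: a, b & u]) = g by [].
  by rewrite -mulr_suml trans_sum//; ring.
have -> : v2 * m.+1%:R = v2 * m%:R + v2 by rewrite -addn1 natrD mulrDr mulr1.
rewrite addrA [leRHS]expRD ler_wpM2l ?expR_ge0//.
exact: expR_ge1Dx.
Qed.

(** Jensen's inequality for the exponential. *)
Lemma partfn_tilt_ge E F m u : adm u ->
  partfn E m u * expR (mean E F m u) <= partfn (fun v => E v + F v) m u.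
Proof.
elim: m u => [|m IH] u hu; first by rewrite /partfn /= expR0 mulr1.
have Zu := partfn_gt0 E m.+1 hu.
rewrite partfn_addS// ler_pM2l//; set g := mean E F m.+1 u.
apply: (@le_trans _ _ (\sum_a trans E m u a *
   (expR g * (1 + (last_inc F (a :: u) + mean E F m (a :: u) - g))))).
  have -> : \sum_a trans E m u a *
     (expR g * (1 + (last_inc F (a :: u) + mean E F m (a :: u) - g))) =
     expR g * (\sum_a trans E m u a * (1 - g) +
     \sum_a trans E m u a * (last_inc F (a :: u) + mean E F m (a :: u))).
    by rewrite -big_split/= mulr_sumr; apply: eq_bigr => a _; ring.
  have -> : \sum_a trans E m u a * (last_inc F (a :: u) + mean E F m (a :: u)) = g by [].
  by rewrite -mulr_suml trans_sum// mul1r subrK mulr1.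
apply: ler_sum => a _; have [au|/negbTE au] := boolP (adm (a :: u)); last first.
  by rewrite /trans au !mul0r.
rewrite ler_wpM2l ?trans_ge0//; have Za := partfn_gt0 E m au.
have := IH _ au; rewrite -ler_pdivlMl// [X in _ <= X]mulrC => IHa.
apply: le_trans (ler_wpM2l (expR_ge0 _) IHa).
set x := last_inc F _ + _.
have -> : expR (inc F a u) * expR (mean E F m (a :: u)) = expR g * expR (x - g).
  by rewrite -!expRD; congr expR; rewrite /x /last_inc /inc /=; ring.
by rewrite ler_wpM2l ?expR_ge0// expR_ge1Dx.
Qed.

(** The exponential moments see the mean and are comparable for all pasts, so
    the means over [m] letters differ by at most [O(sqrt m)], whatever the
    cyclic classes of the pasts. *)
Lemma mean_compare K : 0 <= K -> exists2 C, 0 < C &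
  forall E F L (s : R) m a b u v, fading rho K E -> fading rho L F -> 0 < L ->
  0 < s -> m%:R <= s ^+ 2 -> 1 <= s -> adm (a :: u) -> adm (b :: v) ->
  mean E F m (a :: u) <= mean E F m (b :: v) + C * L * s.
Proof.
move=> K0; have [C [de [C0 de0 CP]]] := partfn_tilt_le K0.
have K20 : 0 <= K + de by lra.
have [Ga Ga1 GaP] := partfn_compare M rho01 K20.
exists ((2 * Ga + C * de ^+ 2) / de).
  by rewrite divr_gt0// addr_gt0 ?mulr_gt0 ?exprn_gt0//; lra.
move=> E F L s m a b u v EK FL L0 s0 ms s1 hu hv.
pose la := de / (L * s).
have Ls : 0 < L * s by rewrite mulr_gt0.
have la0 : 0 < la by rewrite divr_gt0.
have laL : `|la| * L = de / s by rewrite gtr0_norm// /la; field; rewrite !gt_eqF.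
have dle : de / s <= de by rewrite ler_pdivrMr// ler_peMr// ltW.
have FL' : fading rho (de / s) (fun w => la * F w) by rewrite -laL; exact: fadingZ.
have EF : fading rho (K + de) (fun w => E w + la * F w).
  by apply: fadingD => //; apply: fading_le FL'.
have EK' : fading rho (K + de) E by apply: fading_le EK => //; lra.
have h1 := @partfn_tilt_ge E (fun w => la * F w) m _ hu.
have h2 := @GaP _ m a b u v EF hu hv.
have h3 := @CP E _ (de / s) m b v EK FL' dle hv.
have h4 := @GaP _ m b a v u EK' hv hu.
have Zu := partfn_gt0 E m hu.
have e1 : C * (de / s) ^+ 2 * m%:R <= C * de ^+ 2.
  rewrite -mulrA ler_wpM2l ?(ltW C0)// exprMn -mulrA -[leRHS]mulr1 ler_wpM2l ?sqr_ge0//.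
  by rewrite exprVn ler_pdivrMl ?exprn_gt0// mulr1.
rewrite !meanZ in h1 h3.
set x := mean E F m (a :: u) in h1 *; set y := mean E F m (b :: v) in h3 *.
have h5 : partfn E m (a :: u) * expR (la * x) <=
    partfn E m (a :: u) * (Ga * Ga * expR (la * y + C * de ^+ 2)).
  apply: le_trans h1 _; apply: le_trans h2 _.
  have h6 : partfn (fun w => E w + la * F w) m (b :: v) <=
      (Ga * partfn E m (a :: u)) * expR (la * y + C * de ^+ 2).
    apply: le_trans h3 _; apply: ler_pM => //; rewrite ?expR_ge0 ?(ltW (partfn_gt0 E m hv))//.
    by rewrite ler_expR lerD2l.
  have := ler_wpM2l (le_trans ler01 Ga1) h6; lra.
have GaE : Ga <= expR Ga by have := expR_ge1Dx Ga; lra.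
move: h5; rewrite ler_pM2l// => h5.
have : expR (la * x) <= expR (2 * Ga + (la * y + C * de ^+ 2)).
  apply: le_trans h5 _; rewrite [leRHS]expRD ler_wpM2r ?expR_ge0//.
  have -> : 2 * Ga = Ga + Ga by ring.
  by rewrite expRD; apply: ler_pM => //; lra.
rewrite ler_expR => h6.
have -> : (2 * Ga + C * de ^+ 2) / de * L * s = (2 * Ga + C * de ^+ 2) / la.
  by rewrite /la; field; rewrite !gt_eqF.
rewrite -lerBlDl ler_pdivlMr//; lra.
Qed.

End Moments.

(** * Averages twisted by rotations *)

Section Fourier.
Variables (R : realType) (M : transition) (rho : R).
Hypothesis rho01 : 0 < rho < 1.
Local Notation A := (alphabet M).
Implicit Types (a b c : A) (u v w : seq A) (E F : seq A -> R) (K L S t : R).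
Implicit Types (g : seq A -> plane R) (p : seq A -> A -> R).

Let rho_gt0 : 0 < rho. Proof. by case/andP: rho01. Qed.
Let rho_lt1 : rho < 1. Proof. by case/andP: rho01. Qed.
Let rho_ge0 : 0 <= rho. Proof. exact: ltW. Qed.
Let rho_le1 : rho <= 1. Proof. exact: ltW. Qed.

Local Notation reg := (reg rho (@pnorm R)).
Let nD := @pnormD R.
Let nZ := @pnormZ R.

(** The transfer operator of characteristic functions, normalised by its mass. *)
Definition twist p F g u : plane R := \sum_a p u a *: rot (inc F a u) (g (a :: u)).

Fixpoint itwist n (p : nat -> seq A -> A -> R) F g : seq A -> plane R :=
  if n is k.+1 then twist (p k) F (itwist k p F g) else g.

Definition sup_le S g := forall b u, adm (b :: u) -> pnorm (g (b :: u)) <= S.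

Section OneStep.
Variables kap Cp : R.
Hypothesis kap01 : 0 < kap <= 1.
Hypothesis Cp0 : 0 <= Cp.
Local Notation chain := (chain rho kap Cp).

Lemma twist_sup p F S g : chain p -> sup_le S g -> sup_le S (twist p F g).
Proof.
move=> kp gS b u hu; have [p1 p2 _ _ _] := kp.
rewrite -[S]mul1r -(p2 b u hu); apply: (nrm_mean nD nZ) => // a /(chain_adm kp) ha.
by rewrite pnorm_rot; exact: gS.
Qed.

Lemma itwist_sup n (p : nat -> seq A -> A -> R) F S g :
  (forall i, chain (p i)) -> sup_le S g -> sup_le S (itwist n p F g).
Proof. by move=> kp gS; elim: n => //= n IH; exact: twist_sup. Qed.

Definition twist_err p F g u : plane R :=
  \sum_a p u a *: (rot (inc F a u) (g (a :: u)) - g (a :: u)).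

Lemma twistE p F g u : twist p F g u = avg p g u + twist_err p F g u.
Proof.
rewrite /twist /avg /twist_err -big_split/=; apply: eq_bigr => a _.
by rewrite -scalerDr addrC subrK.
Qed.

(** For an observable of size [K], the perturbation is of size [K] in the
    regularity norm, and only the supremum of [g] enters at first order. *)
Lemma twist_err_reg B p F K S t g : 1 <= B -> chain p -> fading rho K F ->
  sup_le S g -> reg B t g -> reg B ((Cp + 2) * K * (S + t)) (twist_err p F g).
Proof.
move=> B1 kp FK gS [og hg]; have K0 := fading_ge0 FK; have [_ f1 f2] := FK.
have [p1 p2 p3 p4 p5] := kp; have t0 := osc_ge0 nD nZ og.
have S0 : 0 <= S by apply: le_trans (gS (letter0 M) [::] isT); exact: pnorm_ge0.
have KS0 : 0 <= K * S by rewrite mulr_ge0.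
have Kt0 : 0 <= K * t by rewrite mulr_ge0.
have CKS0 : 0 <= Cp * (K * S) by rewrite mulr_ge0.
have CKt0 : 0 <= Cp * (K * t) by rewrite mulr_ge0.
have small a u : adm (a :: u) ->
    pnorm (rot (inc F a u) (g (a :: u)) - g (a :: u)) <= K * S.
  move=> hu; apply: le_trans (pnorm_rot_sub_le _ _) _.
  by apply: ler_pM; rewrite ?pnorm_ge0//; [exact: f1|exact: gS].
have errS b u : adm (b :: u) -> pnorm (twist_err p F g (b :: u)) <= K * S.
  move=> hu; rewrite -[K * S]mul1r -(p2 b u hu).
  by apply: (nrm_mean nD nZ) => // a /(chain_adm kp); exact: small.
split=> [a b u v hu hv _|j u v j0 s hu hv].
  apply: le_trans (nD _ _) _; rewrite pnormN.
  have := errS a u hu; have := errS b v hv; lra.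
have [b [u' [v' [eu ev _]]]] := share_inv j0 s.
pose r a w : plane R := rot (inc F a w) (g (a :: w)) - g (a :: w).
have -> : twist_err p F g u - twist_err p F g v =
   \sum_a p u a *: (r a u - r a v) + \sum_a (p u a - p v a) *: r a v.
  rewrite /twist_err -sumrB -big_split; apply: eq_bigr => a _ /=.
  by rewrite -/(r a u) -/(r a v) (scalerBr _ (r a u)) scalerBl subrKA.
apply: (@le_trans _ _ ((K * S + K * (B * t)) * rho ^+ j + Cp * rho ^+ j * (K * S))); last first.
  have -> : B * ((Cp + 2) * K * (S + t)) * rho ^+ j = (B * ((Cp + 2) * K * (S + t))) * rho ^+ j by [].
  rewrite [X in _ + X]mulrAC -mulrDl ler_wpM2r ?exprn_ge0//.
  have h1 : 0 <= (B - 1) * (K * S) by rewrite mulr_ge0// subr_ge0.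
  have h2 : 0 <= (B - 1) * (Cp * (K * S)) by rewrite mulr_ge0// subr_ge0.
  have h3 : 0 <= B * (Cp * (K * t)) by rewrite mulr_ge0//; lra.
  have h4 : 0 <= B * (K * S) by rewrite mulr_ge0//; lra.
  have h5 : 0 <= B * (K * t) by rewrite mulr_ge0//; lra.
  by lra.
apply: le_trans (nD _ _) _; apply: lerD.
  rewrite -[leRHS]mul1r -(p2 b u') -?eu//.
  apply: (nrm_mean nD nZ) => // a /(chain_adm kp) ha.
  have av : adm (a :: v) by rewrite -(share_adm a j0 s).
  have -> : r a u - r a v =
     rot (inc F a v) (rot (inc F a u - inc F a v) (g (a :: u)) - g (a :: u)) +
     (rot (inc F a v) (g (a :: u) - g (a :: v)) - (g (a :: u) - g (a :: v))).
    rewrite /r [in RHS]rotB rot_rot rotB (addrC (inc F a v)) subrK.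
    have regroup (x y z G H : plane R) : x - G - (z - H) = x - y + (y - z - (G - H)).
      by rewrite [RHS]addrA subrKA !opprB addrACA [RHS]addrACA [X in _ + X]addrC.
    exact: regroup.
  apply: le_trans (nD _ _) _; rewrite pnorm_rot mulrDl; apply: lerD.
    apply: le_trans (pnorm_rot_sub_le _ _) _; rewrite mulrAC.
    by apply: ler_pM; rewrite ?pnorm_ge0//; [exact: f2|exact: gS].
  apply: le_trans (pnorm_rot_sub_le _ _) _; rewrite -mulrA.
  apply: ler_pM; rewrite ?pnorm_ge0//; first exact: f1.
  have shj : share j.+1 (a :: u) (a :: v) by rewrite share_cons.
  apply: le_trans (hg j.+1 _ _ isT shj ha av) _.
  by rewrite ler_wpM2l ?mulr_ge0 ?ler_wiXn2l//; lra.
apply: le_trans (nrm_sum nD nZ _) _.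
apply: (@le_trans _ _ (\sum_a `|p u a - p v a| * (K * S))); last first.
  by rewrite -mulr_suml ler_wpM2r//; exact: p5.
apply: ler_sum => a _; rewrite nZ.
have [av|nav] := boolP (adm (a :: v)); last first.
  by rewrite !p3 ?subrr ?normr0 ?mul0r// (share_adm a j0 s).
by rewrite ler_wpM2l//; exact: small.
Qed.

(** Without the mass [kap] of one continuation, mass [1 - kap] remains. *)
Lemma twist_split p F S g a b u : chain p -> sup_le S g -> adm [:: a, b & u] ->
  pnorm (twist p F g (b :: u) - kap *: rot (inc F a (b :: u)) (g [:: a, b & u]))
  <= (1 - kap) * S.
Proof.
move=> kp gS hau; have [p1 p2 p3 p4 p5] := kp; have hu := adm_behead hau.
have -> : twist p F g (b :: u) - kap *: rot (inc F a (b :: u)) (g [:: a, b & u]) =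
   \sum_c (p (b :: u) c - kap *+ (c == a)) *: rot (inc F c (b :: u)) (g [:: c, b & u]).
  rewrite [RHS](eq_bigr _ (fun c _ => scalerBl _ _ _)) sumrB; congr (_ - _).
  by rewrite (bigD1 a)//= eqxx big1 ?addr0// => c /negbTE ->; rewrite scale0r.
have -> : 1 - kap = \sum_c (p (b :: u) c - kap *+ (c == a)).
  by rewrite sumrB p2// (bigD1 a)//= eqxx big1 ?addr0// => c /negbTE ->.
apply: (nrm_mean nD nZ) => c; case: (eqVneq c a) => [->|_]; rewrite ?mulr1n ?mulr0n ?subr0//.
- by rewrite subr_ge0; exact: p4.
- by move=> _; rewrite pnorm_rot; exact: gS.
- by move=> /(chain_adm kp) hc; rewrite pnorm_rot; exact: gS.
Qed.

Lemma twist_split2 p F S g a c b u : chain p -> sup_le S g -> a != c ->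
  adm [:: a, b & u] -> adm [:: c, b & u] ->
  pnorm (twist p F g (b :: u) - (kap *: rot (inc F a (b :: u)) (g [:: a, b & u]) +
     kap *: rot (inc F c (b :: u)) (g [:: c, b & u]))) <= (1 - 2 * kap) * S.
Proof.
move=> kp gS ac hau hcu; have [p1 p2 p3 p4 p5] := kp; have hu := adm_behead hau.
pose q e := p (b :: u) e - kap *+ (e == a) - kap *+ (e == c).
have sumE (x : A -> plane R) : \sum_e q e *: x e =
    \sum_e p (b :: u) e *: x e - (kap *: x a + kap *: x c).
  rewrite (eq_bigr (fun e => p (b :: u) e *: x e - (kap *+ (e == a)) *: x e -
    (kap *+ (e == c)) *: x e)); last by move=> e _; rewrite -!scalerBl.
  rewrite !sumrB opprD addrA; congr (_ - _ - _).
    by rewrite (bigD1 a)//= eqxx big1 ?addr0// => e /negbTE ->; rewrite scale0r.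
  by rewrite (bigD1 c)//= eqxx big1 ?addr0// => e /negbTE ->; rewrite scale0r.
have -> : 1 - 2 * kap = \sum_e q e.
  rewrite !sumrB p2// (bigD1 a)//= eqxx (big1 _ (fun e => e != a)) ?addr0; last first.
    by move=> e /negbTE ->.
  rewrite (bigD1 c)//= eqxx (big1 _ (fun e => e != c)) ?addr0; last by move=> e /negbTE ->.
  by rewrite !mulr1n; lra.
rewrite -sumE; apply: (nrm_mean nD nZ) => e; rewrite /q.
  have [->|ea] := eqVneq e a.
    by rewrite (negbTE ac) mulr1n mulr0n subr0 subr_ge0; exact: p4.
  have [->|ec] := eqVneq e c; last by rewrite !mulr0n !subr0.
  by rewrite mulr1n mulr0n subr0 subr_ge0; exact: p4.
move=> qe; rewrite pnorm_rot; apply: gS; move: qe.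
have [->//|ea] := eqVneq e a; have [->//|ec] := eqVneq e c.
by rewrite !mulr0n !subr0 => /(chain_adm kp).
Qed.

(** The contribution of the continuation [w], up to its mass, to the twisted
    average. *)
Definition ray F g w u : plane R := rot (F (w ++ u) - F u) (g (w ++ u)).

Lemma ray_rcons F g w a u :
  ray F g (rcons w a) u = rot (inc F a u) (ray F g w (a :: u)).
Proof.
by rewrite /ray rot_rot cat_rcons /inc; congr rot; ring.
Qed.

Lemma itwist_path n (p : nat -> seq A -> A -> R) F S g w b u :
  (forall i, chain (p i)) -> sup_le S g -> size w = n -> adm (w ++ b :: u) ->
  pnorm (itwist n p F g (b :: u) - kap ^+ n *: ray F g w (b :: u)) <= (1 - kap ^+ n) * S.
Proof.
move=> kp gS; case/andP: kap01 => k0 k1.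
elim: n w b u => [|n IH] w b u.
  move=> /size0nil -> hu /=.
  by rewrite /ray subrr rot0 expr0 scale1r !subrr mul0r (nrm0 nZ).
case/lastP: w => // w a; rewrite size_rcons => -[sw]; rewrite cat_rcons => hw.
have ha := adm_catr hw.
set x := kap *: rot (inc F a (b :: u)) (itwist n p F g [:: a, b & u]).
have -> : itwist n.+1 p F g (b :: u) - kap ^+ n.+1 *: ray F g (rcons w a) (b :: u) =
   (itwist n.+1 p F g (b :: u) - x) + kap *: rot (inc F a (b :: u))
     (itwist n p F g [:: a, b & u] - kap ^+ n *: ray F g w [:: a, b & u]).
  by rewrite rotB rotZ scalerBr scalerA -exprS ray_rcons addrA subrK.
apply: le_trans (nD _ _) _.
have -> : (1 - kap ^+ n.+1) * S = (1 - kap) * S + kap * ((1 - kap ^+ n) * S).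
  by rewrite exprS; ring.
apply: lerD; first by apply: twist_split => //; exact: itwist_sup.
rewrite nZ pnorm_rot gtr0_norm// ler_pM2l//; exact: IH.
Qed.

Lemma itwist_path2 n (p : nat -> seq A -> A -> R) F S g w1 w2 b u :
  (forall i, chain (p i)) -> sup_le S g -> w1 != w2 -> size w1 = n -> size w2 = n ->
  adm (w1 ++ b :: u) -> adm (w2 ++ b :: u) ->
  pnorm (itwist n p F g (b :: u) -
    kap ^+ n *: (ray F g w1 (b :: u) + ray F g w2 (b :: u))) <= (1 - 2 * kap ^+ n) * S.
Proof.
move=> kp gS; case/andP: kap01 => k0 k1.
elim: n w1 w2 b u => [|n IH] w1 w2 b u.
  by move=> + /size0nil h1 /size0nil h2; rewrite h1 h2 eqxx.
case/lastP: w1 => // w1 a; case/lastP: w2 => // w2 c.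
rewrite !size_rcons => ne [s1] [s2]; rewrite !cat_rcons => h1 h2.
have ha := adm_catr h1; have hc := adm_catr h2.
have iS : sup_le S (itwist n p F g) by exact: itwist_sup.
pose G := itwist n p F g.
have [eac|nac] := eqVneq a c.
  subst c; have {}ne : w1 != w2 by apply: contraNneq ne => ->.
  have -> : itwist n.+1 p F g (b :: u) -
      kap ^+ n.+1 *: (ray F g (rcons w1 a) (b :: u) + ray F g (rcons w2 a) (b :: u)) =
    (itwist n.+1 p F g (b :: u) - kap *: rot (inc F a (b :: u)) (G [:: a, b & u])) +
     kap *: rot (inc F a (b :: u)) (G [:: a, b & u] -
       kap ^+ n *: (ray F g w1 [:: a, b & u] + ray F g w2 [:: a, b & u])).
    by rewrite rotB rotZ rotD scalerBr scalerA -exprS !ray_rcons addrA subrK.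
  apply: le_trans (nD _ _) _.
  have -> : (1 - 2 * kap ^+ n.+1) * S = (1 - kap) * S + kap * ((1 - 2 * kap ^+ n) * S).
    by rewrite exprS; ring.
  apply: lerD; first exact: twist_split.
  by rewrite nZ pnorm_rot gtr0_norm// ler_pM2l//; exact: IH.
have -> : itwist n.+1 p F g (b :: u) -
      kap ^+ n.+1 *: (ray F g (rcons w1 a) (b :: u) + ray F g (rcons w2 c) (b :: u)) =
    (itwist n.+1 p F g (b :: u) - (kap *: rot (inc F a (b :: u)) (G [:: a, b & u]) +
       kap *: rot (inc F c (b :: u)) (G [:: c, b & u]))) +
     (kap *: rot (inc F a (b :: u)) (G [:: a, b & u] - kap ^+ n *: ray F g w1 [:: a, b & u]) +
      kap *: rot (inc F c (b :: u)) (G [:: c, b & u] - kap ^+ n *: ray F g w2 [:: c, b & u])).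
  rewrite !rotB !rotZ !scalerBr !scalerA -exprS !ray_rcons scalerDr.
  have regroup (x y z y' z' : plane R) :
      x - (y' + z') = x - (y + z) + ((y - y') + (z - z')).
    by rewrite [X in _ = _ + X]addrACA -opprD addrA subrK.
  exact: regroup.
apply: le_trans (nD _ _) _.
have -> : (1 - 2 * kap ^+ n.+1) * S = (1 - 2 * kap) * S +
    (kap * ((1 - kap ^+ n) * S) + kap * ((1 - kap ^+ n) * S)).
  by rewrite exprS; ring.
apply: lerD; first exact: twist_split2.
apply: le_trans (nD _ _) _; apply: lerD;
  by rewrite nZ pnorm_rot gtr0_norm// ler_pM2l//; exact: itwist_path.
Qed.

Lemma compat_heads w1 w2 u : u != [::] -> size w1 = size w2 ->
  adm (w1 ++ u) -> adm (w2 ++ u) ->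
  compat (head (letter0 M) (w1 ++ u)) (head (letter0 M) (w2 ++ u)).
Proof.
move=> u0; elim: w1 w2 => [|a w1 IH] [|b w2]//=; first by move=> *; exact: compat_refl.
move=> [sw] h1 h2; have := IH w2 sw (adm_behead h1) (adm_behead h2).
case: (w1 ++ u) h1 (size_cat w1 u) => [|c x] h1.
  by move: u0; rewrite -size_eq0 => /negbTE u0 /esym/eqP; rewrite addn_eq0 u0 andbF.
move=> _; case: (w2 ++ u) h2 (size_cat w2 u) => [|d y] h2.
  by move: u0; rewrite -size_eq0 => /negbTE u0 /esym/eqP; rewrite addn_eq0 u0 andbF.
move=> _ /= cd; move: h1 h2; rewrite !adm_cons2 => /andP[ca _] /andP[db _].
exact: compat_step cd ca db.
Qed.

Lemma fading_path K F w u : fading rho K F -> adm (w ++ u) ->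
  `|F (w ++ u) - F u| <= K * (size w)%:R.
Proof.
move=> FK; have [_ f1 _] := FK; elim: w => [|a w IH] hw /=.
  by rewrite subrr normr0 mulr0.
have -> : F (a :: w ++ u) - F u = inc F a (w ++ u) + (F (w ++ u) - F u).
  by rewrite /inc; ring.
apply: le_trans (ler_normD _ _) _; rewrite -natr1 mulrDr mulr1 addrC.
by apply: lerD; [exact: IH (adm_behead hw)|exact: f1].
Qed.

(** Two continuations of the same past whose phases differ by much more than
    the oscillation of [g] interfere destructively. *)
Lemma itwist_cancel n (p : nat -> seq A -> A -> R) F K S (Q : R) g b u w1 w2 :
  (forall i, chain (p i)) -> 0 < S -> 0 <= Q -> fading rho K F -> sup_le S g ->
  osc (@pnorm R) (Q * K * S) g -> K <= 1 -> 2 * K * n%:R <= 1 ->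
  size w1 = n -> size w2 = n -> adm (w1 ++ b :: u) -> adm (w2 ++ b :: u) ->
  4 * (Q + 1) * K <= `|F (w1 ++ b :: u) - F (w2 ++ b :: u)| ->
  pnorm (itwist n p F g (b :: u)) <= S * (1 - kap ^+ n / 4 * K ^+ 2).
Proof.
move=> kp S0 Q0 FK gS og K1 Kn s1 s2 h1 h2 big_gap.
have K0 := fading_ge0 FK; case/andP: kap01 => k0 k1.
have kn0 : 0 < kap ^+ n by rewrite exprn_gt0.
have K2 : K ^+ 2 <= 1 by rewrite exprn_ile1.
have kK2 : kap ^+ n * K ^+ 2 <= kap ^+ n by rewrite ler_piMr// ltW.
have [K00|Kn0] := eqVneq K 0.
  rewrite K00 expr0n mulr0 subr0 mulr1; apply: itwist_sup => //.
  exact: adm_catr h1.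
have Kp : 0 < K by rewrite lt_neqAle eq_sym Kn0.
have ne : w1 != w2.
  apply: contraTneq big_gap => ->; rewrite subrr normr0 -ltNge.
  by rewrite mulr_gt0// mulr_gt0//; lra.
set f1 := F (w1 ++ b :: u) - F (b :: u); set f2 := F (w2 ++ b :: u) - F (b :: u).
set De := F (w1 ++ b :: u) - F (w2 ++ b :: u) in big_gap.
have DeE : De = f1 - f2 by rewrite /De /f1 /f2; ring.
have De1 : `|De| <= 1.
  rewrite DeE; apply: le_trans (ler_normB _ _) _.
  have := fading_path FK h1; have := fading_path FK h2; rewrite s1 s2; lra.
set z1 := ray F g w1 (b :: u); set z2 := ray F g w2 (b :: u).
set g1 := g (w1 ++ b :: u); set g2 := g (w2 ++ b :: u).
have headE w : exists c v, w ++ b :: u = c :: v by case: w => [|c w]; [exists b, u|exists c, (w ++ b :: u)].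
have g1S : pnorm g1 <= S.
  by rewrite /g1; move: h1; have [c [v ->]] := headE w1; exact: gS.
have g2S : pnorm g2 <= S.
  by rewrite /g2; move: h2; have [c [v ->]] := headE w2; exact: gS.
have gO : pnorm (g1 - g2) <= Q * K * S.
  have := @compat_heads w1 w2 (b :: u) isT (etrans s1 (esym s2)) h1 h2; rewrite /g1 /g2.
  move: h1 h2; have [c [v ->]] := headE w1; have [e [v' ->]] := headE w2.
  by move=> hc he ce; exact: og.
have z1S : pnorm z1 <= S by rewrite /z1 /ray pnorm_rot.
have z2S : pnorm z2 <= S by rewrite /z2 /ray pnorm_rot.
have main := itwist_path2 F kp gS ne s1 s2 h1 h2.
have bound : pnorm (itwist n p F g (b :: u)) <=
    (1 - 2 * kap ^+ n) * S + kap ^+ n * pnorm (z1 + z2).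
  have -> : itwist n p F g (b :: u) = (itwist n p F g (b :: u) - kap ^+ n *: (z1 + z2)) +
      kap ^+ n *: (z1 + z2) by rewrite subrK.
  apply: le_trans (nD _ _) _; apply: lerD => //.
  by rewrite nZ gtr0_norm.
apply: le_trans bound _.
have kS : kap ^+ n * K ^+ 2 * S <= kap ^+ n * S by rewrite ler_wpM2r// ltW.
(* Either [g] is small after one of the continuations, or the two rays have
   different directions. *)
have [small|large] := leP (pnorm g1) (S / 2).
  have zz : pnorm (z1 + z2) <= 3 / 2 * S.
    apply: le_trans (nD _ _) _; have : pnorm z1 <= S / 2 by rewrite /z1 /ray pnorm_rot.
    lra.
  have := ler_wpM2l (ltW kn0) zz.
  have : 0 <= kap ^+ n * S by rewrite mulr_ge0 ?ltW.
  lra.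
have zd : K * S <= pnorm (z1 - z2).
  have -> : z1 - z2 = rot f2 ((rot De g1 - g1) + (g1 - g2)).
    rewrite addrA subrK rotB rot_rot /z1 /z2 /ray -/f1 -/f2.
    by congr (rot _ _ - _); rewrite DeE addrC subrK.
  rewrite pnorm_rot.
  have tri : pnorm (rot De g1 - g1) <= pnorm (rot De g1 - g1 + (g1 - g2)) + pnorm (g1 - g2).
    have -> : rot De g1 - g1 = (rot De g1 - g1 + (g1 - g2)) - (g1 - g2) by rewrite addrK.
    apply: le_trans (nD _ _) _; rewrite pnormN addrK//.
  have low := pnorm_rot_sub_ge g1 De1.
  have : 4 * (Q + 1) * K / 2 * (S / 2) <= `|De| / 2 * pnorm g1.
    apply: ler_pM; [|by rewrite divr_ge0 ?ltW| by lra|exact: ltW].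
    by rewrite divr_ge0// !mulr_ge0//; lra.
  move: tri low gO; lra.
have zz := pnorm_add_lt S0 K0 z1S z2S zd.
have := ler_wpM2l (ltW kn0) zz; lra.
Qed.

End OneStep.

End Fourier.

(** * Decay of characteristic functions *)

Section Decay.
Variables (R : realType) (M : transition) (rho : R).
Hypothesis rho01 : 0 < rho < 1.
Local Notation A := (alphabet M).
Implicit Types (a b c : A) (u v w : seq A) (E F : seq A -> R) (K L S t : R).
Implicit Types (g : seq A -> plane R).

Let nD := @pnormD R.
Let nZ := @pnormZ R.

Lemma itwist_add n k (p : nat -> seq A -> A -> R) F g :
  itwist (n + k) p F g = itwist k (fun i => p (n + i)%N) F (itwist n p F g).
Proof. by elim: k => [|k IH]; rewrite ?addn0// addnS /= IH. Qed.

Lemma sup_le_ge0 S g : sup_le S g -> 0 <= S.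
Proof. by move=> gS; apply: le_trans (gS (letter0 M) [::] isT); exact: pnorm_ge0. Qed.

(** The regularity of a twisted average is of the order of the size [K] of the
    observable, with a constant [Q] that does not depend on the number of
    steps. *)
Lemma itwist_reg kap Cp : 0 < kap <= 1 -> 0 <= Cp ->
  exists N r B Q de, [/\ (0 < N)%N, 0 < r < 1, 1 <= B, 0 < Q & 0 < de <= 1 /\
  forall (p : nat -> seq A -> A -> R) F K S g l, (forall i, chain rho kap Cp (p i)) ->
    fading rho K F -> K <= de -> sup_le S g -> reg rho (@pnorm R) B (Q * K * S) g ->
    (0 < l)%N -> reg rho (@pnorm R) B (r * (Q * K * S)) (itwist (l * N) p F g)].
Proof.
move=> kap01 Cp0.
have [N [r [B [N0 /andP[r0 r1] B1 step contr]]]] :=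
  avg_contraction M rho01 nD nZ kap01 Cp0.
have B0 : 0 <= B by lra.
have r1' : 0 < 1 - r by lra.
pose c3 := Cp + 2; have c30 : 0 < c3 by rewrite /c3; lra.
pose C4 := 3 ^+ N * 4 ^+ N * c3.
have C40 : 0 < C4 by rewrite /C4 !mulr_gt0 ?exprn_gt0.
pose Q := 4 * C4 / (1 - r); have Q0 : 0 < Q by rewrite /Q divr_gt0 ?mulr_gt0.
pose de := Num.min 1 (Num.min c3^-1 ((1 - r) / (4 * C4))).
have de0 : 0 < de by rewrite !lt_min ltr01 invr_gt0 c30 divr_gt0 ?mulr_gt0.
exists N, ((1 + r) / 2), B, Q, de; split => //; first by apply/andP; split; lra.
split; first by rewrite de0 ge_min lexx.
move=> p F K S g l kp FK; rewrite !le_min => /and3P[K1 Kc3 KC4] gS gR l0.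
have K0 := fading_ge0 FK.
have c3K : c3 * K <= 1 by rewrite -ler_pdivlMl// mulr1.
have C4K : C4 * K <= (1 - r) / 4.
  rewrite -ler_pdivlMl//; apply: le_trans KC4 _.
  by rewrite le_eqVlt; apply/predU1P; left; field; rewrite gt_eqF.
have one (p' : nat -> seq A -> A -> R) g' : (forall i, chain rho kap Cp (p' i)) ->
    sup_le S g' -> reg rho (@pnorm R) B (Q * K * S) g' ->
    reg rho (@pnorm R) B ((1 + r) / 2 * (Q * K * S)) (itwist N p' F g').
  move=> kp' gS' gR'; have S0 := sup_le_ge0 gS'.
  set t := Q * K * S in gR' *.
  have t0 : 0 <= t.
    by apply: mulr_ge0 => //; apply: mulr_ge0 => //; exact: ltW.
  have sx n : sup_le S (itwist n p' F g') by apply: itwist_sup.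
  have rx n : reg rho (@pnorm R) B (4 ^+ n * (t + S) - S) (itwist n p' F g').
    elim: n => [|n IH]; first by rewrite expr0 mul1r addrK.
    have -> : itwist n.+1 p' F g' = fun u => avg (p' n) (itwist n p' F g') u +
        twist_err (p' n) F (itwist n p' F g') u.
      by apply/funext => u; rewrite /= twistE.
    set tn := 4 ^+ n * (t + S) - S in IH *.
    have tn0 : 0 <= tn + S.
      by rewrite /tn subrK mulr_ge0 ?exprn_ge0//; lra.
    apply: (@reg_le _ _ _ rho01 _ _ _ (2 * tn + c3 * K * (S + tn))) => //.
      have -> : 4 ^+ n.+1 * (t + S) - S = 4 * (tn + S) - S by rewrite exprS /tn; ring.
      have : c3 * K * (S + tn) <= 1 * (S + tn) by rewrite ler_wpM2r// addrC.
      by lra.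
    apply: (regD nD); first exact: step.
    exact: twist_err_reg.
  have -> : (1 + r) / 2 * t = r * t + 3 ^+ N * (c3 * K * (4 ^+ N * (t + S))) +
     ((1 - r) / 2 * t - C4 * K * (t + S)) by rewrite /C4; lra.
  apply: (@reg_le _ _ _ rho01 _ _ _ (r * t + 3 ^+ N * (c3 * K * (4 ^+ N * (t + S))))) => //.
    rewrite lerDl subr_ge0 [C4 * K * _]mulrDr.
    have h1 : C4 * K * t <= (1 - r) / 4 * t by rewrite ler_wpM2r.
    have h2 : C4 * K * S = (1 - r) / 4 * t by rewrite /t /Q; field; rewrite gt_eqF.
    by rewrite h2; lra.
  apply: (@affine_contraction _ _ _ rho01 _ _ nD nZ kap Cp N r B B0 step contr
     p' (fun n => itwist n p' F g') (fun n => twist_err (p' n) F (itwist n p' F g'))) => //.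
  - by move=> n u; rewrite /= twistE.
  - by rewrite !mulr_ge0 ?exprn_ge0 ?(ltW c30)// addr_ge0.
  - move=> n nN.
    apply: (@reg_le _ _ _ rho01 _ _ _ (c3 * K * (S + (4 ^+ n * (t + S) - S)))) => //.
      rewrite addrC subrK ler_wpM2l ?mulr_ge0 ?(ltW c30)//.
      by rewrite ler_wpM2r ?addr_ge0// ler_weXn2l ?ler1n// ltnW.
    exact: twist_err_reg.
case: l l0 => // l _; elim: l => [|l IH]; first by rewrite mul1n; exact: one.
rewrite mulSn addnC itwist_add; apply: one; [by move=> i; exact: kp|exact: itwist_sup|].
apply: (@reg_le _ _ _ rho01 _ _ _ ((1 + r) / 2 * (Q * K * S))) => //.
have QKS : 0 <= Q * K * S.
  by apply: mulr_ge0 (sup_le_ge0 gS); apply: mulr_ge0 => //; exact: ltW.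
by rewrite ler_piMl//; lra.
Qed.

(** The conditional characteristic function of the next [m] increments of [F]. *)
Definition wave E F m : seq A -> plane R := itwist m (trans E) F (fun=> (1, 0)).

(** In every block of [l * N] letters, the supremum of the wave decreases by a
    factor [1 - c L ^ 2] because two continuations interfere destructively; the
    regularity of the wave stays of order [L] times its supremum, which
    allows the argument to be repeated. *)
Theorem wave_decay K : 0 <= K -> exists X N, [/\ 0 < X, (0 < N)%N &
  forall l, (0 < l)%N -> exists c de : R, [/\ 0 < c, 0 < de &
  forall E F L, fading rho K E -> fading rho L F -> L <= de ->
  (forall b u, adm (b :: u) -> exists w1 w2,
     [/\ size w1 = (l * N)%N, size w2 = (l * N)%N, adm (w1 ++ b :: u), adm (w2 ++ b :: u) &
       X * L <= `|F (w1 ++ b :: u) - F (w2 ++ b :: u)|]) ->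
  forall m b u, adm (b :: u) ->
  pnorm (wave E F m (b :: u)) <= expR (1 - c * L ^+ 2 * m%:R)]].
Proof.
move=> K0; have [kap [Cp [kap01 Cp0 kerP]]] := trans_chain M rho01 K0.
have /andP[k0 k1] := kap01.
have [N [r [B [Q [de [N0 /andP[r0 r1] B1 Q0 [/andP[de0 de1] regP]]]]]]] :=
  itwist_reg kap01 Cp0.
exists (4 * (Q + 1)), N; split; [by rewrite mulr_gt0//; lra|by []|move=> l l0].
set n := (l * N)%N; have n0 : (0 < n)%N by rewrite muln_gt0 l0.
have nR : 0 < n%:R :> R by rewrite ltr0n.
pose c0 := kap ^+ n / 4; have c00 : 0 < c0 by rewrite divr_gt0// exprn_gt0.
have c01 : c0 <= 4^-1.
  by rewrite /c0 -[leRHS]mul1r ler_wpM2r// exprn_ile1// ltW.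
exists (c0 / n%:R), (Num.min de (Num.min (1 - r) (2 * n%:R)^-1)); split.
- exact: divr_gt0.
- by rewrite !lt_min de0 subr_gt0 r1 invr_gt0 mulr_gt0.
move=> E F L EK FL; rewrite !le_min => /and3P[Lde Lr Ln] pairs.
have L0 := fading_ge0 FL; have L1 : L <= 1 by exact: le_trans de1.
have L2 : L ^+ 2 <= L by rewrite expr2 ler_piMr.
have Ln' : 2 * L * n%:R <= 1.
  by rewrite mulrAC -ler_pdivlMl ?mulr_gt0// mulr1.
have ker i : chain rho kap Cp (trans E i) by exact: kerP.
have cL : c0 * L ^+ 2 <= 1 - r.
  apply: le_trans (le_trans L2 Lr); rewrite ler_piMl ?sqr_ge0//; lra.
have cL1 : c0 * L ^+ 2 < 1 by apply: le_lt_trans cL _; lra.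
have cL0 : 0 <= c0 * L ^+ 2 by rewrite mulr_ge0 ?sqr_ge0// ltW.
set q := 1 - c0 * L ^+ 2; have q0 : 0 < q by rewrite /q; lra.
have block k : sup_le (q ^+ k) (wave E F (k * n)) /\
    reg rho (@pnorm R) B (Q * L * q ^+ k) (wave E F (k * n)).
  elim: k => [|k [IHs IHr]].
    split; first by move=> b u _; rewrite pnorm_le// expr0 !expr1n expr0n addr0.
    by apply: (reg_const _ rho01 nZ); [lra|rewrite !mulr_ge0// ltW].
  have qk : 0 < q ^+ k by rewrite exprn_gt0.
  rewrite mulSn addnC /wave itwist_add -/(wave E F (k * n)); split.
    move=> b u hu; have [w1 [w2 [s1 s2 h1 h2 gap]]] := pairs b u hu.
    rewrite exprSr; have [og _] := IHr.
    exact: (itwist_cancel kap01 (fun i => ker (k * n + i)%N) qk (ltW Q0) FL IHs og L1 Ln' s1 s2 h1 h2 gap).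
  apply: (@reg_le _ _ _ rho01 _ _ _ (r * (Q * L * q ^+ k))); [lra| |].
    rewrite exprSr [r * _]mulrC mulrA ler_wpM2l//; last by rewrite /q; lra.
    by rewrite !mulr_ge0 ?(ltW Q0) ?(ltW qk).
  by apply: regP => // i; exact: ker.
move=> m b u hu; set k := (m %/ n)%N.
have -> : wave E F m = itwist (m %% n) (fun i => trans E (k * n + i)%N) F (wave E F (k * n)).
  by rewrite /wave -itwist_add -divn_eq.
have [bs _] := block k.
apply: le_trans (itwist_sup (m %% n) F (fun i => ker (k * n + i)%N) bs hu) _.
apply: (@le_trans _ _ (expR (- (c0 * L ^+ 2) * k%:R))).
  rewrite mulrC expRM_natl; apply: lerXn2r; rewrite ?nnegrE ?expR_ge0 ?(ltW q0)//.
  by have := expR_ge1Dx (- (c0 * L ^+ 2)).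
rewrite ler_expR.
have mk : m%:R <= (k%:R + 1) * n%:R :> R.
  by rewrite natr1 -natrM ler_nat mulSn addnC {1}(divn_eq m n) leq_add2l ltnW// ltn_pmod.
have : c0 / n%:R * L ^+ 2 * m%:R <= c0 * L ^+ 2 * (k%:R + 1).
  have -> : c0 / n%:R * L ^+ 2 * m%:R = c0 * L ^+ 2 * (m%:R / n%:R) by ring.
  by rewrite ler_wpM2l// ler_pdivrMr.
lra.
Qed.

Lemma pnorm_fst (z : plane R) : `|z.1| <= pnorm z.
Proof.
rewrite -ler_sqr ?nnegrE ?pnorm_ge0// pnormE real_normK ?num_real//.
by rewrite lerDl sqr_ge0.
Qed.

Lemma transfer_cos E F m (x : R) u : adm u ->
  transfer E m (fun v => cos (F v - F u + x)) u =
  partfn E m u * (rot x (wave E F m u)).1.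
Proof.
elim: m u x => [|m IH] u x hu.
  by rewrite /partfn /= subrr add0r mul1r mul0r subr0 mul1r.
rewrite transferS//; congr (_ * _).
have fstD (s : A -> plane R) : (\sum_a s a).1 = \sum_a (s a).1.
  by elim/big_rec2 : _ => //= a y z _ <-.
have -> : rot x (wave E F m.+1 u) = \sum_a trans E m u a *:
    rot (x + inc F a u) (wave E F m (a :: u)).
  rewrite /wave /= /twist (big_morph _ (rotD x) (_ : rot x 0 = 0)); last first.
    by rewrite /rot !mul0r subrr addr0.
  by apply: eq_bigr => a _; rewrite rotZ rot_rot.
rewrite fstD; apply: eq_bigr => a _ /=; rewrite -[RHS]/(trans E m u a * _).
have [au|/negbTE au] := boolP (adm (a :: u)); last by rewrite /trans au !mul0r.
congr (_ * _); have Za := partfn_gt0 E m au.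
rewrite (@eq_transfer _ _ E m _ (fun v => cos (F v - F (a :: u) + (x + inc F a u))))//.
  by rewrite IH// mulrAC mulfV ?gt_eqF// mul1r.
by move=> w _ _; congr cos; rewrite /inc; ring.
Qed.

Lemma transfer_cos_le E F m (x : R) u : adm u ->
  transfer E m (fun v => cos (F v - F u + x)) u <=
  partfn E m u * pnorm (wave E F m u).
Proof.
move=> hu; rewrite transfer_cos// ler_pM2l ?partfn_gt0//.
by apply: le_trans (ler_norm _) _; apply: le_trans (pnorm_fst _) _; rewrite pnorm_rot.
Qed.

End Decay.

(** * Concentration and Gaussian tails *)

Section Concentration.
Variables (R : realType) (M : transition) (rho : R).
Hypothesis rho01 : 0 < rho < 1.
Local Notation A := (alphabet M).
Implicit Types (a b c : A) (u v w : seq A) (E F : seq A -> R) (K : R).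
Variables (d : nat) (Fv : 'I_d -> seq A -> R) (KF : R).
Hypothesis KF0 : 0 < KF.
Hypothesis FvP : forall i, fading rho KF (Fv i).

Definition lin (x : 'I_d -> R) u : R := \sum_i x i * Fv i u.

Definition l1 (x : 'I_d -> R) : R := \sum_i `|x i|.

Lemma l1_ge0 x : 0 <= l1 x. Proof. exact: sumr_ge0. Qed.

Lemma fading_lin x : fading rho (KF * l1 x) (lin x).
Proof. by rewrite mulr_sumr; apply: fading_sum => i; rewrite mulrC; exact: fadingZ. Qed.

(** The observable varies in every direction: some pairs of continuations of
    any given past, of any large common length, are far apart. *)
Definition spread := forall X : R, exists n0, forall n, (n0 <= n)%N ->
  forall x b u, adm (b :: u) -> exists w1 w2,
  [/\ size w1 = n, size w2 = n, adm (w1 ++ b :: u), adm (w2 ++ b :: u) &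
    X * l1 x <= `|lin x (w1 ++ b :: u) - lin x (w2 ++ b :: u)|].

Lemma sum_sqr_le_l1 x : \sum_i x i ^+ 2 <= l1 x ^+ 2.
Proof.
rewrite expr2 {1}/l1 mulr_suml; apply: ler_sum => i _.
rewrite -(real_normK (num_real (x i))) expr2 ler_wpM2l//.
by rewrite /l1 (bigD1 i)//= lerDl sumr_ge0.
Qed.

Definition near_at (L : R) (z : 'I_d -> R) u v : bool :=
  [forall i, `|Fv i v - Fv i u - z i| <= L].

(** Fejer kernel: the square of a trigonometric sum dominates the indicator of
    a box and is a combination of characters, whose means decay.  The
    frequencies form a grid of about [m ^ (d / 2)] points of mesh about
    [m ^ (- 1 / 2)], so that the decay makes different points almost
    orthogonal. *)
Theorem concentration K L : 0 <= K -> 0 <= L -> spread -> exists2 C, 0 < C &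
  forall E m z b u, fading rho K E -> (0 < m)%N -> adm (b :: u) ->
  transfer E m (fun v => (near_at L z (b :: u) v)%:R) (b :: u) <=
  C * (Num.sqrt m%:R)^-1 ^+ d * partfn E m (b :: u).
Proof.
move=> K0 L0 sp; have [X [N [X0 N0 NP]]] := wave_decay M rho01 K0.
have [n0 n0P] := sp (X * KF).
have [c [de [c0 de0 decay]]] := NP n0.+1 isT.
have dL : 0 < d%:R * L + 1 by rewrite ltr_wpDl// mulr_ge0.
have Kd : 0 < KF * d%:R + 1 by rewrite ltr_wpDl// mulr_ge0// ltW.
pose e := Num.min (de / (KF * d%:R + 1)) (d%:R * L + 1)^-1.
have e0 : 0 < e by rewrite lt_min divr_gt0// invr_gt0.
have eK : KF * (d%:R * e) <= de.
  have : e <= de / (KF * d%:R + 1) by rewrite /e ge_min lexx.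
  by rewrite ler_pdivlMr// mulrDr mulr1; lra.
have eL : e * d%:R * L <= 1.
  have : e <= (d%:R * L + 1)^-1 by rewrite /e ge_min lexx orbT.
  by rewrite -[leRHS]mul1r ler_pdivlMr// mulrDr mulr1; lra.
clearbody e.
pose be := c * KF ^+ 2 * e ^+ 2 / 4.
have be0 : 0 < be by rewrite /be divr_gt0// !mulr_gt0// exprn_gt0.
pose G := 2 / (1 - expR (- be)).
have G0 : 0 < G by rewrite divr_gt0// subr_gt0 -expR0 ltr_expR oppr_lt0.
exists (4 * expR 1 * G ^+ d); first by rewrite !mulr_gt0 ?expR_gt0 ?exprn_gt0.
move=> E m z b u EK m0 hu; have Zu := partfn_gt0 E m hu.
have [J [J0 mJ Jm]] := nat_sqrt m0.
have JR : 0 < J%:R :> R by rewrite ltr0n.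
(* [J] is of order [sqrt m], and [e] is so small that all phases are at most [1]
   on the box. *)
pose h := e / J%:R; have h0 : 0 < h by rewrite divr_gt0.
pose T := {ffun 'I_d -> 'I_J}.
have cardT : #|T|%:R = J%:R ^+ d :> R by rewrite card_ffun !card_ord natrX.
have cT0 : 0 < #|T|%:R :> R by rewrite cardT exprn_gt0.
pose xi (j k : T) (i : 'I_d) : R := h * ((j i)%:R - (k i)%:R).
pose x0 (j k : T) : R := - \sum_i xi j k i * z i.
pose th (j : T) v : R := h * \sum_i (j i)%:R * (Fv i v - Fv i (b :: u) - z i).
have thB j k v : th j v - th k v = lin (xi j k) v - lin (xi j k) (b :: u) + x0 j k.
  rewrite /th /lin /x0 -mulrBr -!sumrB mulr_sumr; apply: eq_bigr => i _.
  by rewrite /xi; ring.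
have fejer v : \sum_j \sum_k cos (th j v - th k v) =
    (\sum_j cos (th j v)) ^+ 2 + (\sum_j sin (th j v)) ^+ 2.
  rewrite !expr2 !mulr_suml -big_split/=; apply: eq_bigr => j _.
  rewrite !mulr_sumr -big_split/=; apply: eq_bigr => k _.
  by rewrite cosB.
have ind v : (near_at L z (b :: u) v)%:R <=
    4 / #|T|%:R ^+ 2 * \sum_j \sum_k cos (lin (xi j k) v - lin (xi j k) (b :: u) + x0 j k).
  rewrite (eq_bigr (fun j => \sum_k cos (th j v - th k v))); last first.
    by move=> j _; apply: eq_bigr => k _; rewrite thB.
  rewrite fejer; have [near|_] := boolP (near_at L z (b :: u) v); last first.
    by rewrite mulr_ge0 ?addr_ge0 ?sqr_ge0// divr_ge0// sqr_ge0.
  have small j : `|th j v| <= 1.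
    apply: le_trans eL; rewrite /th normrM (gtr0_norm h0).
    have -> : e * d%:R * L = h * \sum_(i < d) J%:R * L.
      by rewrite sumr_const card_ord -mulr_natr /h; field; rewrite gt_eqF.
    rewrite ler_pM2l//; apply: le_trans (ler_norm_sum _ _ _) _; apply: ler_sum => i _.
    rewrite normrM normr_nat; apply: ler_pM => //.
      by rewrite ler_nat ltnW.
    by move/forallP: near => /(_ i).
  have half : #|T|%:R / 2 <= \sum_j cos (th j v).
    have -> : #|T|%:R / 2 = \sum_(j : T) 2^-1 :> R by rewrite sumr_const mulr_natl.
    by apply: ler_sum => j _; exact: cos_ge_half.
  have sq : (#|T|%:R / 2) ^+ 2 <= (\sum_j cos (th j v)) ^+ 2.
    by rewrite ler_sqr ?nnegrE ?divr_ge0// (le_trans _ half)// divr_ge0.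
  rewrite mulrAC ler_pdivlMr ?exprn_gt0// mul1r.
  by have := sqr_ge0 (\sum_j sin (th j v)); move: sq; rewrite exprMn; lra.
apply: (@le_trans _ _ (transfer E m (fun v => 4 / #|T|%:R ^+ 2 *
    \sum_j \sum_k cos (lin (xi j k) v - lin (xi j k) (b :: u) + x0 j k)) (b :: u))).
  by apply: transfer_le => // w _ _; exact: ind.
rewrite transferZ transfer_sum.
have waves j k : transfer E m
     (fun v => cos (lin (xi j k) v - lin (xi j k) (b :: u) + x0 j k)) (b :: u) <=
   partfn E m (b :: u) * (expR 1 * \prod_i expR (- (be * ((j i)%:R - (k i)%:R) ^+ 2))).
  apply: le_trans (transfer_cos_le E (lin (xi j k)) m (x0 j k) hu) _.
  rewrite ler_pM2l//.
  have l1xi : l1 (xi j k) <= d%:R * e.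
    have -> : d%:R * e = \sum_(i < d) e by rewrite sumr_const card_ord mulr_natl.
    apply: ler_sum => i _; rewrite /xi normrM (gtr0_norm h0) /h mulrAC ler_pdivrMr//.
    rewrite ler_pM2l// ler_norml; apply/andP; split.
      by rewrite lerBrDr addrC; apply: (@le_trans _ _ 0); rewrite ?subr_le0 ?ler_nat// ltnW.
    by rewrite lerBlDr; apply: (@le_trans _ _ J%:R); rewrite ?lerDl// ler_nat ltnW.
  have Kle : KF * l1 (xi j k) <= de by apply: le_trans eK; rewrite ler_pM2l.
  have gap b' u' : adm (b' :: u') -> exists w1 w2,
     [/\ size w1 = (n0.+1 * N)%N, size w2 = (n0.+1 * N)%N, adm (w1 ++ b' :: u'),
       adm (w2 ++ b' :: u') & X * (KF * l1 (xi j k)) <=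
       `|lin (xi j k) (w1 ++ b' :: u') - lin (xi j k) (w2 ++ b' :: u')|].
    by move=> hu'; rewrite mulrA; apply: n0P => //; rewrite (leq_trans (leqnSn n0))// leq_pmulr.
  apply: le_trans (decay E _ _ EK (fading_lin _) Kle gap m b u hu) _.
  rewrite -expR_sum -expRD ler_expR lerD2l sumrN lerN2 -mulr_sumr.
  have sq := sum_sqr_le_l1 (xi j k).
  have -> : c * (KF * l1 (xi j k)) ^+ 2 * m%:R = c * KF ^+ 2 * m%:R * l1 (xi j k) ^+ 2.
    by rewrite exprMn; ring.
  have cm : 0 <= c * KF ^+ 2 * m%:R by rewrite !mulr_ge0 ?sqr_ge0// ltW.
  apply: le_trans (ler_wpM2l cm sq).
  have -> : \sum_i xi j k i ^+ 2 = h ^+ 2 * \sum_i ((j i)%:R - (k i)%:R) ^+ 2.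
    by rewrite mulr_sumr; apply: eq_bigr => i _; rewrite exprMn.
  rewrite mulrA ler_wpM2r//; first by apply: sumr_ge0 => i _; exact: sqr_ge0.
  rewrite /be /h exprMn exprVn.
  have JmR : (J%:R : R) ^+ 2 <= 4 * m%:R by rewrite -natrX -natrM ler_nat.
  have ck : 0 <= c * KF ^+ 2 * e ^+ 2 / 4 by rewrite divr_ge0// ltW// !mulr_gt0// exprn_gt0.
  have -> : c * KF ^+ 2 * m%:R * (e ^+ 2 / J%:R ^+ 2) =
     c * KF ^+ 2 * e ^+ 2 / 4 * (4 * m%:R / J%:R ^+ 2) by field; rewrite gt_eqF.
  by rewrite ler_peMr// ler_pdivlMr ?exprn_gt0// mul1r.
apply: (@le_trans _ _ (4 / #|T|%:R ^+ 2 *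
    (partfn E m (b :: u) * expR 1 * (#|T|%:R * G ^+ d)))).
  rewrite ler_wpM2l ?divr_ge0 ?sqr_ge0//.
  have -> : #|T|%:R * G ^+ d = \sum_(j : T) G ^+ d by rewrite sumr_const mulr_natl.
  rewrite mulr_sumr; apply: ler_sum => j _; rewrite transfer_sum.
  apply: (@le_trans _ _ (\sum_(k : T) (partfn E m (b :: u) * expR 1 *
      \prod_i expR (- (be * ((j i)%:R - (k i)%:R) ^+ 2))))).
    by apply: ler_sum => k _; rewrite -mulrA.
  rewrite -mulr_sumr ler_pM2l ?mulr_gt0 ?expR_gt0//.
  rewrite -(bigA_distr_bigA (fun i (l : 'I_J) => expR (- (be * ((j i)%:R - l%:R) ^+ 2)))).
  have -> : G ^+ d = \prod_(i < d) G by rewrite prodr_const card_ord.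
  apply: ler_prod => i _; apply/andP; split; last exact: gauss_sum_le.
  by apply: sumr_ge0 => l _; exact: expR_ge0.
have -> : 4 / #|T|%:R ^+ 2 * (partfn E m (b :: u) * expR 1 * (#|T|%:R * G ^+ d)) =
   4 * expR 1 * G ^+ d * partfn E m (b :: u) * #|T|%:R^-1.
  by field; rewrite gt_eqF.
rewrite [leRHS]mulrAC ler_pM2l; last by rewrite !mulr_gt0 ?expR_gt0 ?exprn_gt0.
rewrite cardT -exprVn; apply: lerXn2r; rewrite ?nnegrE ?invr_ge0 ?sqrtr_ge0//.
have sm : 0 < Num.sqrt m%:R :> R by rewrite sqrtr_gt0 ltr0n.
rewrite lef_pV2 ?posrE// -(ger0_norm (ltW JR)) -sqrtr_sqr ler_sqrt ?sqr_ge0//.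
by rewrite -natrX ler_nat.
Qed.

End Concentration.

Section LocalBound.
Variables (R : realType) (M : transition) (rho : R).
Hypothesis rho01 : 0 < rho < 1.
Local Notation A := (alphabet M).
Implicit Types (a b : A) (u v w : seq A) (E F : seq A -> R) (K : R).
Variables (d : nat) (Fv : 'I_d -> seq A -> R) (KF : R).
Hypothesis KF0 : 0 < KF.
Hypothesis FvP : forall i, fading rho KF (Fv i).

Lemma transfer_tilt E F m (G : seq A -> R) u :
  transfer (fun v => E v + F v) m G u =
  transfer E m (fun v => expR (F v - F u) * G v) u.
Proof.
elim: m u => [|m IH] u /=; first by rewrite subrr expR0 mul1r.
apply: eq_bigr => a _; rewrite IH.
have -> : inc (fun v => E v + F v) a u = inc E a u + inc F a u by rewrite /inc; ring.
rewrite (expRD (inc E a u)) -mulrA -transferZ; congr (_ * transfer _ _ _ _).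
by apply/funext => v; rewrite mulrA -expRD; congr (expR _ * _); rewrite /inc; ring.
Qed.

Lemma l1_sqr_le (x : 'I_d -> R) : l1 x ^+ 2 <= d%:R * \sum_i x i ^+ 2.
Proof.
have : 0 <= \sum_i \sum_j (`|x i| - `|x j|) ^+ 2.
  by apply: sumr_ge0 => i _; apply: sumr_ge0 => j _; exact: sqr_ge0.
have -> : \sum_i \sum_j (`|x i| - `|x j|) ^+ 2 =
    2 * (d%:R * \sum_i x i ^+ 2) - 2 * l1 x ^+ 2.
  transitivity (\sum_i (d%:R * x i ^+ 2 + \sum_j x j ^+ 2 - 2 * `|x i| * l1 x)).
    apply: eq_bigr => i _; rewrite /l1 mulr_sumr -[d in d%:R]card_ord mulr_natl -sumr_const.
    rewrite -big_split -sumrB /=; apply: eq_bigr => j _.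
    by rewrite sqrrB !real_normK ?num_real//; ring.
  rewrite sumrB big_split /= sumr_const card_ord -mulr_natl -mulr_sumr.
  have -> : \sum_i 2 * `|x i| * l1 x = 2 * l1 x ^+ 2.
    by rewrite -mulr_suml -mulr_sumr -/(l1 x); ring.
  by ring.
by lra.
Qed.

(** Exponential change of measure: tilting by [eps * z / m] moves the target to
    the bulk, where the concentration estimate applies; the cost of the tilt is
    the Gaussian factor. *)
Theorem local_bound E K L C1 de1 : fading rho K E -> 0 <= L -> 0 < C1 -> 0 < de1 ->
  spread Fv ->
  (forall (x : 'I_d -> R) m b u, adm (b :: u) -> KF * l1 x <= de1 ->
     partfn (fun v => E v + lin Fv x v) m (b :: u) <=
     C1 * expR (C1 * l1 x ^+ 2 * m%:R) * partfn E m (b :: u)) ->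
  exists C c, [/\ 0 < C, 0 < c &
  forall m z b u, (0 < m)%N -> adm (b :: u) ->
  transfer E m (fun v => (near_at Fv L z (b :: u) v)%:R) (b :: u) <=
  C * (Num.sqrt m%:R)^-1 ^+ d * expR (- (c * ((\sum_i z i ^+ 2) / m%:R))) *
  partfn E m (b :: u)].
Proof.
move=> EK L0 C10 de10 sp mgf; have K0 := fading_ge0 EK.
have K'0 : 0 <= K + de1 by lra.
have [C2 C20 conc] := concentration rho01 KF0 FvP K'0 L0 sp.
pose W := L + KF; have W0 : 0 < W by exact: ltr_wpDl.
have dW0 : 0 <= KF * (d%:R * W) by rewrite mulr_ge0 ?(ltW KF0)// mulr_ge0// ltW.
have Cd0 : 0 <= 2 * C1 * d%:R by rewrite !mulr_ge0 ?(ltW C10).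
pose e := Num.min (de1 / (KF * (d%:R * W) + 1)) (2 * C1 * d%:R + 1)^-1.
have e0 : 0 < e by rewrite lt_min divr_gt0 ?invr_gt0//; lra.
have eW : KF * (d%:R * (e * W)) <= de1.
  have : e <= de1 / (KF * (d%:R * W) + 1) by rewrite /e ge_min lexx.
  by rewrite ler_pdivlMr; lra.
have eC : 2 * (C1 * d%:R * e) <= 1.
  have : e <= (2 * C1 * d%:R + 1)^-1 by rewrite /e ge_min lexx orbT.
  by rewrite -[leRHS]mul1r ler_pdivlMr; lra.
clearbody e.
exists (C2 * C1 * expR (d%:R * (e * W) * L)), (e / 2); split.
- by rewrite !mulr_gt0 ?expR_gt0.
- by rewrite divr_gt0.
move=> m z b u m0 hu; have Zu := partfn_gt0 E m hu.
have mR : 0 < m%:R :> R by rewrite ltr0n.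
have sm : 0 < (Num.sqrt m%:R)^-1 ^+ d :> R by rewrite exprn_gt0// invr_gt0 sqrtr_gt0.
(* Increments are bounded by [KF], so that a displacement beyond [W * m] does not
   occur. *)
have [small|/existsP[i big_i]] :=
    boolP [forall i, `|z i| <= W * m%:R]; last first.
  rewrite (@eq_transfer _ _ E m _ (fun=> 0 * 0))//; last first.
    move=> w sw hw; rewrite mul0r /near_at; case: forallP => // /(_ i) near.
    have := fading_path (FvP i) hw; rewrite sw => far.
    case/negP: big_i; rewrite /W.
    have : `|z i| <= `|Fv i (w ++ b :: u) - Fv i (b :: u)| +
        `|Fv i (w ++ b :: u) - Fv i (b :: u) - z i|.
      apply: le_trans (ler_normB _ _).
      by rewrite opprB addrC subrK.
    have : L <= L * m%:R by rewrite ler_peMr// ler1n.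
    by lra.
  rewrite transferZ mul0r; apply: mulr_ge0 (ltW Zu); apply: mulr_ge0 (expR_ge0 _).
  by rewrite mulr_ge0 ?(ltW sm)// ltW// !mulr_gt0 ?expR_gt0.
pose x i : R := e / m%:R * z i.
have em : 0 < e / m%:R by rewrite divr_gt0.
have l1x : l1 x <= d%:R * (e * W).
  have -> : d%:R * (e * W) = \sum_(i < d) e * W by rewrite sumr_const card_ord mulr_natl.
  apply: ler_sum => i _; rewrite /x normrM (gtr0_norm em) -mulrA ler_pM2l//.
  rewrite ler_pdivrMl// mulrC.
  by move/forallP: small.
have Kx : KF * l1 x <= de1 by apply: le_trans eW; rewrite ler_pM2l.
have tiltK : fading rho (K + de1) (fun v => E v + lin Fv x v).
  by apply: fadingD => //; apply: fading_le Kx (fading_lin _ _).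
pose s := \sum_i z i ^+ 2.
have s0 : 0 <= s by apply: sumr_ge0 => i _; exact: sqr_ge0.
have sx : \sum_i x i ^+ 2 = (e / m%:R) ^+ 2 * s.
  by rewrite mulr_sumr; apply: eq_bigr => i _; rewrite exprMn.
have xz : \sum_i x i * z i = e / m%:R * s.
  by rewrite mulr_sumr; apply: eq_bigr => i _; rewrite /x expr2 mulrA.
have step1 : transfer E m (fun v => (near_at Fv L z (b :: u) v)%:R) (b :: u) <=
   expR (d%:R * (e * W) * L - e / m%:R * s) *
   transfer (fun v => E v + lin Fv x v) m (fun v => (near_at Fv L z (b :: u) v)%:R) (b :: u).
  rewrite transfer_tilt -transferZ; apply: transfer_le => // w sw hw.
  have [near|_] := boolP (near_at _ _ _ _ _); last by rewrite !mulr0.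
  rewrite !mulr1 -expRD one_le_expR//.
  have -> : lin Fv x (w ++ b :: u) - lin Fv x (b :: u) =
     e / m%:R * s + \sum_i x i * (Fv i (w ++ b :: u) - Fv i (b :: u) - z i).
    by rewrite -xz /lin -sumrB -big_split; apply: eq_bigr => i _ /=; ring.
  set r := \sum_i _.
  have : `|r| <= d%:R * (e * W) * L.
    apply: le_trans (ler_wpM2r L0 l1x); apply: le_trans (ler_norm_sum _ _ _) _.
    rewrite mulr_suml; apply: ler_sum => i _; rewrite normrM ler_wpM2l//.
    by move/forallP: near.
  by rewrite ler_norml => /andP[]; lra.
apply: le_trans step1 _.
have step2 := conc _ m z b u tiltK m0 hu.
have step3 := mgf x m b u hu Kx.
apply: (@le_trans _ _ (expR (d%:R * (e * W) * L - e / m%:R * s) *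
   (C2 * (Num.sqrt m%:R)^-1 ^+ d *
    (C1 * expR (C1 * l1 x ^+ 2 * m%:R) * partfn E m (b :: u))))).
  rewrite ler_wpM2l ?expR_ge0//; apply: le_trans step2 _.
  by rewrite ler_wpM2l// mulr_ge0 ?ltW.
have quad : C1 * l1 x ^+ 2 * m%:R <= e / 2 / m%:R * s.
  have h := l1_sqr_le x; rewrite sx in h.
  apply: (@le_trans _ _ (C1 * (d%:R * ((e / m%:R) ^+ 2 * s)) * m%:R)).
    by rewrite ler_wpM2r// ler_wpM2l// ltW.
  have -> : C1 * (d%:R * ((e / m%:R) ^+ 2 * s)) * m%:R =
     2 * (C1 * d%:R * e) * (e / 2 / m%:R * s) by field; rewrite gt_eqF.
  by rewrite -[leRHS]mul1r ler_wpM2r// mulr_ge0// !mulr_ge0 ?invr_ge0// ltW.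
have -> : C2 * C1 * expR (d%:R * (e * W) * L) * (Num.sqrt m%:R)^-1 ^+ d *
    expR (- (e / 2 * (s / m%:R))) * partfn E m (b :: u) =
    (expR (d%:R * (e * W) * L) * expR (- (e / 2 * (s / m%:R)))) *
    (C2 * (Num.sqrt m%:R)^-1 ^+ d * C1 * partfn E m (b :: u)) by ring.
have -> : expR (d%:R * (e * W) * L - e / m%:R * s) * (C2 * (Num.sqrt m%:R)^-1 ^+ d *
    (C1 * expR (C1 * l1 x ^+ 2 * m%:R) * partfn E m (b :: u))) =
    (expR (d%:R * (e * W) * L - e / m%:R * s) * expR (C1 * l1 x ^+ 2 * m%:R)) *
    (C2 * (Num.sqrt m%:R)^-1 ^+ d * C1 * partfn E m (b :: u)) by ring.
rewrite ler_wpM2r//; last by rewrite -!expRD ler_expR; lra.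
by apply: mulr_ge0 (ltW Zu); rewrite !mulr_ge0 ?(ltW C20) ?(ltW sm) ?(ltW C10).
Qed.

End LocalBound.

(** * Loops with different energies *)

Section Loops.
Variables (R : realType) (M : transition) (rho : R).
Hypothesis rho01 : 0 < rho < 1.
Local Notation A := (alphabet M).
Local Notation c0 := (letter0 M).
Implicit Types (a b : A) (u v w q : seq A) (F : seq A -> R) (K : R).

Definition loop w := (exists w', w = c0 :: w') /\ adm (w ++ [:: c0]).

Lemma adm_rcons a u b : adm (a :: u) -> adj b (last a u) -> adm ((a :: u) ++ [:: b]).
Proof. by rewrite /adm /= cat_path /= => -> ->. Qed.

Lemma fading_word K F w : fading rho K F -> adm w -> `|F w| <= K * (size w)%:R.
Proof.
move=> FK hw; have [F0 _ _] := FK.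
by have := @fading_path R M rho K F w [::] FK; rewrite cats0 F0 subr0; exact.
Qed.

(** The connecting words only have to join finitely many pairs of letters. *)
Lemma close_loop : exists N, forall w, w != [::] -> adm w ->
  exists q1 q2, [/\ (size q1 <= N)%N, (size q2 <= N)%N, q1 != [::] & loop (q2 ++ w ++ q1)].
Proof.
have [N NP] := @reach_uniform M; exists N => -[//|h w] _ hw.
have [b bl] := pred_exists (last h w).
have [n1 [n1N r1]] := NP c0 b; have [q1 s1 h1] := reach_word r1.
have [n2 [n2N r2]] := NP h c0; have [q2 s2 h2] := reach_word r2.
exists (b :: q1), (c0 :: q2); split => //=; [by rewrite s1|by rewrite s2|].
split; first by exists (q2 ++ (h :: w) ++ b :: q1).
have -> : (c0 :: q2 ++ h :: w ++ b :: q1) ++ [:: c0] =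
    (c0 :: q2) ++ (h :: w) ++ (b :: q1) ++ [:: c0] by rewrite /= -!catA /= -!catA.
apply: (@adm_glue _ (c0 :: q2) h (w ++ (b :: q1) ++ [:: c0])) => //.
apply: (@adm_glue _ (h :: w) b (q1 ++ [:: c0])) => //; exact: adm_rcons.
Qed.

Definition power k w : seq A := iter k (cat w) [::].

Lemma size_power k w : size (power k w) = (k * size w)%N.
Proof. by elim: k => //= k IH; rewrite size_cat IH mulSn. Qed.

Lemma loop_glue w v : loop w -> (exists v', v = c0 :: v') -> adm v -> adm (w ++ v).
Proof. by move=> [_ hw] [v' ->] hv; exact: adm_glue. Qed.

Lemma power_glue k w : loop w -> adm (power k w ++ [:: c0]) /\
  (exists v', power k w ++ [:: c0] = c0 :: v').
Proof.
move=> lw; elim: k => [|k [IH1 IH2]] /=; first by split => //; exists [::].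
rewrite -catA; split; first exact: loop_glue.
by have [[w' ew] _] := lw; exists (w' ++ power k w ++ [:: c0]); rewrite {1}ew.
Qed.

Lemma loop_power k w : (0 < k)%N -> loop w -> loop (power k w).
Proof.
case: k => // k _ lw; have [h _] := power_glue k.+1 lw; split => //.
by have [[w' ew] _] := lw; exists (w' ++ power k w); rewrite /= {1}ew.
Qed.

Lemma fading_power K F k w : fading rho K F -> loop w ->
  `|F (power k w) - k%:R * F w| <= k%:R * (K * defect rho).
Proof.
move=> FK lw; have [F0 _ _] := FK; elim: k => [|k IH].
  by rewrite /= F0 !mul0r subr0 normr0.
have [h _] := power_glue k.+1 lw.
have qa := quasi_additive rho01 FK (adm_catl h : adm (w ++ power k w)).
have -> : F (power k.+1 w) - k.+1%:R * F w =
   (F (w ++ power k w) - F w - F (power k w)) + (F (power k w) - k%:R * F w).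
  by rewrite -natr1 /=; ring.
apply: le_trans (ler_normD _ _) _; rewrite -natr1 mulrDl mul1r addrC.
exact: lerD.
Qed.

(** If the sums along words are unbounded above but do not all drift upwards,
    then repeating a loop with a large sum, and a long loop with a small one,
    gives two loops of the same length with very different sums. *)
Lemma loop_pairs K F (B0 : R) : fading rho K F ->
  (forall B : R, exists2 w, adm w & B < F w) ->
  (forall m, exists w, [/\ adm w, (m <= size w)%N & F w <= B0]) ->
  forall X : R, exists w1 w2,
    [/\ loop w1, loop w2, size w1 = size w2 & X < F w1 - F w2].
Proof.
move=> FK high low X; have K0 := fading_ge0 FK; have [F0 _ _] := FK.
have [N closeP] := close_loop.
pose D := K * defect rho; have D0 : 0 <= D by rewrite mulr_ge0 ?defect_ge0.
pose C1 := 2 * D + 2 * (K * N%:R).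
have C10 : 0 <= C1 by apply: addr_ge0; apply: mulr_ge0 => //; exact: mulr_ge0.
have closed_sum w q1 q2 : (size q1 <= N)%N -> (size q2 <= N)%N -> adm (q2 ++ w ++ q1) ->
    `|F (q2 ++ w ++ q1) - F w| <= C1.
  move=> s1 s2 h; have h' := adm_catr h; have h1 := adm_catr h'; have h2 := adm_catl h.
  have b1 := quasi_additive rho01 FK h; have b2 := quasi_additive rho01 FK h'.
  have b3 : `|F q1| <= K * N%:R.
    by apply: le_trans (fading_word FK h1) _; rewrite ler_wpM2l// ler_nat.
  have b4 : `|F q2| <= K * N%:R.
    by apply: le_trans (fading_word FK h2) _; rewrite ler_wpM2l// ler_nat.
  move: b1 b2 b3 b4; rewrite /C1 -/D !ler_norml.
  move=> /andP[? ?] /andP[? ?] /andP[? ?] /andP[? ?]; apply/andP; split; lra.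
have [w hw Fw] := high (C1 + D + 1).
have w0 : w != [::].
  by apply: contraTneq Fw => ->; rewrite F0 -leNgt; lra.
have [q1 [q2 [s1 s2 q10 lw]]] := closeP w w0 hw.
set v := q2 ++ w ++ q1 in lw.
have Fv : D + 1 <= F v.
  have := closed_sum w q1 q2 s1 s2 (adm_catl lw.2); rewrite -/v ler_norml => /andP[]; lra.
pose n := size v; have n0 : (0 < n)%N by have [[v' e] _] := lw; rewrite /n e.
pose Y := X + n%:R * (B0 + C1 + D).
pose m := (Num.bound Y).+1.
have [x [hx mx Fx]] := low m.
have x0 : x != [::] by rewrite -size_eq0 -lt0n (leq_trans _ mx).
have [p1 [p2 [t1 t2 p10 ly]]] := closeP x x0 hx.
set y := p2 ++ x ++ p1 in ly.
have Fy : F y <= B0 + C1.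
  have := closed_sum x p1 p2 t1 t2 (adm_catl ly.2); rewrite -/y ler_norml => /andP[]; lra.
pose k := size y.
have Yk : Y < k%:R.
  have [Y0|Yn] := leP 0 Y; last by apply: lt_le_trans Yn _.
  apply: lt_le_trans (archi_boundP Y0) _; rewrite ler_nat.
  by rewrite /k /y !size_cat (leq_trans _ (leq_addl _ _))// (leq_trans _ (leq_addr _ _))// ltnW.
have k0 : (0 < k)%N by have [[v' e] _] := ly; rewrite /k e.
exists (power k v), (power n y); split.
- exact: loop_power.
- exact: loop_power.
- by rewrite !size_power mulnC.
have h1 := fading_power k FK lw; have h2 := fading_power n FK ly.
move: h1 h2; rewrite -/D !ler_norml => /andP[h1 _] /andP[_ h2].
have h3 : k%:R * (D + 1) <= k%:R * F v by rewrite ler_wpM2l.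
have h4 : n%:R * F y <= n%:R * (B0 + C1) by rewrite ler_wpM2l.
by move: Yk; rewrite /Y; lra.
Qed.

Variables (d : nat) (Fv : 'I_d -> seq A -> R) (KF : R).
Hypothesis KF0 : 0 < KF.
Hypothesis FvP : forall i, fading rho KF (Fv i).
Hypothesis unbounded : forall x : 'I_d -> R, (exists i, x i != 0) ->
  forall B : R, exists2 w, adm w & B < lin Fv x w.
Hypothesis no_drift : forall x : 'I_d -> R, exists B0 : R, forall m, exists w,
  [/\ adm w, (m <= size w)%N & lin Fv x w <= B0].

Lemma sum_continuous (T : topologicalType) (I : Type) (r : seq I) (f : I -> T -> R) :
  (forall i, continuous (f i)) -> continuous (fun t => \sum_(i <- r) f i t).
Proof.
move=> fc; elim: r => [|i r IH].
  rewrite (_ : (fun _ => _) = fun=> 0); first exact: cst_continuous.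
  by apply/funext => t; rewrite big_nil.
rewrite (_ : (fun _ => _) = fun t => f i t + \sum_(j <- r) f j t).
  by move=> t; apply: continuousD; [exact: fc|exact: IH].
by apply/funext => t; rewrite big_cons.
Qed.

(** By compactness of the unit sphere, finitely many pairs of loops serve all
    directions. *)
Lemma finite_pairs (X : R) : exists P : seq (seq A * seq A),
  (forall pr, pr \in P -> [/\ loop pr.1, loop pr.2 & size pr.1 = size pr.2]) /\
  forall x, l1 x = 1 -> exists2 pr, pr \in P & X < lin Fv x pr.1 - lin Fv x pr.2.
Proof.
pose val (v : 'rV[R]_d) i := v ord0 i.
have valc i : continuous (val^~ i) by exact: coord_continuous.
pose S := [set v : 'rV[R]_d | l1 (val v) = 1].
have l1c : continuous (fun v : 'rV[R]_d => l1 (val v)).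
  apply: sum_continuous => i v; apply: (@continuous_comp _ _ _ (val^~ i) (fun y => `|y|)).
    exact: valc.
  exact: norm_continuous.
have compS : compact S.
  apply: (@subclosed_compact _ _ [set v : 'rV[R]_d | forall i, [set` `[(-1 : R), 1]] (v ord0 i)]).
  - have -> : S = (fun t : 'rV[R]_d => l1 (val t)) @^-1` [set y | y = 1] by [].
    apply: closed_comp; last exact: closed_eq.
    by move=> v _; exact: l1c.
  - by apply: (@rV_compact _ d (fun=> [set` `[(-1 : R), 1]])) => i; exact: segment_compact.
  - move=> v vS i; rewrite /= in_itv/= -ler_norml -/(val v i).
    have -> : 1 = l1 (val v) :> R by rewrite vS.
    by rewrite /l1 (bigD1 i)//= lerDl sumr_ge0.
pose good := [set pr : seq A * seq A |
  [/\ loop pr.1, loop pr.2 & size pr.1 = size pr.2]].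
pose f (pr : seq A * seq A) := [set v : 'rV[R]_d | X < lin Fv (val v) pr.1 - lin Fv (val v) pr.2].
move: compS; rewrite compact_cover => /(_ _ good f)[].
- move=> pr _; pose h (v : 'rV[R]_d) := \sum_i val v i * (Fv i pr.1 - Fv i pr.2).
  have -> : f pr = h @^-1` [set y | X < y].
    by apply/funext => v; rewrite /f /h /lin /= -sumrB;
      congr (is_true (_ < _)); apply: eq_bigr => i _; rewrite mulrBr.
  apply: open_comp; last exact: open_gt.
  move=> v _; apply: sum_continuous => i.
  have mc (e : R) : continuous (fun y : R => y * e).
    by move=> y; apply: cvgM; [exact: cvg_id|exact: cvg_cst].
  move=> w; apply: (@continuous_comp _ _ _ (val^~ i) (fun y => y * (Fv i pr.1 - Fv i pr.2))).
    exact: valc.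
  exact: mc.
- move=> v vS; have nz : exists i, val v i != 0.
    apply: contrapT => h; move: vS; rewrite /S/= /l1 big1; first by move/esym/eqP; rewrite oner_eq0.
    by move=> i _; apply/eqP; rewrite normr_eq0; apply: contrapT => /negP hi; apply: h; exists i.
  have [B0 low] := no_drift (val v).
  have [w1 [w2 [h1 h2 s X12]]] :=
    loop_pairs (fading_lin FvP (val v)) (unbounded nz) low X.
  by exists (w1, w2).
move=> P Pgood Pcov; exists (finmap.enum_fset P); split.
  by move=> pr prP; have := Pgood pr prP; rewrite inE.
move=> x x1; pose v : 'rV[R]_d := \row_i x i.
have vx : val v = x by apply/funext => i; rewrite /val /v mxE.
have [|pr prP fpr] := Pcov v; first by rewrite /S/= vx.
by exists pr => //; move: fpr; rewrite /f/= vx.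
Qed.

(** The loops are joined to the given past by a bounded word and padded to the
    prescribed length; quasi-additivity changes the gap by a multiple of
    [l1 x], for which [X'] leaves room. *)
Theorem loops_spread : spread Fv.
Proof.
move=> X; have [N NP] := @reach_uniform M.
pose X' := X + 4 * (KF * defect rho).
have [P [Pgood PX]] := finite_pairs X'.
pose mx := (\max_(pr <- P) size pr.1)%N.
exists (N + mx).+1 => n nN x b u hu.
have [r [rN rr]] := NP b c0; have [q sq hq] := reach_word rr.
have hv0 : adm ((c0 :: q) ++ b :: u) by exact: adm_glue.
have [l10|l1n] := eqVneq (l1 x) 0.
  have [p sp hp] := pad_exists n b; exists p, p.
  by split=> //; try exact: adm_glue; rewrite l10 mulr0.
have l1p : 0 < l1 x by rewrite lt_neqAle eq_sym l1n l1_ge0.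
pose y i := (l1 x)^-1 * x i.
have y1 : l1 y = 1.
  rewrite /l1 (eq_bigr (fun i => (l1 x)^-1 * `|x i|)); last first.
    by move=> i _; rewrite normrM gtr0_norm ?invr_gt0.
  by rewrite -mulr_sumr mulVf ?gt_eqF.
have [pr prP gap] := PX y y1; have [lp1 lp2 sp] := Pgood pr prP.
have m1 : (size pr.1 <= mx)%N by exact: leq_bigmax_seq.
clearbody mx.
have m2 : (size pr.2 <= mx)%N by rewrite -sp.
have [p sz hp] := pad_exists (n - size pr.1 - r.+1) c0.
have join w : loop w -> adm (w ++ (c0 :: q) ++ b :: u) /\ adm (p ++ w ++ (c0 :: q) ++ b :: u).
  move=> [[w' ew] hw]; have h : adm (w ++ (c0 :: q) ++ b :: u).
    exact: (@adm_glue _ w c0 (q ++ b :: u)).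
  by split => //; rewrite ew in h *; exact: adm_glue.
have [h1 g1] := join _ lp1; have [h2 g2] := join _ lp2.
have fit : (n - size pr.1 - r.+1 + (size pr.1 + r.+1))%N = n.
  by rewrite -subnDA subnK// (leq_trans _ (ltnW nN))// addnC leq_add.
exists (p ++ pr.1 ++ c0 :: q), (p ++ pr.2 ++ c0 :: q); split.
- by rewrite !size_cat /= sz sq.
- by rewrite !size_cat /= sz sq -sp.
- by rewrite -!catA.
- by rewrite -!catA.
rewrite -!catA; have FK := fading_lin FvP x.
have a1 := quasi_additive rho01 FK h1; have a2 := quasi_additive rho01 FK h2.
have b1 := quasi_additive rho01 FK g1; have b2 := quasi_additive rho01 FK g2.
have {}gap : X' * l1 x < lin Fv x pr.1 - lin Fv x pr.2.
  have linE w : lin Fv y w = (l1 x)^-1 * lin Fv x w.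
    by rewrite /lin mulr_sumr; apply: eq_bigr => i _; rewrite mulrA.
  by move: gap; rewrite !linE -mulrBr -ltr_pdivrMl ?invr_gt0// invrK mulrC.
apply: le_trans (ler_norm _).
move: a1 a2 b1 b2 gap; rewrite /X' !ler_norml.
move=> /andP[? ?] /andP[? ?] /andP[? ?] /andP[? ?]; lra.
Qed.

End Loops.

(** * Points of the subshift and energies of functions *)

Section Points.
Variable M : transition.
Local Notation A := (alphabet M).
Implicit Types (a b : A) (u v w : seq A) (x y z : sft M).

Definition agree k x y := forall i : int, (absz i < k)%N -> letter x i = letter y i.

Lemma sft_ext x y : (forall i, letter x i = letter y i) -> x = y.
Proof.
move=> h; apply: val_inj; apply/funext => i; exact: h.
Qed.

Lemma iter_letter n x i : letter (iter n (@sft_shift M) x) i = letter x (i + n%:Z).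
Proof.
elim: n i => [|n IH] i; first by rewrite addr0.
rewrite iterS -[LHS]/(letter (iter n (@sft_shift M) x) (i + 1)) IH.
by congr (letter x _); lia.
Qed.

Lemma translate_adj (k : int) x (i : int) :
  adj (letter x (i + k)) (letter x (i + 1 + k)).
Proof. by have := letterP x (i + k); rewrite addrAC. Qed.

Definition translate (k : int) x : sft M :=
  mk_sft (fun i => translate_adj k x i).

Lemma translate_letter k x i : letter (translate k x) i = letter x (i + k).
Proof. by []. Qed.

Lemma glue_exists (n : int) x y : adj (letter x (n - 1)) (letter y 0) ->
  exists z, forall i, letter z i = if (i < n)%R then letter x i else letter y (i - n).
Proof.
move=> h; pose f i := if (i < n)%R then letter x i else letter y (i - n).
have fP i : adj (f i) (f (i + 1)).
  rewrite /f; case: ltP => h1; case: ltP => h2; [exact: letterP| |lia|].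
    have -> : i = n - 1 by lia.
    by have -> : n - 1 + 1 - n = 0 by lia.
  by have := letterP y (i - n); congr (adj _ (letter y _)); lia.
by exists (mk_sft fP).
Qed.

(** Splicing of a past and a future; the fallback value [x] makes it total. *)
Definition glue n x y : sft M :=
  if pselect (adj (letter x (n - 1)) (letter y 0)) is left h
  then projT1 (cid (glue_exists h)) else x.

Lemma glueE n x y i : adj (letter x (n - 1)) (letter y 0) ->
  letter (glue n x y) i = if (i < n)%R then letter x i else letter y (i - n).
Proof.
rewrite /glue; case: pselect => // h _; exact: (projT2 (cid (glue_exists h))).
Qed.

Lemma point_exists a : exists x, letter x 0 = a.
Proof.
have [f fP] := choice (@succ_exists M); have [g gP] := choice (@pred_exists M).
pose h (i : int) : A := match i with Posz n => iter n f a | Negz n => iter n.+1 g a end.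
have hP i : adj (h i) (h (i + 1)).
  case: i => [n|[|n]].
  - by rewrite -PoszD addn1 /=.
  - exact: gP.
  - have -> : Negz n.+1 + 1 = Negz n by lia.
    exact: (gP (iter n.+1 g a)).
by exists (mk_sft hP).
Qed.

Definition start a : sft M := projT1 (cid (point_exists a)).

Lemma start0 a : letter (start a) 0 = a.
Proof. exact: (projT2 (cid (point_exists a))). Qed.

(** A point reading the word [u] from time [0] on, in which the past is fixed
    by the oldest letter of [u] and the future by the most recent one. *)
Fixpoint canon u : sft M :=
  if u is a :: v then
    if v is [::] then start a else glue (size v)%:Z (canon v) (start a)
  else start (letter0 M).

Fixpoint word n x : seq A := if n is k.+1 then letter x k%:Z :: word k x else [::].

Lemma size_word n x : size (word n x) = n.
Proof. by elim: n => //= n ->. Qed.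

Lemma adm_word n x : adm (word n x).
Proof.
elim: n => [//|[|n] IH] //.
rewrite [word _ _]/= adm_cons2; apply/andP; split; last exact: IH.
by have := letterP x n%:Z; rewrite -PoszD addn1.
Qed.

Lemma word_eqP n x y :
  (forall k, (k < n)%N -> letter x k%:Z = letter y k%:Z) <-> word n x = word n y.
Proof.
elim: n => [|n IH] /=; first by split.
split=> [h|[h1 h2] k].
  by rewrite h//; congr cons; apply/IH => k kn; apply: h; exact: ltnW.
rewrite ltnS leq_eqVlt => /predU1P[->//|]; exact: (IH.2 h2).
Qed.

Lemma word_shift l m x : word (l + m) x = word m (iter l (@sft_shift M) x) ++ word l x.
Proof.
elim: m => [|m IH]; first by rewrite addn0.
by rewrite addnS /= IH iter_letter -PoszD addnC.
Qed.

Lemma canon_word u : u != [::] -> adm u -> word (size u) (canon u) = u.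
Proof.
elim: u => // a [_ _ _|b u IH _ hu]; first by rewrite /= start0.
have hb := adm_behead hu; have {IH} IH := IH isT hb.
have last_letter : letter (canon (b :: u)) ((size (b :: u))%:Z - 1) = b.
  have -> : (size (b :: u))%:Z - 1 = (size u)%:Z by rewrite /=; lia.
  by move: IH => [].
have ok : adj (letter (canon (b :: u)) ((size (b :: u))%:Z - 1)) (letter (start a) 0).
  by rewrite last_letter start0; case/andP: hu.
rewrite -[canon _]/(glue (size (b :: u))%:Z (canon (b :: u)) (start a)).
rewrite -[RHS]/(a :: (b :: u)) -[size _]/(size (b :: u)).+1.
rewrite -[LHS]/(letter _ _ :: word (size (b :: u)) _) glueE// ltxx subrr start0.
congr cons; rewrite -[RHS]IH; apply/word_eqP => k kn.
by rewrite glueE// ltz_nat kn.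
Qed.

Lemma canonE a b u i : adm [:: a, b & u] -> letter (canon [:: a, b & u]) i =
  if (i < (size (b :: u))%:Z)%R then letter (canon (b :: u)) i
  else letter (start a) (i - (size (b :: u))%:Z).
Proof.
move=> hu; rewrite -[canon _]/(glue (size (b :: u))%:Z (canon (b :: u)) (start a)).
apply: glueE; rewrite start0; have := @canon_word (b :: u) isT (adm_behead hu).
have -> : (size (b :: u))%:Z - 1 = (size u)%:Z by rewrite /=; lia.
by move=> [-> _]; case/andP: hu.
Qed.

Lemma canon_future a u (r : int) : adm (a :: u) -> (0 <= r)%R ->
  letter (canon (a :: u)) ((size u)%:Z + r) = letter (start a) r.
Proof.
case: u => [_ _|b u hu r0]; first by rewrite /= add0r.
rewrite canonE// ltNge; have -> /= : ((size (b :: u))%:Z <= (size (b :: u))%:Z + r)%R by lia.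
by congr letter; lia.
Qed.

Lemma canon_share j u v (r : int) : (0 < j)%N -> share j u v -> adm u -> adm v ->
  (- j%:Z <= r)%R ->
  letter (canon u) ((size u)%:Z + r) = letter (canon v) ((size v)%:Z + r).
Proof.
move=> j0 s hu hv jr; have [r1|r1] := leP (-1) r.
  have [a [u' [v' [eu ev _]]]] := share_inv j0 s; subst u v.
  have e w : (size (a :: w))%:Z + r = (size w)%:Z + (r + 1) by rewrite /=; lia.
  by rewrite !e !canon_future//; lia.
move: s => /and3P[ju jv /eqP s].
have read w : (j <= size w)%N -> adm w ->
    letter (canon w) ((size w)%:Z + r) = nth (letter0 M) (take j w) (absz r).-1.
  move=> jw hw; rewrite nth_take; last by lia.
  have wn : w != [::] by rewrite -size_eq0 -lt0n (leq_trans j0).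
  transitivity (nth (letter0 M) (word (size w) (canon w)) (absz r).-1);
    last by rewrite canon_word.
  have nthw n x k : (k < n)%N -> nth (letter0 M) (word n x) k = letter x (n - k.+1)%N%:Z.
    elim: n k => // n IH [|k] kn /=; first by rewrite subn1.
    by rewrite IH// subSS.
  rewrite nthw; last by lia.
  by congr letter; lia.
by rewrite !read// s.
Qed.

End Points.

Section Energy.
Variables (R : realType) (M : transition) (rho : R).
Hypothesis rho01 : 0 < rho < 1.
Local Notation A := (alphabet M).
Local Notation sigma := (@sft_shift M).
Implicit Types (a b : A) (u v w : seq A) (x y : sft M) (f : sft M -> R) (K : R).

Let rho_gt0 : 0 < rho. Proof. by case/andP: rho01. Qed.
Let rho_lt1 : rho < 1. Proof. by case/andP: rho01. Qed.
Let rho_ge0 : 0 <= rho. Proof. exact: ltW. Qed.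
Let rho_le1 : rho <= 1. Proof. exact: ltW. Qed.
Let rho1_gt0 : 0 < 1 - rho. Proof. by rewrite subr_gt0. Qed.

(** The exponent [3] leaves room to trade a distance to one end of a window
    against the distance to the other end: if [t] is at most [rho ^+ (3 * i)]
    and at most [rho ^+ (3 * (j - i))], then it is at most [rho ^+ (i + j)]. *)
Definition regular K f := (forall x, `|f x| <= K) /\
  forall k x y, agree k x y -> `|f x - f y| <= K * rho ^+ (3 * k).

Lemma regular_ge0 K f : regular K f -> 0 <= K.
Proof. by move=> [h _]; apply: le_trans (h (start (letter0 M))). Qed.

Lemma regular_at K f k m m' x y : regular K f ->
  (forall r : int, (absz r < k)%N -> letter x (r + m%:Z) = letter y (r + m'%:Z)) ->
  `|f (iter m sigma x) - f (iter m' sigma y)| <= K * rho ^+ (3 * k).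
Proof. by move=> [_ h] xy; apply: h => i ik; rewrite !iter_letter; exact: xy. Qed.

(** Bounded distortion: at time [k] the two orbits agree on a window of radius
    [min (k + 1) (n - k)], and the errors form two geometric series. *)
Lemma birkhoff_word K f n x y : regular K f -> word n x = word n y ->
  `|birkhoff f n x - birkhoff f n y| <= K * (2 / (1 - rho)).
Proof.
move=> fK /word_eqP xy; have K0 := regular_ge0 fK.
rewrite /birkhoff -sumrB; apply: le_trans (ler_norm_sum _ _ _) _.
apply: (@le_trans _ _ (K * \sum_(k < n) (rho ^+ k + rho ^+ (n - k.+1)))); last first.
  rewrite ler_wpM2l// big_split/= [X in _ + X](reindex_inj rev_ord_inj)/=.
  have -> : \sum_(j < n) rho ^+ (n - (n - j.+1).+1) = \sum_(j < n) rho ^+ j.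
    by apply: eq_bigr => j _; congr (_ ^+ _); have := ltn_ord j; lia.
  have := @geometric_sum_le R rho n; rewrite rho_ge0 rho_lt1 => /(_ isT); lra.
rewrite mulr_sumr; apply: ler_sum => k _; have kn := ltn_ord k.
have p1 : 0 <= rho ^+ k by exact: exprn_ge0.
have p2 : 0 <= rho ^+ (n - k.+1) by exact: exprn_ge0.
have [h|h] := leqP k.+1 (n - k).
  apply: le_trans (@regular_at K f k.+1 k k x y fK _) _.
    move=> r rk; have [m [mn ->]] : exists m : nat, (m < n)%N /\ r + k%:Z = m%:Z.
      by exists (absz (r + k%:Z)); lia.
    exact: xy.
  rewrite ler_wpM2l//; apply: (@le_trans _ _ (rho ^+ k)); last by rewrite lerDl.
  by rewrite ler_wiXn2l//; lia.
apply: le_trans (@regular_at K f (n - k) k k x y fK _) _.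
  move=> r rk; have [m [mn ->]] : exists m : nat, (m < n)%N /\ r + k%:Z = m%:Z.
    by exists (absz (r + k%:Z)); lia.
  exact: xy.
rewrite ler_wpM2l//; apply: (@le_trans _ _ (rho ^+ (n - k.+1))); last by rewrite lerDr.
by rewrite ler_wiXn2l//; lia.
Qed.

Definition energy f u : R := birkhoff f (size u) (canon u).

Definition energy_const : R := 1 + 2 / (1 - rho).

Lemma energy_const_ge1 : 1 <= energy_const.
Proof. by rewrite /energy_const lerDl divr_ge0// ltW. Qed.

Lemma birkhoffD f m n x :
  birkhoff f (m + n) x = birkhoff f m x + birkhoff f n (iter m sigma x).
Proof.
rewrite /birkhoff big_split_ord/=; congr (_ + _).
by apply: eq_bigr => i _; rewrite addnC iterD.
Qed.

Lemma energy_word K f n x : regular K f -> (0 < n)%N ->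
  `|birkhoff f n x - energy f (word n x)| <= K * (2 / (1 - rho)).
Proof.
move=> fK n0; rewrite /energy size_word; apply: birkhoff_word => //.
have wn : word n x != [::] by rewrite -size_eq0 size_word -lt0n.
by rewrite -{1}(canon_word wn (adm_word _ _)) size_word.
Qed.

Lemma energy_inc f a u : inc (energy f) a u = f (iter (size u) sigma (canon (a :: u))) +
  \sum_(i < size u) (f (iter (size u - i.+1) sigma (canon (a :: u))) -
     f (iter (size u - i.+1) sigma (canon u))).
Proof.
rewrite /inc /energy /birkhoff /= big_ord_recr/= addrAC -sumrB addrC; congr (_ + _).
by rewrite (reindex_inj rev_ord_inj)/=.
Qed.

Lemma canon_past a u (i : int) : adm (a :: u) -> (i < (size u)%:Z)%R -> u != [::] ->
  letter (canon (a :: u)) i = letter (canon u) i.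
Proof. by case: u => // b u hu iu _; rewrite canonE// iu. Qed.

(** Energies of regular functions are fading: the contribution of the time [i]
    steps before the new letter is small in [i] because the new letter is far
    away, and depends little on the past before time [j] because that is far
    away from it too. *)
Theorem energy_fading K f : regular K f -> fading rho (K * energy_const) (energy f).
Proof.
move=> fK; have K0 := regular_ge0 fK; have [fb _] := fK.
pose br a u i := f (iter (size u - i.+1) sigma (canon (a :: u))) -
  f (iter (size u - i.+1) sigma (canon u)).
have br_le a u i : adm (a :: u) -> (i < size u)%N -> `|br a u i| <= K * rho ^+ (3 * i.+1).
  move=> hu iu; apply: regular_at => // r ri; apply: canon_past => //; first by lia.
  by rewrite -size_eq0 -lt0n (leq_trans _ iu).
have shrink i k : (i <= k)%N -> K * rho ^+ k <= K * rho ^+ i.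
  by move=> ik; rewrite ler_wpM2l// ler_wiXn2l.
split.
- by rewrite /energy /birkhoff big_ord0.
- move=> a u hu; rewrite energy_inc; apply: le_trans (ler_normD _ _) _.
  rewrite /energy_const mulrDr mulr1; apply: lerD; first exact: fb.
  apply: le_trans (ler_norm_sum _ _ _) _.
  apply: (@le_trans _ _ (\sum_(i < size u) K * rho ^+ i)).
    apply: ler_sum => i _; apply: le_trans (br_le a u i hu (ltn_ord i)) _.
    by apply: shrink; lia.
  rewrite -mulr_sumr ler_wpM2l//.
  have := @geometric_sum_le R rho (size u); rewrite rho_ge0 rho_lt1 => /(_ isT) h.
  have : 0 <= (1 - rho)^-1 by rewrite invr_ge0 ltW.
  by lra.
move=> j a u v j0 s hu hv.
have hu' := adm_behead hu; have hv' := adm_behead hv.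
have s1 : share j.+1 (a :: u) (a :: v) by rewrite share_cons.
have ju : (j <= size u)%N by case/and3P: s.
have jv : (j <= size v)%N by case/and3P: s.
pose m := maxn (size u) (size v).
pose brm w i : R := if (i < size w)%N then br a w i else 0.
have brmE w : (size w <= m)%N -> \sum_(i < size w) br a w i = \sum_(i < m) brm w i.
  move=> wm; rewrite -!(big_mkord predT) (big_cat_nat (leq0n (size w)) wm)/=.
  rewrite [X in _ = _ + X]big_nat_cond [X in _ = _ + X]big1 ?addr0; last first.
    by move=> i /andP[/andP[wi _] _]; rewrite /brm ltnNge wi.
  rewrite big_nat_cond [RHS]big_nat_cond; apply: eq_bigr => i.
  by rewrite andbT => /andP[_ iw]; rewrite /brm iw.
rewrite !energy_inc !brmE ?leq_maxl ?leq_maxr//.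
have -> : K * energy_const * rho ^+ j = K * rho ^+ j + 2 * (K * rho ^+ j) * (1 - rho)^-1.
  by rewrite /energy_const; ring.
set x := f _; set y := f _.
have -> (p q : R) : x + p - (y + q) = (x - y) + (p - q) by ring.
apply: le_trans (ler_normD _ _) _; apply: lerD.
  apply: le_trans (@regular_at K f j.+1 _ _ _ _ fK _) (shrink _ _ _); last by clear; lia.
  move=> r rj; have := @canon_share M j.+1 _ _ (r - 1) isT s1 hu hv _.
  have e w : (size (a :: w))%:Z + (r - 1) = r + (size w)%:Z by clear; rewrite /=; lia.
  by rewrite !e; apply; clear -rj; lia.
rewrite -sumrB; apply: le_trans (ler_norm_sum _ _ _) _.
apply: (@le_trans _ _ (\sum_(i < m) 2 * (K * rho ^+ j) * rho ^+ i)); last first.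
  rewrite -mulr_sumr ler_wpM2l ?mulr_ge0 ?exprn_ge0//.
  by apply: geometric_sum_le; rewrite rho_ge0.
apply: ler_sum => i _.
have -> : 2 * (K * rho ^+ j) * rho ^+ i = K * rho ^+ (i + j) + K * rho ^+ (i + j).
  by rewrite exprD; ring.
have [ji|ij] := leqP j (2 * i + 3).
  apply: le_trans (ler_normB _ _) _.
  have one w : adm (a :: w) -> `|brm w i| <= K * rho ^+ (i + j).
    move=> hw; rewrite /brm; case: ifP => iw.
      by apply: le_trans (br_le a w i hw iw) _; apply: shrink; clear -ji; lia.
    by rewrite normr0 mulr_ge0// exprn_ge0.
  exact: lerD (one u hu) (one v hv).
have iu : (i < size u)%N by clear -ij ju; lia.
have iv : (i < size v)%N by clear -ij jv; lia.
rewrite /brm iu iv /br.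
set x1 := f _; set x2 := f _; set x3 := f _; set x4 := f _.
have -> : x1 - x2 - (x3 - x4) = (x1 - x3) - (x2 - x4) by ring.
apply: le_trans (ler_normB _ _) _; apply: lerD.
  apply: le_trans (@regular_at K f (j - i) _ _ _ _ fK _) (shrink _ _ _); last by clear -ij; lia.
  move=> r rj; have := @canon_share M j.+1 _ _ (r - i%:Z - 2) isT s1 hu hv _.
  have e w : (i < size w)%N ->
      (size (a :: w))%:Z + (r - i%:Z - 2) = r + (size w - i.+1)%N%:Z.
    by move=> iw; clear -iw; rewrite /=; lia.
  by rewrite !e//; apply; clear -rj ij; lia.
apply: le_trans (@regular_at K f (j - i) _ _ _ _ fK _) (shrink _ _ _); last by clear -ij; lia.
move=> r rj; have := @canon_share M j _ _ (r - i%:Z - 1) j0 s hu' hv' _.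
have e w : (i < size w)%N ->
    (size w)%:Z + (r - i%:Z - 1) = r + (size w - i.+1)%N%:Z.
  by move=> iw; clear -iw; lia.
by rewrite !e//; apply; clear -rj ij; lia.
Qed.

End Energy.

(** * Functions with Birkhoff sums bounded above *)

Section Subaction.
Variables (R : realType) (M : transition) (rho : R).
Hypothesis rho01 : 0 < rho < 1.
Local Notation sigma := (@sft_shift M).
Implicit Types (x y z : sft M) (f : sft M -> R) (K : R).

Let rho_gt0 : 0 < rho. Proof. by case/andP: rho01. Qed.
Let rho_lt1 : rho < 1. Proof. by case/andP: rho01. Qed.
Let rho_ge0 : 0 <= rho. Proof. exact: ltW. Qed.
Let rho_le1 : rho <= 1. Proof. exact: ltW. Qed.
Let rho1_gt0 : 0 < 1 - rho. Proof. by rewrite subr_gt0. Qed.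

(** Replacing the future of [sigma ^ n y] by that of a nearby point [x] moves
    the orbit segment of length [n] by little, and after one more step the new
    orbit is closer to [sigma x] by one letter. *)
Lemma shadow K f n j x y : regular rho K f -> (0 < j)%N -> agree j (iter n sigma y) x ->
  exists y', agree j.+1 (iter n.+1 sigma y') (sigma x) /\
    birkhoff f n y + f x - K * (1 + (1 - rho)^-1) * rho ^+ (3 * j) <= birkhoff f n.+1 y'.
Proof.
move=> fK j0 ag; have K0 := regular_ge0 fK.
set z := iter n sigma y in ag.
have ok : adj (letter z (0 - 1)) (letter x 0).
  rewrite -(ag 0) //; by have := letterP z (-1).
pose z' := glue 0 z x; have z'E i : letter z' i = if (i < 0)%R then letter z i else letter x i.
  by rewrite /z' glueE// subr0.
have z'z i : (i < j%:Z)%R -> letter z' i = letter z i.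
  move=> ij; rewrite z'E; case: ltP => // i0; rewrite ag//; clear -ij i0; lia.
pose y' := translate (- n%:Z) z'.
have y'E : iter n sigma y' = z'.
  by apply: sft_ext => i; rewrite iter_letter translate_letter addrK.
exists y'; split.
  move=> i ij; rewrite iterS y'E -[LHS]/(letter z' (i + 1)) -[RHS]/(letter x (i + 1)) z'E.
  case: ltP => // i0; rewrite ag//; clear -ij i0; lia.
have -> : birkhoff f n.+1 y' = birkhoff f n y' + f z'.
  by rewrite /birkhoff big_ord_recr/= y'E.
have h1 : `|f z' - f x| <= K * rho ^+ (3 * j).
  apply: fK.2 => i ij; rewrite z'E; case: ltP => // i0; exact: ag.
have h2 : `|birkhoff f n y' - birkhoff f n y| <= K * (1 - rho)^-1 * rho ^+ (3 * j).
  rewrite /birkhoff -sumrB (reindex_inj rev_ord_inj)/=.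
  apply: le_trans (ler_norm_sum _ _ _) _.
  apply: (@le_trans _ _ (\sum_(i < n) K * rho ^+ (3 * j) * rho ^+ i)).
    apply: ler_sum => i _; apply: le_trans (@regular_at _ _ _ K f (i.+1 + j) _ _ _ _ fK _) _.
      move=> r rij; have ni := ltn_ord i.
      have -> : letter y' (r + (n - i.+1)%N%:Z) = letter z' (r - i.+1%:Z).
        by rewrite translate_letter; congr letter; clear -ni; lia.
      rewrite z'z; last by clear -rij; lia.
      by rewrite iter_letter; congr letter; clear -ni; lia.
    rewrite -mulrA ler_wpM2l// -exprD ler_wiXn2l//; clear; lia.
  rewrite -mulr_sumr [leRHS]mulrAC ler_wpM2l ?mulr_ge0 ?exprn_ge0//.
  by apply: geometric_sum_le; rewrite rho_ge0.
move: h1 h2; rewrite !ler_norml => /andP[? _] /andP[? _]; lra.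
Qed.

(** A penalised supremum of sums along orbit segments that end near [x]: the
    penalty makes it Lipschitz for free, and the shadowing estimate makes it
    grow by at least [f] along orbits. *)
Theorem subaction_exists K f (B : R) : regular rho K f -> (forall n x, birkhoff f n x <= B) ->
  exists (h : sft M -> R) (L : R),
    (forall k x y, agree k x y -> `|h x - h y| <= L * rho ^+ (3 * k)) /\
    forall x, h x + f x <= h (sigma x).
Proof.
move=> fK fB; have K0 := regular_ge0 fK; have [fb _] := fK.
have B0 : 0 <= B by have := fB 0%N (start (letter0 M)); rewrite /birkhoff big_ord0.
pose q := 1 + (1 - rho)^-1; have q0 : 0 <= q by rewrite addr_ge0// invr_ge0 ltW.
have th1 : 0 < 1 - rho ^+ 3 by rewrite subr_gt0 exprn_ilt1.
pose L := (K * q + B + K) / (1 - rho ^+ 3).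
have KqBK : 0 <= K * q + B + K by rewrite !addr_ge0// mulr_ge0.
have L0 : 0 <= L by rewrite divr_ge0// ltW.
have LE : L * (1 - rho ^+ 3) = K * q + B + K by rewrite /L divfK// gt_eqF.
pose V x : set R := [set v | exists n y j, agree j (iter n sigma y) x /\
  v = birkhoff f n y - L * rho ^+ (3 * j)].
have pen j : 0 <= L * rho ^+ (3 * j) by rewrite mulr_ge0// exprn_ge0.
have Vsup x : has_sup (V x).
  split; first by exists (birkhoff f 0 x - L * rho ^+ (3 * 0)), 0%N, x, 0%N.
  exists B => v [n [y [j [_ ->]]]].
  by have := fB n y; have := pen j; lra.
pose h x := sup (V x).
have hub x v : V x v -> v <= h x by move=> Vv; exact: (sup_upper_bound (Vsup x)).
have hle x c : (forall v, V x v -> v <= c) -> h x <= c.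
  by move=> H; apply: ge_sup => //; case: (Vsup x).
exists h, L; split.
  have half k x y : agree k x y -> h x <= h y + L * rho ^+ (3 * k).
    move=> xy; apply: hle => v [n [w [j [ag ->]]]].
    have [jk|kj] := leqP j k.
      have : birkhoff f n w - L * rho ^+ (3 * j) <= h y.
        apply: hub; exists n, w, j; split => // i ij; rewrite ag// xy//.
        exact: leq_trans jk.
      by have := pen k; lra.
    have : birkhoff f n w - L * rho ^+ (3 * k) <= h y.
      apply: hub; exists n, w, k; split => // i ik; rewrite ag ?xy//.
      exact: ltn_trans kj.
    by have := pen j; lra.
  move=> k x y xy; have := half k x y xy; have : agree k y x by move=> i ik; rewrite xy.
  by move=> /half h1 h2; rewrite ler_norml; apply/andP; split; lra.
move=> x; rewrite -lerBrDr; apply: hle => v [n [y [j [ag ->]]]].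
have fx : f x <= K by apply: le_trans (fb x); exact: ler_norm.
case: j ag => [|j] ag.
  have : birkhoff f 0 (sigma x) - L * rho ^+ (3 * 1) <= h (sigma x).
    by apply: hub; exists 0%N, (sigma x), 1%N.
  rewrite {1}/birkhoff big_ord0 muln1 muln0 expr0 mulr1 => h1.
  have := fB n y; have : 0 <= K * q by rewrite mulr_ge0.
  by move: LE h1; lra.
have [y' [ag' le_y']] := @shadow K f n j.+1 x y fK isT ag.
have : birkhoff f n.+1 y' - L * rho ^+ (3 * j.+2) <= h (sigma x).
  by apply: hub; exists n.+1, y', j.+2.
have p0 : 0 <= rho ^+ (3 * j.+1) by rewrite exprn_ge0.
have -> : rho ^+ (3 * j.+2) = rho ^+ 3 * rho ^+ (3 * j.+1) by rewrite -exprD -mulnS.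
have : K * q * rho ^+ (3 * j.+1) <= L * (1 - rho ^+ 3) * rho ^+ (3 * j.+1).
  by rewrite LE ler_wpM2r//; lra.
move: le_y'; rewrite -/q; lra.
Qed.

End Subaction.

(** * Topology and cylinders of the subshift *)

Section Topology.
Variables (R : realType) (M : transition).
Local Notation A := (alphabet M).
Local Notation sigma := (@sft_shift M).
Implicit Types (a : A) (u w : seq A) (x y : sft M) (f g : sft M -> R).

Lemma letter_continuous (i : int) :
  continuous ((fun x => letter x i) : sft M -> discrete_topology A).
Proof.
move=> x; apply: (@continuous_comp _ _ _ (set_val : sft M -> prod_topology _) (proj i)).
  exact: initial_continuous.
exact: proj_continuous.
Qed.

Lemma letter_open (i : int) a : open [set x : sft M | letter x i = a].
Proof.
have -> : [set x : sft M | letter x i = a] =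
   ((fun x => letter x i) : sft M -> discrete_topology A) @^-1` [set a] by [].
apply: open_comp; last exact: discrete_open.
by move=> x _; exact: letter_continuous.
Qed.

Lemma shift_continuous : continuous sigma.
Proof.
apply: (@continuous_comp_initial _ _ _ (set_val : sft M -> prod_topology _)).
move=> x; have FF : Filter (nbhs x) := nbhs_filter x.
have FF' : Filter ((set_val \o sigma) y @[y --> x]) by exact: fmap_filter.
apply/cvg_sup => i.
by apply: (@continuous_comp_initial _ _ _ (fun g : prod_topology _ => g i)
  (fun z : sft M => set_val (sigma z))) => z; exact: letter_continuous.
Qed.

Lemma agree_open k x : open [set y | agree k x y].
Proof.
elim: k => [|k IH].
  by rewrite (_ : [set y | agree 0 x y] = setT); [exact: openT|apply/seteqP; split].
have -> : [set y | agree k.+1 x y] = [set y | agree k x y] `&`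
   ([set y | letter y k%:Z = letter x k%:Z] `&` [set y | letter y (- k%:Z) = letter x (- k%:Z)]).
  apply/seteqP; split=> [y h|y [h [h1 h2]] i ik].
    by split=> [i ik|]; [apply: h; lia|split; apply/esym/h; lia].
  have [|ki] := ltnP (absz i) k; first exact: h.
  have [->|->] : i = k%:Z \/ i = - k%:Z by lia.
    by rewrite h1.
  by rewrite h2.
by apply: openI => //; apply: openI; exact: letter_open.
Qed.

(** Continuity, phrased with the cylinders around a point. *)
Definition local f := forall x e, 0 < e ->
  exists k, forall y, agree k x y -> `|f x - f y| < e.

Lemma local_continuous f : local f -> continuous f.
Proof.
move=> h x; apply/(@cvgrPdist_lt _ _ _ _ (nbhs_filter x)) => e e0; have [k kP] := h x e e0.
have : nbhs x [set y | agree k x y] by apply: open_nbhs_nbhs; split => //; exact: agree_open.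
by apply: filterS => y; exact: kP.
Qed.

Lemma localD f g : local f -> local g -> local (fun x => f x + g x).
Proof.
move=> fl gl x e e0; have e2 : 0 < e / 2 by rewrite divr_gt0.
have [k kP] := fl x _ e2; have [l lP] := gl x _ e2; exists (maxn k l) => y xy.
have -> : f x + g x - (f y + g y) = (f x - f y) + (g x - g y) by ring.
apply: le_lt_trans (ler_normD _ _) _; rewrite [ltRHS]splitr; apply: ltrD.
  by apply: kP => i ik; apply: xy; rewrite (leq_trans ik)// leq_maxl.
by apply: lP => i il; apply: xy; rewrite (leq_trans il)// leq_maxr.
Qed.

Lemma localN f : local f -> local (fun x => - f x).
Proof.
by move=> fl x e e0; have [k kP] := fl x e e0; exists k => y /kP; rewrite -opprD normrN.
Qed.

Lemma local_shift f : local f -> local (f \o sigma).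
Proof.
move=> fl x e e0; have [k kP] := fl (sigma x) e e0; exists k.+1 => y xy.
apply: kP => i ik; apply: xy; lia.
Qed.

Lemma lipschitz_local rho f (K : R) : 0 < rho < 1 ->
  (forall k x y, agree k x y -> `|f x - f y| <= K * rho ^+ (3 * k)) -> local f.
Proof.
move=> /andP[r0 r1] h x e e0.
have K10 : 0 < `|K| + 1 by rewrite ltr_wpDl.
have [n nP] : exists n, rho ^+ n <= e / (2 * (`|K| + 1)).
  by apply: exprn_small; [rewrite (ltW r0)|rewrite divr_gt0// mulr_gt0].
exists n => y xy; apply: le_lt_trans (h n x y xy) _.
apply: (@le_lt_trans _ _ ((`|K| + 1) * rho ^+ n)).
  have h1 : rho ^+ (3 * n) <= rho ^+ n by rewrite ler_wiXn2l ?(ltW r0) ?(ltW r1) ?leq_pmull.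
  have h2 : 0 <= rho ^+ (3 * n) by rewrite exprn_ge0// ltW.
  apply: (@le_trans _ _ ((`|K| + 1) * rho ^+ (3 * n))); last by rewrite ler_pM2l.
  rewrite ler_wpM2r//; apply: le_trans (ler_norm K) _; by rewrite lerDl.
apply: (@le_lt_trans _ _ (e / 2)); last by rewrite ltr_pdivrMr// ltr_pMr// ltr1n.
have -> : e / 2 = (`|K| + 1) * (e / (2 * (`|K| + 1))) by field; rewrite gt_eqF.
by rewrite ler_pM2l.
Qed.

Lemma regular_continuous rho K f : 0 < rho < 1 -> regular rho K f -> continuous f.
Proof. by move=> r01 fK; apply: local_continuous; exact: (lipschitz_local r01 fK.2). Qed.

Lemma open_meas (U : set (sft M)) : open U -> measurable U.
Proof. by move=> oU; exact: sub_sigma_algebra. Qed.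

Lemma continuous_meas f : continuous f -> measurable_fun [set: sft M] f.
Proof.
move=> /continuousP cf mD; apply: (measurability _ (measurable_realfun.RGenOpens.measurableE R)) => //.
move=> _ [_ [a [b ->] <-]]; rewrite setTI; apply: open_meas.
exact/cf/interval_open.
Qed.

Lemma shift_meas : measurable_fun [set: sft M] sigma.
Proof.
apply: (@measurability _ _ _ _ _ _ (@open (sft M))) => // _ [U oU <-].
rewrite setTI; apply: open_meas; apply: open_comp => // x _; exact: shift_continuous.
Qed.

Lemma birkhoff_continuous f n : continuous f -> continuous (birkhoff f n).
Proof.
move=> cf; rewrite /birkhoff; apply: sum_continuous => i.
elim: (nat_of_ord i) => [|k IH] /=; first exact: cf.
rewrite (_ : (fun x => f (iter k.+1 sigma x)) = (fun x => f (iter k sigma x)) \o sigma).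
  by move=> x; apply: continuous_comp; [exact: shift_continuous|exact: IH].
by apply/funext => x; rewrite /= -iterSr.
Qed.

Definition cyl u := [set x : sft M | word (size u) x = u].

Lemma cyl_open u : open (cyl u).
Proof.
elim: u => [|a u IH].
  by rewrite (_ : cyl [::] = setT); [exact: openT|apply/seteqP; split].
have -> : cyl (a :: u) = [set x | letter x (size u)%:Z = a] `&` cyl u.
  apply/seteqP; split=> x; rewrite /cyl /=; first by move=> [-> ->].
  by move=> [-> ->].
by apply: openI => //; exact: letter_open.
Qed.

Lemma cyl_meas u : measurable (cyl u).
Proof. apply: open_meas; exact: cyl_open. Qed.

Lemma cyl_adm u x : cyl u x -> adm u.
Proof. by move=> <-; exact: adm_word. Qed.

Lemma cyl_cylinder u : u != [::] -> adm u -> cyl u = cylinder (canon u) (size u).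
Proof.
move=> u0 hu; apply/seteqP; split=> x; rewrite /cyl /=.
  by rewrite -[RHS](canon_word u0 hu) => /word_eqP.
by move=> /word_eqP ->; exact: canon_word.
Qed.

Lemma cyl_split u : cyl u = \big[setU/set0]_(a <- index_enum A) cyl (a :: u).
Proof.
rewrite -bigcup_seq; apply/seteqP; split=> [x xu|x [a _]].
  by exists (letter x (size u)%:Z); [rewrite /= mem_index_enum|rewrite /cyl /= xu].
by rewrite /cyl /= => -[].
Qed.

Lemma cyl_trivIset u : trivIset [set` index_enum A] (fun a => cyl (a :: u)).
Proof.
by move=> a b _ _ [x [+ +]]; rewrite /cyl /= => -[<- _] [<- _].
Qed.

End Topology.

(** * Invariant and Gibbs measures *)

Section Invariance.
Variables (R : realType) (M : transition) (mu : probability (sft M) R).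
Local Notation A := (alphabet M).
Local Notation sigma := (@sft_shift M).
Hypothesis mu_inv : shift_invariant mu.
Implicit Types (a b : A) (u v w : seq A) (x y : sft M) (f g h : sft M -> R) (K : R).

Definition bcont f := continuous f /\ exists K, forall x, `|f x| <= K.

Definition zero_mean f := (\int[mu]_x (f x)%:E = 0)%E.

Lemma bcont_integrable f : bcont f -> mu.-integrable setT (EFin \o f).
Proof.
move=> [fc [K fK]]; apply: measurable_bounded_integrable => //.
- by apply: le_lt_trans (probability_le1 mu measurableT) _; exact: ltry.
- exact: continuous_meas.
- by exists K; split; [exact: num_real|move=> r Kr x _; exact: le_trans (fK x) (ltW Kr)].
Qed.

Lemma bcont_cst (c : R) : bcont (fun=> c).
Proof. by split; [exact: cst_continuous|exists `|c|]. Qed.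

Lemma bcontD f g : bcont f -> bcont g -> bcont (fun x => f x + g x).
Proof.
move=> [fc [K fK]] [gc [L gL]]; split.
  by move=> x; apply: continuousD; [exact: fc|exact: gc].
exists (K + L) => x; apply: le_trans (ler_normD _ _) _; exact: lerD.
Qed.

Lemma bcontZ (c : R) f : bcont f -> bcont (fun x => c * f x).
Proof.
move=> [fc [K fK]]; split.
  by move=> x; apply: continuousM; [exact: cst_continuous|exact: fc].
by exists (`|c| * K) => x; rewrite normrM ler_wpM2l.
Qed.

Lemma bcont_shift f : bcont f -> bcont (f \o sigma).
Proof.
move=> [fc [K fK]]; split; last by exists K => x; exact: fK.
by move=> x; apply: continuous_comp; [exact: shift_continuous|exact: fc].
Qed.

Lemma bcont_sum (I : Type) (r : seq I) (f : I -> sft M -> R) :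
  (forall i, bcont (f i)) -> bcont (fun x => \sum_(i <- r) f i x).
Proof.
move=> fn; elim: r => [|i r IH].
  by rewrite (_ : (fun _ => _) = fun=> 0); [exact: bcont_cst|apply/funext => x; rewrite big_nil].
rewrite (_ : (fun _ => _) = fun x => f i x + \sum_(j <- r) f j x); first exact: bcontD.
by apply/funext => x; rewrite big_cons.
Qed.

Lemma integral_bcontD f g : bcont f -> bcont g ->
  (\int[mu]_x (f x + g x)%:E = \int[mu]_x (f x)%:E + \int[mu]_x (g x)%:E)%E.
Proof.
move=> fn gn.
by rewrite -(integralD measurableT (bcont_integrable fn) (bcont_integrable gn)).
Qed.

Lemma integral_bcontZ (c : R) f : bcont f ->
  (\int[mu]_x (c * f x)%:E = c%:E * \int[mu]_x (f x)%:E)%E.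
Proof.
by move=> fn; rewrite -integralZl//; exact: bcont_integrable.
Qed.

Lemma integral_shift f : bcont f ->
  (\int[mu]_x (f (sigma x))%:E = \int[mu]_x (f x)%:E)%E.
Proof.
move=> fn; have := @integral_pushforward _ _ _ _ R sigma (@shift_meas M) mu setT (EFin \o f).
rewrite preimage_setT => <- //.
- apply: eq_measure_integral; first exact: shift_meas.
  by move=> ? B mB _; exact: mu_inv.
- by apply: measurableT_comp => //; apply: continuous_meas; case: fn.
- exact: (bcont_integrable (bcont_shift fn)).
Qed.

Lemma zero_meanD f g : bcont f -> bcont g -> zero_mean f -> zero_mean g ->
  zero_mean (fun x => f x + g x).
Proof. by move=> fn gn f0 g0; rewrite /zero_mean integral_bcontD// f0 g0 adde0. Qed.

Lemma zero_meanZ (c : R) f : bcont f -> zero_mean f -> zero_mean (fun x => c * f x).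
Proof. by move=> fn f0; rewrite /zero_mean integral_bcontZ// f0 mule0. Qed.

Lemma zero_mean0 : zero_mean (fun=> 0).
Proof. by rewrite /zero_mean; under eq_integral do rewrite -/(cst 0%E _); rewrite integral_cst// mul0e. Qed.

Lemma zero_mean_sum (I : Type) (r : seq I) (f : I -> sft M -> R) :
  (forall i, bcont (f i)) -> (forall i, zero_mean (f i)) ->
  zero_mean (fun x => \sum_(i <- r) f i x).
Proof.
move=> fn f0; elim: r => [|i r IH].
  rewrite (_ : (fun _ => _) = fun=> 0); first exact: zero_mean0.
  by apply/funext => x; rewrite big_nil.
rewrite (_ : (fun _ => _) = fun x => f i x + \sum_(j <- r) f j x).
  by apply: zero_meanD => //; exact: bcont_sum.
by apply/funext => x; rewrite big_cons.
Qed.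

Lemma bcont_iter f n : bcont f -> bcont (fun x => f (iter n sigma x)).
Proof.
move=> fn; elim: n => [|n IH] //=.
rewrite (_ : (fun x => _) = (fun x => f (iter n sigma x)) \o sigma); first exact: bcont_shift.
by apply/funext => x; rewrite /= -iterS iterSr.
Qed.

Lemma zero_mean_iter f n : bcont f -> zero_mean f -> zero_mean (fun x => f (iter n sigma x)).
Proof.
move=> fn f0; elim: n => [|n IH] //=.
rewrite /zero_mean -[RHS]IH -(integral_shift (bcont_iter n fn)).
by apply: eq_integral => x _; rewrite -iterS iterSr.
Qed.

Lemma bcont_birkhoff f n : bcont f -> bcont (birkhoff f n).
Proof. by move=> fn; apply: bcont_sum => i; exact: bcont_iter. Qed.

Lemma zero_mean_birkhoff f n : bcont f -> zero_mean f -> zero_mean (birkhoff f n).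
Proof.
move=> fn f0; apply: zero_mean_sum => i; [exact: bcont_iter|exact: zero_mean_iter].
Qed.

Lemma mu_iter (B : set (sft M)) k : measurable B -> mu (iter k sigma @^-1` B) = mu B.
Proof.
move=> mB; elim: k => //= k IH.
have mk j : measurable (iter j sigma @^-1` B).
  elim: j => //= j IHj.
  have -> : (fun x => sigma (iter j sigma x)) @^-1` B = sigma @^-1` (iter j sigma @^-1` B).
    by apply/funext => x; rewrite /preimage /= -iterS iterSr.
  by rewrite -[X in measurable X]setTI; exact: shift_meas.
rewrite -IH -(mu_inv (mk k)); congr (mu _).
by apply/funext => x; rewrite /preimage /= -iterS iterSr.
Qed.

End Invariance.

Section Gibbs.
Variables (R : realType) (M : transition) (mu : probability (sft M) R) (rho : R).
Hypothesis rho01 : 0 < rho < 1.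
Local Notation A := (alphabet M).
Local Notation sigma := (@sft_shift M).
Variables (phi : sft M -> R) (Kphi : R).
Hypothesis phiK : regular rho Kphi phi.
Hypothesis phi_gibbs : gibbs phi mu.
Implicit Types (a b : A) (u v w : seq A) (x y : sft M) (f g h : sft M -> R) (K : R).

Local Notation E := (energy phi).
Let KE := Kphi * energy_const rho.
Let EK : fading rho KE E. Proof. exact: energy_fading. Qed.
Let mu_inv : shift_invariant mu. Proof. by case: phi_gibbs. Qed.

Lemma regular_bcont K f : regular rho K f -> bcont f.
Proof. by move=> fK; split; [exact: regular_continuous fK|exists K; case: fK]. Qed.

Section Decompose.
Variable part : seq A -> \bar R.
Hypothesis part_split : forall u, adm u ->
  (part u = \sum_(a | adm (a :: u)) part (a :: u))%E.

(** Bounds on cylinders of a given length propagate to shorter ones through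
    the transfer operator. *)
Lemma part_le m u (G : seq A -> R) : adm u ->
  (forall w, size w = m -> adm (w ++ u) ->
    (part (w ++ u) <= (expR (E (w ++ u)) * G (w ++ u))%:E)%E) ->
  (part u <= (expR (E u) * transfer E m G u)%:E)%E.
Proof.
elim: m u => [|m IH] u hu bound; first exact: (bound [::]).
rewrite part_split// /= mulr_sumr -sumEFin; apply: lee_sum => a au.
rewrite mulrA -expRD addrC /inc subrK; apply: IH => // w sw hw.
by rewrite -cat_rcons bound ?size_rcons ?sw ?cat_rcons.
Qed.

Lemma part_ge m u (G : seq A -> R) : adm u ->
  (forall w, size w = m -> adm (w ++ u) ->
    ((expR (E (w ++ u)) * G (w ++ u))%:E <= part (w ++ u))%E) ->
  ((expR (E u) * transfer E m G u)%:E <= part u)%E.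
Proof.
elim: m u => [|m IH] u hu bound; first exact: (bound [::]).
rewrite part_split// /= mulr_sumr -sumEFin; apply: lee_sum => a au.
rewrite mulrA -expRD addrC /inc subrK; apply: IH => // w sw hw.
by rewrite -cat_rcons bound ?size_rcons ?sw ?cat_rcons.
Qed.

End Decompose.

Lemma integral_split (g : sft M -> R) u : measurable_fun [set: sft M] g -> (forall x, 0 <= g x) ->
  (\int[mu]_(x in cyl u) (g x)%:E =
   \sum_(a | adm (a :: u)) \int[mu]_(x in cyl (a :: u)) (g x)%:E)%E.
Proof.
move=> gm g0; rewrite {1}cyl_split ge0_integral_bigsetU//; last 5 first.
- by move=> a; exact: cyl_meas.
- by rewrite index_enum_uniq.
- exact: cyl_trivIset.
- rewrite -cyl_split; apply: (@measurableT_comp _ _ _ _ _ _ EFin) => //.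
  exact: (measurable_funS measurableT).
- by move=> x _; rewrite lee_fin.
rewrite [RHS]big_mkcond/=; apply: eq_bigr => a _; case: ifP => // /negP au.
rewrite (_ : cyl (a :: u) = set0) ?integral_set0//.
by apply/seteqP; split=> // x /cyl_adm.
Qed.

Lemma measure_split (D : set (sft M)) u : measurable D ->
  (mu (cyl u `&` D) = \sum_(a | adm (a :: u)) mu (cyl (a :: u) `&` D))%E.
Proof.
move=> mD; have e w : mu (cyl w `&` D) = (\int[mu]_(x in cyl w) (\1_D x)%:E)%E.
  by rewrite setIC integral_indic//; exact: cyl_meas.
under eq_bigr do rewrite e.
rewrite e.
apply: integral_split => [|x]; last by rewrite indicE.
exact: measurable_indic.
Qed.

Lemma cyl_bounds : exists P c1 c2 : R, [/\ 0 < c1, 0 < c2 &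
  forall u, u != [::] -> adm u ->
  ((c1 * expR (E u - P * (size u)%:R))%:E <= mu (cyl u))%E /\
  (mu (cyl u) <= (c2 * expR (E u - P * (size u)%:R))%:E)%E].
Proof.
case: phi_gibbs => _ [P [c1 [c2 [h1 h2 h]]]]; exists P, c1, c2; split => // u u0 hu.
by rewrite cyl_cylinder//; exact: h.
Qed.

Lemma cyl_gt0 u : adm u -> (0 < mu (cyl u))%E.
Proof.
have [-> _|u0 hu] := eqVneq u [::].
  by rewrite (_ : cyl [::] = setT) ?probability_setT ?lte01//; apply/seteqP; split.
have [P [c1 [c2 [h1 h2 h]]]] := cyl_bounds; have [lo _] := h u u0 hu.
by apply: lt_le_trans lo; rewrite lte_fin mulr_gt0// expR_gt0.
Qed.

(** A set of points that agree with [x] around time [0] contains, up to a shift,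
    a cylinder, so that invariant Gibbs measures have full support. *)
Lemma agree_gt0 k x : (0 < mu [set y | agree k x y])%E.
Proof.
have mA : measurable [set y : sft M | agree k x y] by apply: open_meas; exact: agree_open.
rewrite -(mu_iter mu_inv k mA); set u := word (2 * k) (translate (- k%:Z) x).
apply: (lt_le_trans (cyl_gt0 (adm_word _ _ : adm u))).
apply: le_measure; rewrite ?inE; [exact: cyl_meas| |].
  have ck : continuous (iter k sigma).
    elim: (k) => [|j IH]; first by move=> y; exact: cvg_id.
    by move=> y; apply: (@continuous_comp _ _ _ (iter j sigma) sigma);
      [exact: IH|exact: shift_continuous].
  apply: open_meas; apply: open_comp => [y _|]; [exact: ck|exact: agree_open].
move=> y; rewrite /cyl /u size_word /= => /word_eqP yx i ik.
rewrite iter_letter; have [m [mk em]] : exists m : nat, (m < 2 * k)%N /\ i + k%:Z = m%:Z.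
  by exists (absz (i + k%:Z)); lia.
by rewrite em yx// translate_letter; congr letter; lia.
Qed.

(** By continuity, a positive value would persist on a set of positive measure. *)
Lemma zero_mean_ge0 f : bcont f -> (forall x, 0 <= f x) -> zero_mean mu f ->
  local f -> forall x, f x = 0.
Proof.
move=> fn f0 fz loc x; apply/eqP; rewrite eq_le f0 andbT leNgt; apply/negP => fx.
pose e := f x / 2; have e0 : 0 < e by rewrite /e divr_gt0.
have [fc _] := fn.
have [k kP] : exists k, forall y, agree k x y -> e <= f y.
  have [k kP] := loc x e e0; exists k => y xy.
  have := le_lt_trans (ler_norm _) (kP y xy); rewrite /e; lra.
pose U := [set y | agree k x y].
have mU : measurable U by apply: open_meas; exact: agree_open.
have fm : measurable_fun [set: sft M] (EFin \o f).
  by apply: measurableT_comp => //; exact: continuous_meas.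
have : (e%:E * mu U <= \int[mu]_y (f y)%:E)%E.
  rewrite -integral_cst//.
  apply: (@le_trans _ _ (\int[mu]_(y in U) (f y)%:E)%E).
    apply: ge0_le_integral => //.
    - by move=> y _; rewrite lee_fin ltW.
    - exact: measurable_funS fm.
  by apply: ge0_subset_integral => // y _; rewrite lee_fin.
rewrite fz leNgt => /negP; apply; apply: mule_gt0; first by rewrite lte_fin.
exact: agree_gt0.
Qed.

End Gibbs.

(** * Centering *)

Section Centering.
Variables (R : realType) (M : transition) (mu : probability (sft M) R) (rho : R).
Hypothesis rho01 : 0 < rho < 1.
Local Notation A := (alphabet M).
Local Notation sigma := (@sft_shift M).
Variables (phi : sft M -> R) (Kphi : R).
Hypothesis phiK : regular rho Kphi phi.
Hypothesis mu_inv : shift_invariant mu.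
Implicit Types (a b : A) (u v w : seq A) (x y : sft M) (f g h : sft M -> R) (K : R).
Local Notation E := (energy phi).
Variables P c1 c2 : R.
Hypothesis c1_gt0 : 0 < c1.
Hypothesis c2_gt0 : 0 < c2.
Hypothesis cylP : forall u, u != [::] -> adm u ->
  ((c1 * expR (E u - P * (size u)%:R))%:E <= mu (cyl u))%E /\
  (mu (cyl u) <= (c2 * expR (E u - P * (size u)%:R))%:E)%E.

Let KE := Kphi * energy_const rho.
Let EK : fading rho KE E. Proof. exact: energy_fading. Qed.
Let E0 : E [::] = 0. Proof. by case: EK. Qed.

Lemma cyl_nil : cyl [::] = [set: sft M]. Proof. by apply/seteqP; split. Qed.

Lemma measure_cyl_split u :
  (mu (cyl u) = \sum_(a | adm (a :: u)) mu (cyl (a :: u)))%E.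
Proof.
rewrite -[cyl u]setIT (measure_split mu u measurableT).
by apply: eq_bigr => a _; rewrite setIT.
Qed.

Lemma fading1 K F a : fading rho K F -> `|F [:: a]| <= K.
Proof. by move=> [F0 h _]; have := h a [::] isT; rewrite /inc F0 subr0. Qed.

Lemma partfn_nil n : partfn E n.+1 [::] <= c1^-1 * expR (P * n.+1%:R).
Proof.
have : ((expR (E [::]) * transfer E n.+1 (fun=> c1 * expR (- (P * n.+1%:R)) * 1) [::])%:E <= 1)%E.
  apply: (@le_trans _ _ (mu (cyl [::]))); last exact: probability_le1 (cyl_meas _).
  apply: (@part_ge _ _ phi (fun u => mu (cyl u))) => // [u _|w sw]; first exact: measure_cyl_split.
  rewrite cats0 => hw; have w0 : w != [::] by case: (w) sw.
  have [lo _] := cylP w0 hw; apply: le_trans lo; rewrite lee_fin sw expRD mulr1 mulrCA.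
  by rewrite mulrA.
rewrite lee_fin E0 expR0 mul1r transferZ expRN -mulrA mulrCA ler_pdivrMl ?expR_gt0// mulr1.
by rewrite -ler_pdivlMl// mulrC.
Qed.

(** The partition functions grow at most at the exponential rate of the Gibbs
    bounds, since cylinders of a given length have total mass one. *)
Lemma partfn_le : exists2 C, 0 < C & forall m b u, adm (b :: u) ->
  partfn E m (b :: u) <= C * expR (P * m%:R).
Proof.
have KE0 : 0 <= KE by exact: fading_ge0 EK.
have [Ga Ga1 cmp] := partfn_compare M rho01 KE0.
have Ga0 : 0 < Ga by exact: lt_le_trans Ga1.
exists (Ga * (expR KE * (c1^-1 * expR P))).
  by rewrite !mulr_gt0 ?expR_gt0// invr_gt0.
move=> m b u hu; pose a := letter0 M.
apply: le_trans (cmp E m b a u [::] EK hu isT) _.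
rewrite -2!mulrA ler_pM2l//.
have : expR (E [:: a]) * partfn E m [:: a] <= partfn E m.+1 [::].
  rewrite {2}/partfn /= (bigD1 a)//= /inc E0 subr0 lerDl; apply: sumr_ge0 => c _.
  by rewrite mulr_ge0 ?expR_ge0// ltW// partfn_gt0.
move=> /le_trans /(_ (partfn_nil m)).
rewrite -natr1 mulrDr mulr1 [P * _ + _]addrC expRD => h.
have : expR (- KE) * partfn E m [:: a] <= c1^-1 * (expR P * expR (P * m%:R)).
  apply: le_trans h; rewrite ler_wpM2r ?(ltW (partfn_gt0 _ _ _))// ler_expR.
  by have := fading1 a EK; rewrite ler_norml => /andP[].
rewrite expRN ler_pdivrMl ?expR_gt0// => /le_trans; apply.
by rewrite le_eqVlt; apply/predU1P; left; ring.
Qed.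

Lemma transfer_first m (G : seq A -> R) :
  transfer E m.+1 G [::] = \sum_a expR (E [:: a]) * transfer E m G [:: a].
Proof. by apply: eq_bigr => a _; rewrite /inc E0 subr0. Qed.

(** If all conditional means were large, the exponential moment of minus the
    Birkhoff sum would be too small for a function of zero mean. *)
Lemma mean_small : exists2 C, 0 < C & forall f Kf m b u s,
  regular rho Kf f -> 0 < Kf -> zero_mean mu f -> m%:R <= s ^+ 2 -> 1 <= s ->
  adm (b :: u) -> mean E (energy f) m (b :: u) <= C * Kf * s.
Proof.
have KE0 : 0 <= KE by exact: fading_ge0 EK.
have [Ct [de [Ct0 de0 tilt]]] := partfn_tilt_le M rho01 KE0.
have [Cc Cc0 cmp] := mean_compare M rho01 KE0.
pose ec := energy_const rho.
have ec1 : 1 <= ec := energy_const_ge1 rho01.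
pose Q := c2 * c1^-1 * expR (2 * de + Ct * de ^+ 2).
have Q0 : 0 < Q by rewrite !mulr_gt0 ?expR_gt0// invr_gt0.
exists ((Q / de + Cc) * ec).
  by apply: mulr_gt0; [apply: addr_gt0 => //; exact: divr_gt0|lra].
move=> f Kf m b u s fK Kf0 f0 ms s1 hu; have s0 : 0 < s by lra.
pose F := energy f; pose L := Kf * ec; have FL : fading rho L F by exact: energy_fading.
have L0 : 0 < L by rewrite mulr_gt0//; lra.
pose lam := de / (L * s); have lam0 : 0 < lam by rewrite divr_gt0// mulr_gt0.
have lamL : lam * L <= de.
  have -> : lam * L = de / s by rewrite /lam; field; rewrite !gt_eqF.
  by rewrite ler_pdivrMr// ler_peMr// ltW.
have lamLs : lam * L * s = de by rewrite /lam; field; rewrite !gt_eqF.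
have [a ma] : exists a, mean E F m [:: a] <= Q / lam.
  apply: contrapT => /forallNP no.
  pose g := birkhoff f m.+1; have fn : bcont f by exact: regular_bcont fK.
  have gn : bcont g by exact: bcont_birkhoff.
  have g0 : zero_mean mu g by exact: zero_mean_birkhoff.
  have em : measurable_fun [set: sft M] (fun x => expR (- lam * g x)).
    by apply: measurableT_comp => //; apply: continuous_meas; case: (bcontZ (- lam) gn).
  have low : (1 <= \int[mu]_(x in cyl [::]) (expR (- lam * g x))%:E)%E.
    have -> : (1 = \int[mu]_x (1 + - lam * g x)%:E)%E.
      rewrite integral_bcontD ?integral_bcontZ ?g0 ?mule0 ?adde0//; last 2 first.
      - exact: bcont_cst.
      - exact: bcontZ.
      by rewrite integral_cst// mul1e; exact/esym/probability_setT.
    rewrite cyl_nil; apply: le_integral => //.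
    - apply: bcont_integrable; apply: bcontD; [exact: bcont_cst|exact: bcontZ].
    - apply: bcont_integrable; split.
        move=> x; apply: continuous_comp; last exact: continuous_expR.
        by case: (bcontZ (- lam) gn) => + _; apply.
      case: (bcontZ (- lam) gn) => _ [K gK]; exists (expR K) => x.
      rewrite ger0_norm ?expR_ge0// ler_expR; exact: le_trans (ler_norm _) (gK x).
    - by move=> x _; rewrite lee_fin expR_ge1Dx.
  have up : (\int[mu]_(x in cyl [::]) (expR (- lam * g x))%:E <=
     (expR (E [::]) * transfer E m.+1 (fun w => c2 * expR (de - P * m.+1%:R) *
        expR (- lam * F w)) [::])%:E)%E.
    apply: (@part_le _ _ phi (fun u => \int[mu]_(x in cyl u) (expR (- lam * g x))%:E)%E) => //.
      by move=> v _; apply: integral_split => // x; exact: expR_ge0.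
    move=> w sw; rewrite cats0 => hw; have w0 : w != [::] by case: (w) sw.
    apply: (@le_trans _ _ (\int[mu]_(x in cyl w) (expR (de - lam * F w))%:E)%E).
      apply: ge0_le_integral => //.
      - exact: cyl_meas.
      - apply: (@measurableT_comp _ _ _ _ _ _ EFin) => //; exact: (measurable_funS measurableT).
      move=> x xw; rewrite lee_fin ler_expR.
      have := energy_word rho01 x fK (ltn0Sn m).
      have -> : word m.+1 x = w by rewrite -sw.
      rewrite -/g -/F => near.
      have near2 : `|g x - F w| <= L.
        apply: le_trans near _; rewrite /L ler_pM2l// /ec /energy_const; lra.
      have : lam * (F w - g x) <= lam * L.
        rewrite ler_pM2l//; apply: le_trans near2; rewrite distrC; exact: ler_norm.
      lra.
    rewrite integral_cst; last exact: cyl_meas.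
    have [_ hi] := cylP w0 hw; apply: le_trans (lee_wpmul2l _ hi) _.
      by rewrite lee_fin expR_ge0.
    by rewrite -EFinM lee_fin sw !expRD mulNr !expRN le_eqVlt; apply/predU1P; left; ring.
  have := le_trans low up; rewrite lee_fin E0 expR0 mul1r transferZ transfer_first.
  apply/negP; rewrite -ltNge.
  pose G := expR (2 * de + Ct * de ^+ 2 - Q).
  have term a : transfer E m (fun w => expR (- lam * F w)) [:: a] <=
      expR (- Q + (de + Ct * de ^+ 2)) * partfn E m [:: a].
    have FL' : fading rho (lam * L) (fun w => - lam * F w).
      by have := fadingZ (- lam) FL; rewrite normrN gtr0_norm.
    have -> : transfer E m (fun w => expR (- lam * F w)) [:: a] =
        expR (- lam * F [:: a]) * partfn (fun v => E v + - lam * F v) m [:: a].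
      rewrite /partfn transfer_tilt -transferZ; congr transfer.
      by apply/funext => w; rewrite mulr1 -expRD; congr expR; ring.
    have := tilt E _ (lam * L) m a [::] EK FL' lamL isT.
    move=> h; apply: le_trans (ler_wpM2l (expR_ge0 _) h) _.
    rewrite mulrCA -expRD mulrC ler_pM2r ?partfn_gt0// ler_expR meanZ.
    have : lam * - F [:: a] <= lam * L.
      rewrite ler_pM2l//; have := fading1 a FL; apply: le_trans; rewrite -normrN; exact: ler_norm.
    have : Q <= lam * mean E F m [:: a].
      by rewrite -ler_pdivrMl// mulrC; have /negP := no a; rewrite -ltNge => /ltW.
    have : Ct * (lam * L) ^+ 2 * m%:R <= Ct * de ^+ 2.
      rewrite -mulrA ler_pM2l// -lamLs [X in _ <= X]exprMn.
      by rewrite ler_wpM2l// exprn_ge0// ltW// mulr_gt0.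
    lra.
  have : \sum_a expR (E [:: a]) * transfer E m (fun w => expR (- lam * F w)) [:: a] <=
      expR (- Q + (de + Ct * de ^+ 2)) * (c1^-1 * expR (P * m.+1%:R)).
    apply: (@le_trans _ _ (expR (- Q + (de + Ct * de ^+ 2)) * partfn E m.+1 [::])).
      rewrite /partfn transfer_first mulr_sumr; apply: ler_sum => a _.
      by rewrite mulrCA ler_pM2l ?expR_gt0//; exact: term.
    by rewrite ler_pM2l ?expR_gt0//; exact: partfn_nil.
  have pos : 0 < c2 * expR (de - P * m.+1%:R) by rewrite mulr_gt0 ?expR_gt0.
  rewrite -(ler_pM2l pos) => /le_lt_trans; apply.
  have -> : c2 * expR (de - P * m.+1%:R) * (expR (- Q + (de + Ct * de ^+ 2)) *
      (c1^-1 * expR (P * m.+1%:R))) = Q * expR (- Q).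
    transitivity (c2 * c1^-1 * (expR (de - P * m.+1%:R) * expR (- Q + (de + Ct * de ^+ 2)) *
       expR (P * m.+1%:R))); first ring.
    have QE : Q = c2 * c1^-1 * expR (2 * de + Ct * de ^+ 2) by [].
    by rewrite {2}QE -[RHS]mulrA -!expRD; congr (_ * expR _); ring.
  rewrite expRN ltr_pdivrMr ?expR_gt0// mul1r.
  apply: lt_le_trans (expR_ge1Dx Q); lra.
have := cmp E F L s m b a u [::] EK FL L0 s0 ms s1 hu isT.
have -> : (Q / de + Cc) * ec * Kf * s = Q / lam + Cc * L * s.
  by rewrite /lam /L; field; rewrite !gt_eqF//; lra.
lra.
Qed.

End Centering.

(** * The local bound for one block *)

Section Directions.
Variables (R : realType) (M : transition) (mu : probability (sft M) R) (rho : R).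
Hypothesis rho01 : 0 < rho < 1.
Local Notation A := (alphabet M).
Local Notation sigma := (@sft_shift M).
Variables (phi : sft M -> R) (Kphi : R).
Hypothesis phiK : regular rho Kphi phi.
Hypothesis phi_gibbs : gibbs phi mu.
Variables (d : nat) (t : 'I_d -> sft M -> R) (Kt : R).
Hypothesis Kt_gt0 : 0 < Kt.
Hypothesis tK : forall i, regular rho Kt (t i).
Hypothesis t_mean : forall i, zero_mean mu (t i).
Implicit Types (a b : A) (u v w : seq A) (y : sft M) (f g h : sft M -> R) (K : R).
Implicit Types (x : 'I_d -> R).
Local Notation E := (energy phi).

Let mu_inv : shift_invariant mu. Proof. by case: phi_gibbs. Qed.

Definition combination x y := \sum_i x i * t i y.

Local Notation Fv := (fun i => energy (t i)).

Lemma energy_combination x u : energy (combination x) u = lin Fv x u.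
Proof.
rewrite /energy /birkhoff /combination /lin exchange_big/=; apply: eq_bigr => i _.
by rewrite mulr_sumr.
Qed.

Lemma regular_le K L f : K <= L -> regular rho K f -> regular rho L f.
Proof.
move=> KL [f1 f2]; split=> [y|k y z yz]; first exact: le_trans (f1 y) KL.
apply: le_trans (f2 k y z yz) _; rewrite ler_wpM2r// exprn_ge0//.
by case/andP: rho01 => /ltW.
Qed.

Lemma regular_combination x : regular rho (Kt * l1 x) (combination x).
Proof.
split=> [y|k y z yz].
  rewrite mulr_sumr; apply: le_trans (ler_norm_sum _ _ _) _; apply: ler_sum => i _.
  by rewrite normrM mulrC ler_wpM2r//; case: (tK i).
rewrite -sumrB mulr_sumr mulr_suml; apply: le_trans (ler_norm_sum _ _ _) _.
apply: ler_sum => i _; rewrite -mulrBr normrM mulrAC [leRHS]mulrC ler_wpM2l//.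
by case: (tK i) => _; apply.
Qed.

Lemma bcont_combination x : bcont (combination x).
Proof. exact: regular_bcont (regular_combination x). Qed.

Lemma mean_combination x : zero_mean mu (combination x).
Proof.
have tn i : bcont (t i) by exact: regular_bcont (tK i).
apply: zero_mean_sum => i; [exact: bcontZ|exact: zero_meanZ].
Qed.

Lemma energy_near x n y : (0 < n)%N -> `|birkhoff (combination x) n y - lin Fv x (word n y)| <=
  Kt * l1 x * (2 / (1 - rho)).
Proof.
by move=> n0; rewrite -energy_combination; apply: energy_word => //; exact: regular_combination.
Qed.

Lemma no_drift x : exists B0, forall m, exists w,
  [/\ adm w, (m <= size w)%N & lin Fv x w <= B0].
Proof.
exists (1 + Kt * l1 x * (2 / (1 - rho))) => m.
have [y yP] : exists y, birkhoff (combination x) m.+1 y <= 1.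
  apply: contrapT => /forallNP no; pose g := birkhoff (combination x) m.+1.
  have gn : bcont g by apply: bcont_birkhoff; exact: bcont_combination.
  have : (\int[mu]_y 1%:E <= \int[mu]_y (g y)%:E)%E.
    apply: le_integral => //; [by apply: (@bcont_integrable _ _ mu (fun=> 1)); exact: bcont_cst|exact: bcont_integrable|].
    by move=> y _; rewrite lee_fin ltW// ltNge; apply/negP; exact: no.
  rewrite (zero_mean_birkhoff mu_inv m.+1 (bcont_combination x) (mean_combination x)).
  have -> : (\int[mu]_y 1%:E = 1)%E.
    by rewrite integral_cst// mul1e; exact: probability_setT.
  by rewrite leNgt lte01.
exists (word m.+1 y); split; [exact: adm_word|by rewrite size_word|].
have := energy_near x y (ltn0Sn m); rewrite ler_norml => /andP[h _].
lra.
Qed.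

(** Birkhoff sums bounded above provide a subaction [h]; the difference
    [h (sigma y) - h y - combination x y] is nonnegative with zero mean, hence
    vanishes. *)
Lemma combination_coboundary x B : (forall w, adm w -> lin Fv x w <= B) ->
  coboundary (combination x).
Proof.
move=> lin_le; have fK := regular_combination x.
have B0 : 0 <= B by apply: le_trans (lin_le [::] isT); rewrite /lin big1// => i _;
  rewrite /energy /birkhoff big_ord0 mulr0.
have K0 : 0 <= Kt * l1 x * (2 / (1 - rho)).
  by case/andP: rho01 => r0 r1; rewrite !mulr_ge0 ?(ltW Kt_gt0) ?l1_ge0 ?invr_ge0 ?subr_ge0 ?(ltW r1).
have birk n y : birkhoff (combination x) n y <= B + Kt * l1 x * (2 / (1 - rho)).
  case: n => [|n]; first by rewrite /birkhoff big_ord0 addr_ge0.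
  have := energy_near x y (ltn0Sn n); rewrite ler_norml => /andP[_ h].
  have := lin_le _ (adm_word n.+1 y); lra.
have [h [L [hL sub]]] := subaction_exists rho01 fK birk.
have hl : local h by exact: lipschitz_local rho01 hL.
have hn : bcont h.
  split; first exact: local_continuous.
  pose y0 := start (letter0 M); exists (`|h y0| + L) => y.
  have := hL 0%N y y0; rewrite muln0 expr0 mulr1 => near.
  have -> : h y = h y0 + (h y - h y0) by ring.
  by apply: le_trans (ler_normD _ _) _; rewrite lerD2l; apply: near.
have fn := bcont_combination x.
have hsn := bcont_shift hn.
pose g y := (h \o sigma) y + -1 * (h y + combination x y).
have gn : bcont g by apply: bcontD => //; apply: bcontZ; exact: bcontD.
have gz : zero_mean mu g.
  rewrite /zero_mean /g integral_bcontD//; last by apply: bcontZ; exact: bcontD.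
  rewrite integral_bcontZ ?integral_bcontD//; last exact: bcontD.
  rewrite (integral_shift mu_inv hn) (mean_combination x) adde0 EFinN mulN1e subee//.
  by apply: integrable_fin_num => //; exact: bcont_integrable.
have gl : local g.
  have -> : g = fun y => (h \o sigma) y + - (h y + combination x y).
    by apply/funext => y; rewrite /g mulN1r.
  apply: localD; first exact: local_shift.
  apply: localN; apply: localD => //; exact: lipschitz_local rho01 fK.2.
exists h; first exact: local_continuous.
move=> y; have : g y = 0.
  apply: (zero_mean_ge0 rho01 phi_gibbs gn _ gz gl) => z.
  by rewrite /g /=; have := sub z; lra.
by rewrite /g /=; lra.
Qed.

(** The conditional means are [O (l1 x * sqrt m)] by centering, which is absorbed
    in the Gaussian exponent at the price of a constant factor. *)
Lemma mgf_bound : exists C1 de1, [/\ 0 < C1, 0 < de1 & forall x m b u, adm (b :: u) ->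
  Kt * energy_const rho * l1 x <= de1 ->
  partfn (fun v => E v + lin Fv x v) m (b :: u) <=
  C1 * expR (C1 * l1 x ^+ 2 * m%:R) * partfn E m (b :: u)].
Proof.
have EK := energy_fading rho01 phiK; have KE0 := fading_ge0 EK.
have [Ct [de [Ct0 de0 tilt]]] := partfn_tilt_le M rho01 KE0.
have [P [c1 [c2 [c10 c20 cylP]]]] := cyl_bounds phi_gibbs.
have [Cm Cm0 small] := mean_small rho01 phiK mu_inv c10 c20 cylP.
pose KF := Kt * energy_const rho.
pose C1 := expR (1 + Cm * Kt) + (Cm * Kt) ^+ 2 + Ct * KF ^+ 2.
have p1 : 0 <= (Cm * Kt) ^+ 2 by exact: sqr_ge0.
have p2 : 0 <= Ct * KF ^+ 2 by rewrite mulr_ge0 ?sqr_ge0 ?(ltW Ct0).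
have p3 : 0 < expR (1 + Cm * Kt) by exact: expR_gt0.
exists C1, de; split => //; first by rewrite /C1; lra.
move=> x m b u hu xde; have Z0 := partfn_gt0 E m hu.
have linK : fading rho (KF * l1 x) (lin Fv x).
  by apply: fading_lin => i; exact: energy_fading.
apply: le_trans (tilt _ _ _ m b u EK linK xde hu) _.
rewrite mulrC ler_pM2r//.
have l0 : 0 <= l1 x := l1_ge0 x.
have m0 : 0 <= m%:R :> R by exact: ler0n.
have meanP : mean E (lin Fv x) m (b :: u) <= 1 + Cm * Kt + (Cm * Kt) ^+ 2 * l1 x ^+ 2 * m%:R.
  have CK : 0 < Cm * Kt by exact: mulr_gt0.
  case: m {Z0} m0 => [|m] m0; first by rewrite mulr0 addr0 /=; lra.
  pose s : R := Num.sqrt m.+1%:R.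
  have ss : s ^+ 2 = m.+1%:R by rewrite sqr_sqrtr.
  have s0 : 0 < s by rewrite sqrtr_gt0 ltr0n.
  have s1 : 1 <= s by rewrite -[leLHS]sqrtr1 ler_sqrt ?ler1n.
  (* The centering estimate needs a positive regularity constant; the increase by
     [s^-1] changes the mean by a bounded amount. *)
  have e0 : 0 < l1 x + s^-1 by rewrite ltr_wpDl// invr_gt0.
  have reg_e : regular rho (Kt * (l1 x + s^-1)) (combination x).
    apply: regular_le (regular_combination x).
    by rewrite ler_pM2l// lerDl invr_ge0 ltW.
  have := small _ _ m.+1 b u s reg_e (mulr_gt0 Kt_gt0 e0) (mean_combination x) _ s1 hu.
  rewrite ss lexx => /(_ isT).
  have -> : energy (combination x) = lin Fv x.
    by apply/funext => v; exact: energy_combination.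
  have -> : Cm * (Kt * (l1 x + s^-1)) * s = Cm * Kt * l1 x * s + Cm * Kt.
    by field; rewrite gt_eqF.
  move=> h; apply: le_trans h _.
  have : 0 <= (Cm * Kt * l1 x * s - 2^-1) ^+ 2 by exact: sqr_ge0.
  rewrite -ss; nra.
apply: (@le_trans _ _ (expR (1 + Cm * Kt) *
   expR (((Cm * Kt) ^+ 2 + Ct * KF ^+ 2) * l1 x ^+ 2 * m%:R))).
  rewrite -expRD ler_expR; move: meanP; rewrite /KF; lra.
apply: ler_pM; rewrite ?expR_ge0//; first by rewrite /C1; lra.
rewrite ler_expR -!mulrA ler_wpM2r// ?mulr_ge0 ?sqr_ge0// /C1; lra.
Qed.

Hypothesis not_coboundary : forall x, (exists i, x i != 0) -> ~ coboundary (combination x).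

(** That no combination is a coboundary gives [spread], and that all of them
    are centred gives the bound on exponential moments. *)
Theorem energy_local_bound L : 0 <= L -> exists C c, [/\ 0 < C, 0 < c &
  forall m z b u, (0 < m)%N -> adm (b :: u) ->
  transfer E m (fun v => (near_at Fv L z (b :: u) v)%:R) (b :: u) <=
  C * (Num.sqrt m%:R)^-1 ^+ d * expR (- (c * ((\sum_i z i ^+ 2) / m%:R))) *
  partfn E m (b :: u)].
Proof.
move=> L0; have [C1 [de1 [C10 de10 mgf]]] := mgf_bound.
have r01 := rho01; case/andP: rho01 => r0 r1.
have KF0 : 0 < Kt * energy_const rho.
  by rewrite mulr_gt0// (lt_le_trans _ (energy_const_ge1 rho01)).
have FvP i : fading rho (Kt * energy_const rho) (Fv i) by exact: energy_fading.
apply: (@local_bound _ _ _ rho01 _ Fv _ KF0 FvP E _ L C1 de1 (energy_fading rho01 phiK)) => //.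
apply: (loops_spread rho01 FvP); last exact: no_drift.
move=> x x0 B; apply: contrapT => no; apply: (not_coboundary x0).
apply: (@combination_coboundary x B) => w hw; rewrite leNgt; apply/negP => Bw.
by apply: no; exists w.
Qed.

End Directions.

(** * Several blocks *)

Section Blocks.
Variables (R : realType) (M : transition) (mu : probability (sft M) R) (rho : R).
Hypothesis rho01 : 0 < rho < 1.
Local Notation A := (alphabet M).
Local Notation sigma := (@sft_shift M).
Variables (phi : sft M -> R) (Kphi : R).
Hypothesis phiK : regular rho Kphi phi.
Hypothesis phi_gibbs : gibbs phi mu.
Variables (d : nat) (t : 'I_d -> sft M -> R) (Kt : R).
Hypothesis Kt_gt0 : 0 < Kt.
Hypothesis tK : forall i, regular rho Kt (t i).
Hypothesis t_mean : forall i, zero_mean mu (t i).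
Hypothesis not_coboundary :
  forall x, (exists i, x i != 0) -> ~ coboundary (combination t x).
Implicit Types (a b : A) (u v w : seq A) (x y : sft M) (n : nat -> nat)
  (z : nat -> 'I_d -> R).
Local Notation E := (energy phi).
Local Notation Fv := (fun i => energy (t i)).

Let mu_inv : shift_invariant mu. Proof. by case: phi_gibbs. Qed.

Definition gauss (c : R) (m : nat) (r : 'I_d -> R) : R :=
  (Num.sqrt m%:R)^-1 ^+ d * expR (- (c * ((\sum_i r i ^+ 2) / m%:R))).

Lemma gauss_ge0 c m r : 0 <= gauss c m r.
Proof. by rewrite mulr_ge0 ?expR_ge0// exprn_ge0// invr_ge0 sqrtr_ge0. Qed.

Definition visits s n z : set (sft M) := [set x | forall j, (1 <= j <= s)%N ->
  forall i, `|birkhoff (t i) (n j) x - z j i| <= 2^-1].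

Lemma visits_meas s n z : measurable (visits s n z).
Proof.
have -> : visits s n z = \bigcap_(j in [set j | (1 <= j <= s)%N]) \bigcap_(i in [set: 'I_d])
    [set x | `|birkhoff (t i) (n j) x - z j i| <= 2^-1].
  by apply/seteqP; split=> x h j hj => [i _|i]; apply: h.
rewrite -[X in measurable X]setCK; apply: measurableC; apply: open_meas.
rewrite openC; apply: closed_bigI => j _; apply: closed_bigI => i _.
have -> : [set x | `|birkhoff (t i) (n j) x - z j i| <= 2^-1] =
    birkhoff (t i) (n j) @^-1` `[z j i - 2^-1, z j i + 2^-1].
  by apply/funext => x; rewrite /preimage /= in_itv /= ler_distl.
apply: preimage_closed; last exact: itv_closed.
by move=> x _; apply: birkhoff_continuous; exact: regular_continuous (tK i).
Qed.

Let slack := Kt * (2 / (1 - rho)) + Kt.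

(** The blocks start at time [1], so that the initial word is one letter and not
    empty; the value at time [0] goes into [slack]. *)
Lemma energy_after_start i m x :
  `|birkhoff (t i) m (sigma x) - energy (t i) (word m.+1 x)| <= slack.
Proof.
have := energy_word rho01 x (tK i) (ltn0Sn m).
rewrite -{1}add1n birkhoffD [birkhoff _ 1 _]big_ord1 /= => h.
have [tb _] := tK i; have := tb x.
move: h; rewrite !ler_norml /slack => /andP[h1 h2] /andP[h3 h4]; apply/andP; split; lra.
Qed.

Lemma visits_near s n z k u w x : n 0%N = 0%N -> (forall i, z 0%N i = 0) -> (k < s)%N ->
  size u = (n k).+1 -> size (w ++ u) = (n k.+1).+1 ->
  visits s n z (sigma x) -> cyl (w ++ u) x ->
  near_at Fv (1 + 2 * slack) (fun i => z k.+1 i - z k i) u (w ++ u).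
Proof.
move=> n0 z0 ks su swu vx xwu.
have close j i : (j <= s)%N -> `|birkhoff (t i) (n j) (sigma x) - z j i| <= 2^-1.
  case: j => [|j] js; last exact: vx.
  by rewrite n0 z0 /birkhoff big_ord0 subrr normr0.
have xu : word (n k).+1 x = u.
  move: xwu; rewrite /cyl /= size_cat addnC word_shift => /eqP.
  by rewrite eqseq_cat ?size_word// su => /andP[_ /eqP].
move: xwu; rewrite /cyl /= swu => xwu; apply/forallP => i.
have h1 := energy_after_start i (n k) x; have h2 := energy_after_start i (n k.+1) x.
have h3 := close k i (ltnW ks); have h4 := close k.+1 i ks.
rewrite xu in h1; rewrite xwu in h2; clear -h1 h2 h3 h4.
set c := energy _ (w ++ u) in h2 *; set e := energy _ u in h1 *.
move: h1 h2 h3 h4; rewrite !ler_norml.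
by move=> /andP[a1 a2] /andP[b1 b2] /andP[e1 e2] /andP[f1 f2]; apply/andP; split; lra.
Qed.

(** Blocks are integrated from the last one to the first one: for a word [u] read
    during the first [k] blocks, the mass of the event inside the cylinder of
    [u] is at most the Gibbs weight of [u] times the Gaussian factors of the
    remaining blocks, because the bound for one block is uniform in the past. *)
Theorem visits_bound s : (1 <= s)%N -> exists C c, [/\ 0 < C, 0 < c &
  forall n z, n 0%N = 0%N -> (forall j, (j < s)%N -> (n j < n j.+1)%N) ->
    (forall i, z 0%N i = 0) ->
  (mu (visits s n z) <= (\prod_(0 <= j < s)
     (C * gauss c (n j.+1 - n j) (fun i => z j.+1 i - z j i)))%:E)%E].
Proof.
move=> s1; have r01 := rho01; case/andP: rho01 => r0 r1.
have slack0 : 0 <= 1 + 2 * slack.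
  have : 0 <= Kt * (2 / (1 - rho)) by rewrite mulr_ge0 ?(ltW Kt_gt0)// divr_ge0// subr_ge0 ltW.
  by move: Kt_gt0; rewrite /slack; lra.
have [C [c [C0 c0 lb]]] :=
  energy_local_bound rho01 phiK phi_gibbs Kt_gt0 tK t_mean not_coboundary slack0.
have [P [c1 [c2 [c10 c20 cylP]]]] := cyl_bounds phi_gibbs.
have [Cz Cz0 pb] := partfn_le rho01 phiK c10 cylP.
pose S := \sum_(a : A) c2 * expR (E [:: a] - P * 1%:R).
have S0 : 0 <= S by apply: sumr_ge0 => a _; rewrite mulr_ge0 ?expR_ge0// ltW.
pose C3 := C * Cz; have C30 : 0 < C3 by exact: mulr_gt0.
exists ((S + 1) * C3), c; split => //; first by rewrite mulr_gt0// ltr_wpDl.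
move=> n z n0 ninc z0.
pose D := sigma @^-1` visits s n z.
have mD : measurable D.
  by rewrite -[D]setTI; apply: shift_meas => //; exact: visits_meas.
pose B j := C3 * gauss c (n j.+1 - n j) (fun i => z j.+1 i - z j i).
have B0 j : 0 <= B j by rewrite mulr_ge0 ?gauss_ge0// ltW.
have claim l k u : (k + l = s)%N -> adm u -> size u = (n k).+1 ->
    (mu (cyl u `&` D) <= (c2 * expR (E u - P * (n k).+1%:R) * \prod_(k <= j < s) B j)%:E)%E.
  elim: l k u => [|l IH] k u kl hu su.
    rewrite addn0 in kl; rewrite kl in su *; rewrite big_geq// mulr1.
    have u0 : u != [::] by case: (u) su.
    have [_] := cylP u u0 hu; rewrite su; apply: le_trans.
    by apply: le_measure; rewrite ?inE//; [apply: measurableI => //|]; exact: cyl_meas.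
  have ks : (k < s)%N by rewrite -kl addnS ltnS leq_addr.
  have nk := ninc k ks; pose m := (n k.+1 - n k)%N; have m0 : (0 < m)%N by rewrite subn_gt0.
  case: u su hu => // b u su hu.
  pose Pk := \prod_(k.+1 <= j < s) B j.
  have Pk0 : 0 <= Pk by apply: prodr_ge0 => j _; exact: B0.
  pose zk i := z k.+1 i - z k i.
  pose N v : R := (near_at Fv (1 + 2 * slack) zk (b :: u) v)%:R.
  apply: (@le_trans _ _ (expR (E (b :: u)) *
      transfer E m (fun v => c2 * expR (- (P * (n k.+1).+1%:R)) * Pk * N v) (b :: u))%:E).
    apply: (@part_le _ _ phi (fun u => mu (cyl u `&` D))) => // [v _|w sw hw].
      exact: measure_split.
    have swu : size (w ++ b :: u) = (n k.+1).+1 by rewrite size_cat sw su addnS subnK// ltnW.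
    have [near|far] := boolP (near_at Fv (1 + 2 * slack) zk (b :: u) (w ++ b :: u)).
      apply: le_trans (IH k.+1 _ _ hw swu) _; first by rewrite addSnnS.
      rewrite lee_fin /N near mulr1 expRD -/Pk le_eqVlt; apply/predU1P; left; ring.
    rewrite (_ : cyl (w ++ b :: u) `&` D = set0).
      by rewrite measure0 lee_fin mulr_ge0 ?expR_ge0// mulr_ge0// mulr_ge0// mulr_ge0 ?expR_ge0// ltW.
    apply/seteqP; split=> // x [xw xD]; move/negP: far; apply.
    exact: (visits_near n0 z0 ks su swu xD xw).
  rewrite lee_fin transferZ big_ltn// -/Pk.
  have := lb m zk b u m0 hu; rewrite -/(N) => h.
  have {}h : transfer E m N (b :: u) <= B k * expR (P * m%:R).
    apply: le_trans h _; rewrite /B /C3 /gauss -/m -/zk.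
    have h := pb m b u hu; set ga := expR (- _); set sq := _ ^+ d.
    apply: (@le_trans _ _ (C * sq * ga * (Cz * expR (P * m%:R)))).
      rewrite ler_wpM2l// mulr_ge0 ?expR_ge0// mulr_ge0 ?(ltW C0)//.
      by rewrite exprn_ge0// invr_ge0 sqrtr_ge0.
    by rewrite le_eqVlt; apply/predU1P; left; ring.
  have em : P * (n k.+1).+1%:R = P * (n k).+1%:R + P * m%:R.
    by rewrite -mulrDr -natrD addSn subnKC// ltnW.
  apply: (@le_trans _ _ (expR (E (b :: u)) * (c2 * expR (- (P * (n k.+1).+1%:R)) * Pk *
      (B k * expR (P * m%:R))))).
    rewrite ler_pM2l ?expR_gt0// ler_wpM2l//.
    by rewrite mulr_ge0// mulr_ge0 ?expR_ge0// ltW.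
  rewrite em opprD !expRD !expRN le_eqVlt; apply/predU1P; left; field.
  by rewrite !gt_eqF ?expR_gt0.
have -> : (mu (visits s n z) = mu (cyl [::] `&` D))%E.
  by rewrite cyl_nil setTI; apply/esym/mu_inv; exact: visits_meas.
rewrite measure_split//.
apply: (@le_trans _ _ ((S * \prod_(0 <= j < s) B j)%:E)).
  rewrite /S mulr_suml -sumEFin; apply: lee_sum => a _.
  by have := claim s 0%N [:: a] (add0n s) isT; rewrite n0; apply.
(* As [1 <= s], the constant [S] of the starting letters is absorbed once in the
   product. *)
rewrite lee_fin [leRHS](eq_bigr (fun j => (S + 1) * B j)); last by move=> j _; rewrite -mulrA.
rewrite [leRHS]big_split/= prodr_const_nat subn0 ler_wpM2r//; first exact: prodr_ge0.
by apply: (@le_trans _ _ (S + 1)); [rewrite lerDl|rewrite ler_eXnr// lerDr].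
Qed.

End Blocks.

(** * Hoelder functions and conclusion *)

Section Hoelder.
Variables (R : realType) (M : transition).
Implicit Types (x y : sft M) (f : sft M -> R).

(** A rate whose cube dominates [theta], by Bernoulli's inequality. *)
Lemma cubic_rate (theta : R) : 0 < theta < 1 ->
  0 < 1 - (1 - theta) / 3 < 1 /\ theta <= (1 - (1 - theta) / 3) ^+ 3.
Proof.
move=> /andP[t0 t1]; split; first by apply/andP; split; lra.
have -> : (1 - (1 - theta) / 3) ^+ 3 = theta + (1 - theta) ^+ 2 / 3 * (1 - (1 - theta) / 9).
  by field.
rewrite lerDl mulr_ge0 ?divr_ge0 ?sqr_ge0//; lra.
Qed.

Lemma hoelder_regular (theta0 theta C B : R) f :
  0 < theta0 -> theta0 <= theta -> theta < 1 ->
  (forall k x y, agree k x y -> `|f x - f y| <= C * theta0 ^+ k) ->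
  `|f (start (letter0 M))| <= B ->
  regular (1 - (1 - theta) / 3) (B + `|C|) f.
Proof.
move=> t0 tt t1 fC fB; pose x0 := start (letter0 M).
have [/andP[r0 r1] cube] : 0 < 1 - (1 - theta) / 3 < 1 /\ theta <= (1 - (1 - theta) / 3) ^+ 3.
  by apply: cubic_rate; rewrite (lt_le_trans t0 tt).
set rho := 1 - _ in r0 r1 cube *.
have B0 : 0 <= B by exact: le_trans fB.
split=> [x|k x y xy].
  have -> : f x = f x0 + (f x - f x0) by ring.
  apply: le_trans (ler_normD _ _) _; apply: lerD => //.
  apply: le_trans (fC 0%N x x0 _) _ => //.
  by rewrite expr0 mulr1 ler_norm.
apply: le_trans (fC k x y xy) _; rewrite exprM.
apply: (@le_trans _ _ (`|C| * theta0 ^+ k)).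
  by rewrite ler_wpM2r ?ler_norm// exprn_ge0// ltW.
apply: ler_pM; rewrite ?exprn_ge0 ?(ltW t0) ?lerDr//.
by rewrite lerXn2r ?nnegrE ?exprn_ge0 ?(ltW t0) ?(ltW r0)// (le_trans tt).
Qed.

End Hoelder.

Lemma coord_le_norm (R : realType) (d : nat) (v : 'rV[R]_d) i : `|v 0 i| <= `|v|.
Proof.
rewrite /Num.norm /= mx_normrE.
exact: (le_bigmax _ (fun ij : 'I_1 * 'I_d => `|v ij.1 ij.2|) (0, i)).
Qed.

Lemma gauss_powR (R : realType) (d : nat) (c : R) (m : nat) (v : 'rV[R]_d) :
  gauss c m (fun i => v 0 i) =
  (m%:R `^ (d%:R / 2))^-1 * expR (- (c * (enorm v ^+ 2 / m%:R))).
Proof.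
rewrite /gauss /enorm sqr_sqrtr; last first.
  by apply: sumr_ge0 => i _; rewrite -expr2 sqr_ge0.
congr (_ * expR (- (c * (_ / _)))).
  by rewrite exprVn mulrC powRrM powR12_sqrt// powR_mulrn.
Qed.

Theorem lemmaA4 (R : realType) (M : transition) (mu : probability (sft M) R)
    (phi : sft M -> R) (d : nat) (tau : sft M -> 'rV[R]_d) :
  holder (phi : sft M -> R^o) ->
  gibbs phi mu ->
  holder tau ->
  (forall i : 'I_d, (\int[mu]_x (tau x 0 i)%:E = 0)%E) ->
  (forall a : 'rV[R]_d, a != 0 -> ~ coboundary (fun x => dotv a (tau x))) ->
  forall s : nat, (1 <= s)%N ->
  exists C c : R, [/\ 0 < C, 0 < c &
    forall (n : nat -> nat) (z : nat -> 'rV[R]_d),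
      n 0%N = 0%N ->
      (forall j : nat, (j < s)%N -> (n j < n j.+1)%N) ->
      z 0%N = 0 ->
      (mu [set x | forall j : nat, (1 <= j <= s)%N ->
                   unit_cube (z j) (birkhoff tau (n j) x)]
       <= (\prod_(1 <= j < s.+1)
             (C / ((n j - n j.-1)%N%:R `^ (d%:R / 2)) *
              expR (- (c * (enorm (z j - z j.-1) ^+ 2 /
                            (n j - n j.-1)%N%:R)))))%:E)%E].
Proof.
move=> [Cp [tp [tp0 tp1 phiH]]] phi_gibbs [Ct [tt [tt0 tt1 tauH]]] tau0 tauN s s1.
pose theta := Num.max tp tt.
have theta1 : theta < 1 by rewrite gt_max tp1.
have theta01 : 0 < theta < 1 by rewrite theta1 andbT lt_max tp0.
have [rho01 _] := cubic_rate theta01; set rho := 1 - _ in rho01.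
pose x0 : sft M := start (letter0 M).
pose t (i : 'I_d) x : R := tau x 0 i.
have phiK : regular rho (`|phi x0| + `|Cp|) phi.
  by apply: (hoelder_regular tp0 _ theta1 phiH) => //; rewrite le_max lexx.
have tK i : regular rho (`|tau x0| + 1 + `|Ct|) (t i).
  apply: (@hoelder_regular _ _ tt _ _ _ _ tt0 _ theta1); first by rewrite le_max lexx orbT.
    move=> k x y xy; apply: le_trans (tauH k x y xy).
    by have := coord_le_norm (tau x - tau y) i; rewrite !mxE.
  by apply: (le_trans (coord_le_norm _ _)); rewrite lerDl.
have Kt0 : 0 < `|tau x0| + 1 + `|Ct| by rewrite ltr_wpDr// ltr_wpDl.
have notco (a : 'I_d -> R) : (exists i, a i != 0) -> ~ coboundary (combination t a).
  move=> [i ai] co; apply: (tauN (\row_j a j)).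
    by apply: contra_neq ai => /rowP /(_ i); rewrite !mxE.
  rewrite (_ : (fun _ => _) = combination t a)//.
  by apply/funext => x; apply: eq_bigr => j _; rewrite mxE.
have [C [c [C0 c0 bound]]] :=
  visits_bound rho01 phiK phi_gibbs Kt0 tK tau0 notco s1.
exists C, c; split => // n z n0 ninc z0.
have -> : [set x | forall j, (1 <= j <= s)%N -> unit_cube (z j) (birkhoff tau (n j) x)] =
    visits t s n (fun j i => z j 0 i).
  apply/seteqP; split=> x h j hj i; have := h j hj i;
    by rewrite /birkhoff summxE.
apply: le_trans (bound n (fun j i => z j 0 i) n0 ninc _) _.
  by move=> i; rewrite z0 mxE.
rewrite lee_fin big_add1 /= le_eqVlt; apply/orP; left; apply/eqP.
apply: eq_bigr => j _; rewrite -mulrA -gauss_powR; congr (_ * gauss _ _ _).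
by apply/funext => i; rewrite !mxE.
Qed.
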